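(* Let $p$ be a prime and $s\ge 2$. If $f$ is the $s$-player version of one of $\textsc{Rank}_{n,n-1}$, $\textsc{Inverse}_n$, or $\textsc{SolveLinearSystem}_{n,b}$ (with $b\in\mathbb{F}_p^n$ fixed and non-zero), then $R^s_{1/40}(f)=\Omega(sn^2\log p)$. Further, $R^s_{1/12}(\textsc{IP}_n)=\Omega(sn\log p)$ and $R^s_{1/12}(\textsc{Ham}_{n,k})=\Omega(sk)$.
   Context: Coordinator model: there are $s$ players and an additional coordinator with no input; players communicate only with the coordinator, who outputs the answer; protocols may use public randomness. $R^s_\delta(f)$ is the minimum, over such protocols that are correct with probability at least $1-\delta$ on every input satisfying the promise, of the maximum total number of bits communicated. Matrix problems: Player $i$ holds $x^{(i)}\in M_n(\mathbb{F}_p)$ and $z=x^{(1)}+\cdots+x^{(s)}$. $\textsc{Rank}_{n,n-1}$: promise $\mathrm{rk}(z)\in\{n-1,n\}$, compute $\mathrm{rk}(z)$. $\textsc{Inverse}_n$: promise $z$ invertible, decide whether $(z^{-1})_{11}=0$. $\textsc{SolveLinearSystem}_{n,b}$: promise $z$ invertible, decide whether the first coordinate of the solution $t$ of $zt=b$ is zero. $\textsc{IP}_n$: Player $i$ holds $x^{(i)}\in\mathbb{F}_p^n$; with the promise that the generalized inner product $\sum_{j=1}^n\prod_{i=1}^s x^{(i)}_j$ (computed in $\mathbb{F}_p$) lies in $\{0,1\}$, compute it. $\textsc{Ham}_{n,k}$: Player $i$ holds $x^{(i)}\in\mathbb{F}_2^n$, $z=\sum_i x^{(i)}$; with the promise that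 the Hamming weight (number of ones) of $z$ is in $\{k,k+2\}$, compute it.
   Formalization: The Ham bound is proved for k ≤ (1−ε)n, for each fixed ε > 0, with constants depending on ε; for k near n the claim Ω(sk) is false (for k = n−1 the promise fixes the answer, for k = n−2 O(s) bits suffice). *)

(* Defs.v *)
From HB Require Import structures.
From mathcomp Require Import all_boot all_order all_algebra.
From mathcomp Require Import all_classical all_reals all_analysis.

Set Implicit Arguments.
Unset Strict Implicit.
Unset Printing Implicit Defensive.

Import Order.TTheory GRing.Theory Num.Theory.

Local Open Scope classical_set_scope.
Local Open Scope ring_scope.

(* What one player has seen on its private channel, oldest bit first:
   [inl b] is a bit [b] received from the coordinator, [inr b] a bit [b] sent
   to the coordinator. *)
Definition view := seq (bool + bool).

(* The coordinator has no input, so (once the public randomness is fixed) all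
   it knows is the position reached in this tree. [Send i b t] sends the bit
   [b] to player [i]; [Ask i t] waits for one bit of player [i]. Both transmit
   exactly one bit. *)
Inductive coordinator (s : nat) (A : Type) : Type :=
| Output of A
| Send of 'I_s & bool & coordinator s A
| Ask of 'I_s & (bool -> coordinator s A).

(* The bits of a player are a function of its own input and its own view only:
   it does not see the traffic between the coordinator and the others. *)
Record dprotocol (s : nat) (X A : Type) := DProtocol {
  center : coordinator s A;
  reply : 'I_s -> X -> view -> bool }.

Definition record_bit (s : nat) (i : 'I_s) (e : bool + bool)
    (h : 'I_s -> view) : 'I_s -> view :=
  fun j => if j == i then rcons (h j) e else h j.

(* Pair of the total number of bits transmitted and the final output, when
   player [i] answers according to [r i] and [h i] is its view so far. *)
Fixpoint run (s : nat) (A : Type) (r : 'I_s -> view -> bool)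
    (h : 'I_s -> view) (t : coordinator s A) : nat * A :=
  match t with
  | Output a => (0%N, a)
  | Send i b t' =>
      let u := run r (record_bit i (inl b) h) t' in (u.1.+1, u.2)
  | Ask i t' =>
      let b := r i (h i) in
      let u := run r (record_bit i (inr b) h) (t' b) in (u.1.+1, u.2)
  end.

Definition execute (s : nat) (X A : Type) (P : dprotocol s X A)
    (x : 'I_s -> X) : nat * A :=
  run (fun i => reply P i (x i)) (fun=> [::]) (center P).

(* Public randomness: a coin with an arbitrary distribution on a finite set,
   seen by the coordinator and by all the players. Finite sets lose nothing:
   on finite inputs, deterministic protocols of bounded cost have only finitely
   many input/output/cost behaviours. *)
Record protocol (R : realType) (s : nat) (X A : Type) := Protocol {
  coin : finType;
  coin_pr : coin -> R;
  coin_pr_ge0 : forall w, 0 <= coin_pr w;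
  coin_pr_sum1 : \sum_w coin_pr w = 1;
  strategy : coin -> dprotocol s X A }.

Arguments coin_pr {R s X A} p w.
Arguments strategy {R s X A} p w.

Record problem (s : nat) (X A : Type) := Problem {
  promise : ('I_s -> X) -> bool;
  answer : ('I_s -> X) -> A }.

Definition success_pr (R : realType) (s : nat) (X : Type) (A : eqType)
    (f : problem s X A) (P : protocol R s X A) (x : 'I_s -> X) : R :=
  \sum_(w | (execute (strategy P w) x).2 == answer f x) coin_pr P w.

Definition correct (R : realType) (s : nat) (X : Type) (A : eqType) (delta : R)
    (f : problem s X A) (P : protocol R s X A) : Prop :=
  forall x : 'I_s -> X, promise f x -> 1 - delta <= success_pr f P x.

(* Inputs that violate the promise count too; this does not change the minimal
   cost, since a run can be cut off at the maximum over the promise. *)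
Definition cost (R : realType) (s : nat) (X : finType) (A : Type)
    (P : protocol R s X A) : nat :=
  \max_(w : coin P) \max_(x : {ffun 'I_s -> X}) (execute (strategy P w) x).1.

(* As costs are natural numbers, this infimum is a minimum (and it would be
   [+oo] if no protocol were correct). *)
Definition rand_cc (R : realType) (s : nat) (X : finType) (A : eqType)
    (delta : R) (f : problem s X A) : \bar R :=
  ereal_inf [set y | exists2 P : protocol R s X A,
                       correct delta f P & y = (cost P)%:R%:E].

Definition total (V : nmodType) (s : nat) (x : 'I_s -> V) : V := \sum_i x i.

(* The matrices below are indexed by ['I_n.+1], so that [ord0] is the first
   row or column. *)

Definition rank_problem (p s n : nat) : problem s 'M['F_p]_n.+1 nat :=
  {| promise x := (\rank (total x) == n) || (\rank (total x) == n.+1);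
     answer x := \rank (total x) |}.

Definition inverse_problem (p s n : nat) : problem s 'M['F_p]_n.+1 bool :=
  {| promise x := total x \in unitmx;
     answer x := invmx (total x) ord0 ord0 == 0 |}.

Definition solve_problem (p s n : nat) (b : 'cV['F_p]_n.+1) :
    problem s 'M['F_p]_n.+1 bool :=
  {| promise x := total x \in unitmx;
     answer x := [exists t : 'cV['F_p]_n.+1,
                    (total x *m t == b) && (t ord0 ord0 == 0)] |}.

Definition inner_product (p s n : nat) (x : 'I_s -> 'rV['F_p]_n) : 'F_p :=
  \sum_(j < n) \prod_(i < s) x i ord0 j.

Definition ip_problem (p s n : nat) : problem s 'rV['F_p]_n 'F_p :=
  {| promise x := (inner_product x == 0) || (inner_product x == 1);
     answer x := inner_product x |}.

Definition hamming_weight (n : nat) (z : 'rV['F_2]_n) : nat :=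
  #|[pred j | z ord0 j == 1]|.

Definition ham_problem (s n k : nat) : problem s 'rV['F_2]_n nat :=
  {| promise x := (hamming_weight (total x) == k)
                  || (hamming_weight (total x) == k.+2);
     answer x := hamming_weight (total x) |}.

(* Main.v *)
(* Symmetrization: if the players hold a random sharing of a hard input, an
   average player exchanges only a 1/s fraction of the bits with the coordinator.
   Once the view of player i is cut at a multiple of that length, the accepted
   inputs split into few combinatorial rectangles for player i against all the
   others, so it is enough to find signed weights F = F0 - G that are small on
   every rectangle but correlate with every correct protocol.

   Rank: W(z) = sum over invertible R of chi(tr(R z)) has rectangle discrepancy at
   most |M_n|^2 by Parseval, while a recursion on the corner entry of R gives its
   value (-1)^k q^(sum_(n-k <= i < n) i) |GL_(n-k)| at rank k. Hence W has opposite
   signs on coranks 0 and 1, where most of its mass lies, and the total mass of the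
   coranks at least 3, whose acceptance is not controlled, is small enough.
   Inverse: z is tested for invertibility by bordering it with random vectors and
   corners 0 and 1. If z is invertible, so is one of the two bordered matrices, and
   its inverse has a nonzero corner; if z has corank 1, both are invertible with
   probability at least 1/4 and then their inverses have corner 0. A linear change
   of variables turns the right-hand side b into the first basis vector, so solving
   is as hard as inverting.

   For p >= 3 the inner product is shared multiplicatively by nonzero entries, and
   its discrepancy is bounded with characters. For p = 2 and for the Hamming weight
   the hard problem is unique disjointness: a rectangle that contains disjoint pairs
   with probability mu contains uniquely intersecting pairs with probability at
   least 3/20 mu - exp(-Omega(n)), because otherwise many coordinates would be
   biased inside the rectangle. *)

From HB Require Import structures.
From mathcomp Require Import all_boot all_order all_algebra.
From mathcomp Require Import all_classical all_reals all_analysis.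
From mathcomp Require Import algC cyclotomic ring lra zify.
Require Import Defs.

Set Implicit Arguments.
Unset Strict Implicit.
Unset Printing Implicit Defensive.

Import Order.TTheory GRing.Theory Num.Theory.

Local Open Scope ring_scope.

(** * Views and rectangles *)

(** A promise protocol is unconstrained off the promise, so the weights are one-sided: [F] only has
    to dominate [F0 - G], where [G] carries the inputs whose acceptance counts against the bound.
    Corank 2 costs nothing, since the rank kernel is positive there; coranks at least 3 are charged
    as if always accepted, which for the tester of inverses leaves a positive margin only after
    repetition. Characters live in [algC] and costs in [R]; the kernels are integer valued, so the
    discrepancy bounds pass through [int]. For p = 2 the only nonzero entry is 1, and multiplicative
    sharing has no randomness left. Instead a centre holds one side Y of a disjoint pair, and every
    other player holds an independent sample of the other side given Y, so each of them forms a hard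
    pair with the centre. The decision compares the inner product with the parity of Y; it reads the
    centre's input, so the centre is left out of the average. For the Hamming weight with bounded k
    an exponential bound says nothing. Cutting the views at length 0 then still gives a bound linear
    in s, and the two bounds are combined. *)

Definition upd (s : nat) (V : Type) (x : {ffun 'I_s -> V}) (i : 'I_s) (a : V) :
    {ffun 'I_s -> V} :=
  [ffun j => if j == i then a else x j].

Lemma updE s V (x : {ffun 'I_s -> V}) i a j :
  upd x i a j = if j == i then a else x j.
Proof. by rewrite ffunE. Qed.

Lemma upd_id s V (x : {ffun 'I_s -> V}) i : upd x i (x i) = x.
Proof. by apply/ffunP => j; rewrite updE; case: eqP => // ->. Qed.

Lemma upd_upd s V (x : {ffun 'I_s -> V}) i a b : upd (upd x i a) i b = upd x i b.
Proof. by apply/ffunP => j; rewrite !updE; case: eqP. Qed.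

Fixpoint views (s : nat) (A : Type) (r : 'I_s -> view -> bool)
    (h : 'I_s -> view) (t : coordinator s A) : 'I_s -> view :=
  match t with
  | Output _ => h
  | Send i b t' => views r (record_bit i (inl b) h) t'
  | Ask i t' => let b := r i (h i) in views r (record_bit i (inr b) h) (t' b)
  end.

Definition view_of (s : nat) (X A : Type) (P : dprotocol s X A)
    (x : {ffun 'I_s -> X}) : 'I_s -> view :=
  views (fun i => reply P i (x i)) (fun=> [::]) (center P).

Lemma sum_record_bit s i e (h : 'I_s -> view) :
  (\sum_j size (record_bit i e h j) = (\sum_j size (h j)).+1)%N.
Proof.
rewrite (bigD1 i) //= [in RHS](bigD1 i) //= /record_bit eqxx size_rcons addSn.
by congr (_ + _).+1; apply: eq_bigr => j /negbTE ->.
Qed.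

Lemma cost_views s A (r : 'I_s -> view -> bool) (t : coordinator s A) h :
  ((run r h t).1 + \sum_j size (h j) = \sum_j size (views r h t j))%N.
Proof.
elim: t h => [a|i b t IH|i t IH] h //=.
- by rewrite -IH sum_record_bit addSnnS.
- by rewrite -IH sum_record_bit addSnnS.
Qed.

Lemma cost_view_of s X A (P : dprotocol s X A) (x : {ffun 'I_s -> X}) :
  (execute P x).1 = (\sum_j size (view_of P x j))%N.
Proof. by rewrite /view_of -cost_views /= big1 // addn0. Qed.

(* A function [rho] from views to bits could have produced the entries of [H]
   after the first [m] ones. *)
Definition consistent (rho : view -> bool) (m : nat) (H : view) : Prop :=
  forall k b, (m <= k)%N -> onth H k = Some (inr b) -> rho (take k H) = b.

Lemma views_prefix s A r i (t : coordinator s A) h : prefix (h i) (views r h t i).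
Proof.
elim: t h => [a|j b t IH|j t IH] h /=; first exact: prefix_refl.
all: have pre e : prefix (h i) (record_bit j e h i)
  by rewrite /record_bit; case: eqP => _; rewrite ?prefix_refl ?prefix_rcons.
- exact: prefix_trans (pre _) (IH _).
- exact: prefix_trans (pre _) (IH _ _).
Qed.

Lemma views_consistent s A r i (t : coordinator s A) h :
  consistent (r i) (size (h i)) (views r h t i).
Proof.
elim: t h => [a|j b t IH|j t IH] h //= k b'.
- by move=> hk; rewrite onth_default.
- rewrite leq_eqVlt => /orP[/eqP <-|hk]; last first.
    apply: IH; rewrite /record_bit; case: eqP => _ //; last exact: ltnW.
    by rewrite size_rcons.
  have /prefixP[u] := views_prefix r i t (record_bit j (inl b) h).
  rewrite /record_bit; case: eqP => [_ Hu|ji _].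
    by rewrite Hu onth_cat size_rcons ltnSn -cats1 onth_cat ltnn subnn.
  by move=> hb; apply: IH hb; rewrite /record_bit; case: eqP.
- rewrite leq_eqVlt => /orP[/eqP <-|hk]; last first.
    apply: IH; rewrite /record_bit; case: eqP => _ //; last exact: ltnW.
    by rewrite size_rcons.
  have /prefixP[u] := views_prefix r i (t (r j (h j)))
     (record_bit j (inr (r j (h j))) h).
  rewrite /record_bit; case: eqP => [<- Hu|ji _].
    rewrite Hu onth_cat size_rcons ltnSn -cats1 onth_cat ltnn subnn /= => -[<-].
    by rewrite -catA take_size_cat.
  by move=> hb; apply: IH hb; rewrite /record_bit; case: eqP.
Qed.

(** Every bit asked of player [i] is already prescribed by the old view, so the two runs follow the
    same branch of the tree. *)
Lemma run_consistent s A (r r' : 'I_s -> view -> bool) i (t : coordinator s A) h :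
  (forall j, j != i -> r j = r' j) ->
  consistent (r i) (size (h i)) (views r' h t i) ->
  (run r h t).2 = (run r' h t).2 /\ views r h t = views r' h t.
Proof.
move=> rr'; elim: t h => [a|j b t IH|j t IH] h //= hc.
- apply: IH => k b' hk; apply: hc; apply: leq_trans hk.
  by rewrite /record_bit; case: eqP => // _; rewrite size_rcons.
- suff E : r j (h j) = r' j (h j).
    rewrite E; apply: IH => k b' hk; apply: hc; apply: leq_trans hk.
    by rewrite /record_bit; case: eqP => // _; rewrite size_rcons.
  case: (eqVneq j i) => [ji|/rr' -> //]; subst j.
  have := hc (size (h i)) (r' i (h i)) (leqnn _).
  have /prefixP[u] := views_prefix r' i (t (r' i (h i)))
     (record_bit i (inr (r' i (h i))) h).
  have -> : record_bit i (inr (r' i (h i))) h i = rcons (h i) (inr (r' i (h i))).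
    by rewrite /record_bit eqxx.
  move=> ->; rewrite -cats1 -catA take_size_cat // onth_cat ltnn subnn /=; exact.
Qed.

Lemma cut_and_paste s X A (P : dprotocol s X A) (x x' : {ffun 'I_s -> X}) i :
  consistent (reply P i (x i)) 0 (view_of P x' i) ->
  (execute P (upd x' i (x i))).2 = (execute P x').2 /\
  view_of P (upd x' i (x i)) = view_of P x'.
Proof.
move=> hc; apply: (@run_consistent _ _ _ _ i) => [j ji|].
  by rewrite updE (negbTE ji).
by rewrite updE eqxx.
Qed.

Lemma view_of_consistent s X A (P : dprotocol s X A) (x : {ffun 'I_s -> X}) i :
  consistent (reply P i (x i)) 0 (view_of P x i).
Proof. exact: (@views_consistent _ _ (fun i => reply P i (x i)) i _ (fun=> [::])). Qed.

(** Short views, padded with [None], become words over a five-letter alphabet; this is the origin of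
    the [5] in all the bounds. *)
Definition view_code (c : nat) (h : view) : {ffun 'I_c -> option (bool + bool)} :=
  [ffun k => onth h (k : 'I_c)].

Lemma view_code_inj c : {in [pred h | (size h <= c)%N] &, injective (@view_code c)}.
Proof.
move=> h h' hc hc' /ffunP E; apply: eq_from_onth => k.
case: (ltnP k c) => [kc|ck]; first by have := E (Ordinal kc); rewrite !ffunE.
rewrite !onth_default //; first exact: leq_trans hc' ck.
exact: leq_trans hc ck.
Qed.

(* Cut-and-paste form of: [E] is a combinatorial rectangle for the partition of
   the players into [i] and the others. *)
Definition rectangle (s : nat) (V : Type) (i : 'I_s) (E : pred {ffun 'I_s -> V}) :=
  forall x x', E x -> E x' -> E (upd x' i (x i)).

(** The degenerate rectangle of an empty view: the input of a player who exchanges no bit has no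
    influence. *)
Definition cylinder (s : nat) (V : Type) (i : 'I_s) (E : pred {ffun 'I_s -> V}) :=
  forall x a, E x -> E (upd x i a).

(** * From protocols to rectangle bounds *)

(* The decision may look at the inputs, see [blind]. *)
Record tester (R : realType) (s : nat) (V A : Type) := Tester {
  coins : finType;
  weight : coins -> R;
  weight_ge0 : forall w, 0 <= weight w;
  weight_sum1 : \sum_w weight w = 1;
  calls : finType;
  subprotocol : coins -> calls -> dprotocol s V A;
  test : coins -> {ffun 'I_s -> V} -> (calls -> A) -> bool }.

Arguments weight {R s V A} t w.
Arguments subprotocol {R s V A} t w j.
Arguments test {R s V A} t w x o.

Definition accepts (R : realType) s V A (T : tester R s V A) w x : bool :=
  test T w x (fun j => (execute (subprotocol T w j) x).2).

Arguments accepts {R s V A} T w x.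

Definition accept_pr (R : realType) s V A (T : tester R s V A) x : R :=
  \sum_(w | accepts T w x) weight T w.

Definition calls_cost_le (R : realType) s V A (T : tester R s V A) (C : nat) :=
  forall w j (x : {ffun 'I_s -> V}), ((execute (subprotocol T w j) x).1 <= C)%N.

(** A decision that depended on the input of player [i] would destroy the rectangle structure of the
    accepted inputs for that player. *)
Definition blind (R : realType) s V A (T : tester R s V A) (i : 'I_s) :=
  forall w x a o, test T w (upd x i a) o = test T w x o.

Definition brief (R : realType) s V A (T : tester R s V A) c w i
    (x : {ffun 'I_s -> V}) : bool :=
  [forall j, size (view_of (subprotocol T w j) x i) <= c]%N.

Arguments accept_pr {R s V A} T x.
Arguments brief {R s V A} T c w i x.

Lemma accept_pr_ge0 (R : realType) s V A (T : tester R s V A) x :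
  0 <= accept_pr T x.
Proof. by apply: sumr_ge0 => w _; apply: weight_ge0. Qed.

Lemma accept_pr_le1 (R : realType) s V A (T : tester R s V A) x :
  accept_pr T x <= 1.
Proof.
rewrite -(weight_sum1 T) /accept_pr big_mkcond ler_sum // => w _.
by case: ifP => _ //; apply: weight_ge0.
Qed.

Lemma card_code c : #|{ffun 'I_c -> option (bool + bool)}| = (5 ^ c)%N.
Proof. by rewrite card_ffun card_option card_sum !card_bool card_ord. Qed.

(** Classify the accepted inputs by the codes of the views of player [i] in all calls: by cut and
    paste each class is a rectangle, and there are [5 ^ (c * #|calls T|)] classes. *)
Lemma brief_accept_sum (R : realType) s (V : finType) A (T : tester R s V A) c w i
    (F : {ffun 'I_s -> V} -> R) (eta : R) :
  blind T i ->
  (forall E, rectangle i E -> (c = 0%N -> cylinder i E) -> \sum_(x | E x) F x <= eta) ->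
  \sum_(x | accepts T w x && brief T c w i x) F x <= 5 ^+ (c * #|calls T|) * eta.
Proof.
move=> bl hF.
pose code x : {ffun calls T -> {ffun 'I_c -> option (bool + bool)}} :=
  [ffun j => view_code c (view_of (subprotocol T w j) x i)].
rewrite (partition_big code predT) //=.
have -> : 5 ^+ (c * #|calls T|) * eta =
    \sum_(z : {ffun calls T -> {ffun 'I_c -> option (bool + bool)}}) eta.
  by rewrite sumr_const card_ffun card_code -expnM -[RHS]mulr_natl natrX.
apply: ler_sum => z _; apply: hF.
- move=> x x' /andP[/andP[ax /forallP bx] /eqP cx].
  move=> /andP[/andP[ax' /forallP bx'] /eqP cx'].
  have E j : view_of (subprotocol T w j) x i = view_of (subprotocol T w j) x' i.
    have /ffunP/(_ j) := etrans cx (esym cx'); rewrite !ffunE.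
    by apply: view_code_inj; [exact: bx | exact: bx'].
  have H j := @cut_and_paste _ _ _ (subprotocol T w j) x x' i
    (eq_rect _ (consistent _ 0) (@view_of_consistent _ _ _ (subprotocol T w j) x i) _ (E j)).
  apply/andP; split.
    apply/andP; split.
      rewrite (_ : accepts T w _ = accepts T w x') // /accepts bl.
      by congr (test T w _ _); apply/funext => j; have [-> _] := H j.
    by apply/forallP => j; have [_ ->] := H j; apply: bx'.
  by rewrite -cx'; apply/eqP/ffunP => j; rewrite !ffunE; have [_ ->] := H j.
- move=> c0 x a /andP[/andP[ax /forallP bx] /eqP cx].
  (* At [c = 0] the only short view is the empty one, which is consistent with every reply
     function. *)
  have nil j : view_of (subprotocol T w j) x i = [::].
    by apply/nilP; have := bx j; rewrite c0 leqn0.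
  have H j : (execute (subprotocol T w j) (upd x i a)).2 =
      (execute (subprotocol T w j) x).2 /\
      view_of (subprotocol T w j) (upd x i a) = view_of (subprotocol T w j) x.
    rewrite -[X in upd x i X](_ : upd x i a i = a); last by rewrite updE eqxx.
    by apply: cut_and_paste; rewrite nil => k b _; rewrite onth0n.
  apply/andP; split.
    apply/andP; split.
      rewrite (_ : accepts T w _ = accepts T w x) // /accepts bl.
      by congr (test T w _ _); apply/funext => j; have [-> _] := H j.
    by apply/forallP => j; have [_ ->] := H j; apply: bx.
  by rewrite -cx; apply/eqP/ffunP => j; rewrite !ffunE; have [_ ->] := H j.
Qed.

(* The views of the players add up to the cost, hence only few of them can be
   long. *)
Lemma few_not_brief (R : realType) s (V : finType) A (T : tester R s V A) C c w x
    (B : {set 'I_s}) :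
  calls_cost_le T C ->
  (c.+1 * #|[set i in B | ~~ brief T c w i x]| <= #|calls T| * C)%N.
Proof.
move=> hC.
have -> : (#|calls T| * C = \sum_(j : calls T) C)%N by rewrite sum_nat_const.
apply: (@leq_trans (\sum_(j : calls T) (execute (subprotocol T w j) x).1)%N);
  last by apply: leq_sum => j _; apply: hC.
rewrite (eq_bigr (fun j => \sum_i size (view_of (subprotocol T w j) x i))%N);
  last by move=> j _; rewrite cost_view_of.
rewrite exchange_big /= mulnC -sum_nat_const big_mkcond; apply: leq_sum => i _.
case: ifP => //; rewrite inE => /andP[_ /forallPn[j]]; rewrite -ltnNge => h.
by rewrite (bigD1 j) //=; apply: leq_trans h (leq_addr _ _).
Qed.

(** Inputs with a long view are charged to [F0] alone: dropping them from the [- G] part only helps,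
    and [F0] has mass at most 1, so [few_not_brief] bounds the loss summed over the players. *)
Lemma tester_ineq (R : realType) s (V : finType) A (T : tester R s V A) C c
    (B : {set 'I_s}) (F G : 'I_s -> {ffun 'I_s -> V} -> R)
    (F0 : {ffun 'I_s -> V} -> R) (eta gamma : R) :
  calls_cost_le T C ->
  (forall i, i \in B -> blind T i) ->
  (forall x, 0 <= F0 x) -> \sum_x F0 x <= 1 ->
  (forall i x, i \in B -> 0 <= G i x) ->
  (forall i x, i \in B -> F0 x - G i x <= F i x) ->
  (forall i E, i \in B -> rectangle i E -> (c = 0%N -> cylinder i E) ->
     \sum_(x | E x) F i x <= eta) ->
  (forall i, i \in B -> gamma <=
     \sum_x F0 x * accept_pr T x - \sum_x G i x * accept_pr T x) ->
  #|B|%:R * gamma - (#|calls T| * C)%:R / c.+1%:R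
    <= #|B|%:R * (5 ^+ (c * #|calls T|) * eta).
Proof.
move=> hC bl F0_ge0 F0_le1 G_ge0 FFG hF hgamma.
have avg (a : R) : a = \sum_w weight T w * a.
  by rewrite -mulr_suml weight_sum1 mul1r.
have up : \sum_(i in B) \sum_w weight T w *
      \sum_(x | accepts T w x && brief T c w i x) F i x
    <= #|B|%:R * (5 ^+ (c * #|calls T|) * eta).
  rewrite mulr_natl -sumr_const; apply: ler_sum => i iB.
  rewrite [leRHS]avg; apply: ler_sum => w _.
  apply: ler_wpM2l; first exact: weight_ge0.
  by apply: brief_accept_sum => [|E rE cE]; [exact: bl | exact: hF].
apply: le_trans up.
pose acc w x : R := (accepts T w x)%:R.
pose nb w i x : R := (~~ brief T c w i x)%:R.
have low i w : i \in B -> \sum_x (F0 x - G i x) * acc w x - \sum_x F0 x * nb w i x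
    <= \sum_(x | accepts T w x && brief T c w i x) F i x.
  move=> iB; rewrite -sumrB [leRHS]big_mkcond; apply: ler_sum => x _.
  rewrite /acc /nb; have := FFG i x iB; have := F0_ge0 x; have := G_ge0 i x iB.
  by case: (accepts _ _ _); case: (brief _ _ _ _ _) => /=; lra.
have accE x : accept_pr T x = \sum_w weight T w * acc w x.
  rewrite /accept_pr big_mkcond; apply: eq_bigr => w _; rewrite /acc.
  by case: ifP; rewrite ?mulr1 ?mulr0.
have long : \sum_(i in B) \sum_w weight T w * \sum_x F0 x * nb w i x
    <= (#|calls T| * C)%:R / c.+1%:R.
  rewrite exchange_big /=.
  rewrite [leRHS]avg; apply: ler_sum => w _.
  rewrite -mulr_sumr; apply: ler_wpM2l; first exact: weight_ge0.
  rewrite exchange_big /=.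
  have K_ge0 : 0 <= (#|calls T| * C)%:R / c.+1%:R :> R by rewrite divr_ge0.
  apply: le_trans (_ : \sum_x F0 x * ((#|calls T| * C)%:R / c.+1%:R) <= _).
    apply: ler_sum => x _; rewrite -mulr_sumr; apply: ler_wpM2l => //.
    rewrite ler_pdivlMr ?ltr0Sn //.
    have -> : \sum_(i in B) nb w i x = #|[set i in B | ~~ brief T c w i x]|%:R.
      rewrite -sum1_card natr_sum [RHS]big_mkcond [LHS]big_mkcond.
      apply: eq_bigr => i _; rewrite inE /nb.
      by case: (i \in B) => //=; case: (brief _ _ _ _ _).
    by rewrite -natrM ler_nat mulnC few_not_brief.
  by rewrite -mulr_suml; apply: ler_piMl.
apply: le_trans (_ : \sum_(i in B) \sum_w weight T w *
   (\sum_x (F0 x - G i x) * acc w x - \sum_x F0 x * nb w i x) <= _); last first.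
  apply: ler_sum => i iB; apply: ler_sum => w _; apply: ler_wpM2l (low _ _ iB).
  exact: weight_ge0.
have -> : \sum_(i in B) \sum_w weight T w *
     (\sum_x (F0 x - G i x) * acc w x - \sum_x F0 x * nb w i x) =
   \sum_(i in B) (\sum_x F0 x * accept_pr T x - \sum_x G i x * accept_pr T x)
   - \sum_(i in B) \sum_w weight T w * \sum_x F0 x * nb w i x.
  rewrite -sumrB; apply: eq_bigr => i iB.
  under eq_bigr do rewrite mulrBr; rewrite sumrB; congr (_ - _).
  under eq_bigr do rewrite mulr_sumr.
  rewrite exchange_big /= -sumrB; apply: eq_bigr => x _.
  rewrite accE !mulr_sumr -sumrB; apply: eq_bigr => w _; ring.
apply: lerB long; rewrite mulr_natl -sumr_const; exact: ler_sum.
Qed.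

(** The cut at [c = 0]: it needs no small discrepancy, only that the average of [F] over a cylinder
    is not positive. *)
Lemma tester_cost_silent (R : realType) s (V : finType) A (T : tester R s V A) C
    (B : {set 'I_s}) (F G : 'I_s -> {ffun 'I_s -> V} -> R)
    (F0 : {ffun 'I_s -> V} -> R) (gamma : R) :
  calls_cost_le T C ->
  (forall i, i \in B -> blind T i) ->
  (forall x, 0 <= F0 x) -> \sum_x F0 x <= 1 ->
  (forall i x, i \in B -> 0 <= G i x) ->
  (forall i x, i \in B -> F0 x - G i x <= F i x) ->
  (forall i E, i \in B -> cylinder i E -> \sum_(x | E x) F i x <= 0) ->
  (forall i, i \in B -> gamma <=
     \sum_x F0 x * accept_pr T x - \sum_x G i x * accept_pr T x) ->
  #|B|%:R * gamma <= (#|calls T| * C)%:R.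
Proof.
move=> hC bl F0_ge0 F0_le1 G_ge0 FFG hF hgamma.
have := @tester_ineq R s V A T C 0 B F G F0 0 gamma hC bl F0_ge0 F0_le1 G_ge0 FFG.
rewrite mulr0 mulr0 divr1 subr_le0; apply => // i E iB _ cyl.
by apply: hF => //; apply: cyl.
Qed.

Lemma tester_cost (R : realType) s (V : finType) A (T : tester R s V A) C
    (B : {set 'I_s}) (F G : 'I_s -> {ffun 'I_s -> V} -> R)
    (F0 : {ffun 'I_s -> V} -> R) (eta gamma : R) :
  calls_cost_le T C ->
  (forall i, i \in B -> blind T i) ->
  (forall x, 0 <= F0 x) -> \sum_x F0 x <= 1 ->
  (forall i x, i \in B -> 0 <= G i x) ->
  (forall i x, i \in B -> F0 x - G i x <= F i x) ->
  (forall i E, i \in B -> rectangle i E -> \sum_(x | E x) F i x <= eta) ->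
  (forall i, i \in B -> gamma <=
     \sum_x F0 x * accept_pr T x - \sum_x G i x * accept_pr T x) ->
  (0 < #|calls T|)%N -> 0 < gamma -> 0 < eta ->
  gamma / (2 * #|calls T|%:R ^+ 2 * ln 5) * #|B|%:R * ln (gamma / (2 * eta)) <= C%:R.
Proof.
move=> hC bl F0_ge0 F0_le1 G_ge0 FFG hF hgamma J0 g0 e0.
(* Views are cut at twice the average length divided by [gamma], so that the
   truncation costs at most half of the advantage [gamma]. *)
have [B0|B0] := posnP #|B|; first by rewrite B0 mulr0 mul0r.
have Jr : 0 < #|calls T|%:R :> R by rewrite ltr0n.
have Br : 0 < #|B|%:R :> R by rewrite ltr0n.
set m : R := 2 * #|calls T|%:R * C%:R / (gamma * #|B|%:R).
have m_ge0 : 0 <= m by rewrite divr_ge0 ?mulr_ge0 // ltW.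
set c := Num.truncn m.
have cm : c%:R <= m by rewrite truncn_le.
have mc : m < c.+1%:R by rewrite truncnS_gt.
have := @tester_ineq R s V A T C c B F G F0 eta gamma hC bl F0_ge0 F0_le1 G_ge0 FFG.
move=> /(_ (fun i E iB rE _ => hF i E iB rE) hgamma) H.
have H1 : (#|calls T| * C)%:R / c.+1%:R <= #|B|%:R * (gamma / 2).
  rewrite ler_pdivrMr ?ltr0Sn //.
  apply: le_trans (_ : #|B|%:R * (gamma / 2) * m <= _).
    by rewrite natrM /m le_eqVlt; apply/orP; left; apply/eqP; field; rewrite !gt_eqF.
  by apply: ler_wpM2l (ltW mc); rewrite mulr_ge0 ?divr_ge0 // ltW.
have H2 : gamma / 2 <= 5 ^+ (c * #|calls T|) * eta.
  rewrite -(ler_pM2l Br); move: H H1.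
  set X := 5 ^+ _ * eta; set Y := (_ * _)%:R / _; lra.
have ln5 : 0 < ln 5 :> R by rewrite ln_gt0 // ltr1n.
have H3 : ln (gamma / (2 * eta)) <= c%:R * #|calls T|%:R * ln 5.
  have -> : c%:R * #|calls T|%:R * ln 5 = ln (5 ^+ (c * #|calls T|)) :> R.
    by rewrite lnXn ?ltr0n // -[RHS]mulr_natl natrM.
  rewrite ler_ln ?posrE ?exprn_gt0 ?divr_gt0 ?mulr_gt0 //.
  by rewrite ler_pdivrMr ?mulr_gt0 //; move: H2; set X := 5 ^+ _; lra.
apply: le_trans (_ : gamma / (2 * #|calls T|%:R ^+ 2 * ln 5) * #|B|%:R *
   (m * #|calls T|%:R * ln 5) <= _).
  apply: ler_wpM2l.
    by rewrite mulr_ge0 ?divr_ge0 ?mulr_ge0 ?sqr_ge0 // ltW.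
  apply: le_trans H3 _; apply: ler_wpM2r; first exact: ltW.
  by apply: ler_wpM2r => //; exact: ltW.
rewrite /m le_eqVlt; apply/orP; left; apply/eqP; field.
by rewrite !gt_eqF.
Qed.

(** * Additive sharing *)

Lemma sum_upd (R : realType) s (V : finType) (F : {ffun 'I_s -> V} -> R) i :
  \sum_u \sum_a F (upd u i a) = #|V|%:R * \sum_x F x.
Proof.
(* Exchanging the fresh value with the one it replaces is an involution. *)
pose h (p : {ffun 'I_s -> V} * V) := (upd p.1 i p.2, p.1 i).
have hK : involutive h.
  by case=> u a; rewrite /h /= updE eqxx upd_upd upd_id.
rewrite pair_bigA /=.
transitivity (\sum_(p : {ffun 'I_s -> V} * V) F p.1).
  by rewrite [RHS](reindex_inj (inv_inj hK)).
rewrite -(pair_bigA _ (fun u (_ : V) => F u)) /= mulr_sumr.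
by apply: eq_bigr => u _; rewrite sumr_const mulr_natl.
Qed.

(** Freezing every player but [i] and a representative [i'] of the others turns the rectangle into a
    product set, so a two-player estimate for each frozen assignment is enough. *)
Lemma rectangle_sum (R : realType) s (V : finType) (F : {ffun 'I_s -> V} -> R)
    (i i' : 'I_s) (E : pred {ffun 'I_s -> V}) eta :
  i != i' -> rectangle i E ->
  (forall u (A B : pred V),
     \sum_(a | A a) \sum_(b | B b) F (upd (upd u i a) i' b) <= eta) ->
  #|V|%:R ^+ 2 * \sum_(x | E x) F x <= #|V|%:R ^+ s * eta.
Proof.
move=> ii' rE hF; rewrite big_mkcond /=.
pose H x := if E x then F x else 0.
rewrite -/(H _) expr2 -mulrA -(sum_upd H i').
rewrite -(sum_upd (fun x => \sum_b H (upd x i' b)) i).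
have -> : #|V|%:R ^+ s * eta = \sum_(u : {ffun 'I_s -> V}) eta.
  by rewrite sumr_const card_ffun card_ord -[RHS]mulr_natl natrX.
apply: ler_sum => u _.
pose pt a b := upd (upd u i a) i' b.
apply: le_trans (hF u (fun a => [exists b, E (pt a b)]) (fun b => [exists a, E (pt a b)])).
rewrite [leRHS]big_mkcond; apply: ler_sum => a _.
have -> : (if [exists b, E (pt a b)] then
    \sum_(b | [exists a0, E (pt a0 b)]) F (upd (upd u i a) i' b) else 0) =
    \sum_b H (pt a b); last by [].
case: ifPn => [/existsP[b0 Eb0]|/existsPn nE].
  rewrite big_mkcond; apply: eq_bigr => b _; rewrite /H.
  case: ifPn => [/existsP[a0 Ea0]|/existsPn /(_ a) /negbTE -> //].
  suff -> : E (pt a b) by [].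
  have := rE _ _ Eb0 Ea0; congr (is_true (E _)); apply/ffunP => j.
  rewrite !updE !eqxx (negbTE ii'); case: (eqVneq j i) => // ->.
  by rewrite (negbTE ii').
by rewrite big1 // => b _; rewrite /H (negbTE (nE b)).
Qed.

Lemma exists_neq_ord s (i : 'I_s) : (2 <= s)%N -> exists i' : 'I_s, i != i'.
Proof.
case: s i => [|[|s]] i // _; case: (eqVneq i ord0) => [->|]; last by exists ord0.
by exists ord_max.
Qed.

Lemma total_upd (V : zmodType) s (x : {ffun 'I_s -> V}) i a :
  total (upd x i a) = a + (total x - x i).
Proof.
rewrite /total (bigD1 i) //= [in RHS](bigD1 i) //= updE eqxx addrAC subrr add0r.
by congr (_ + _); apply: eq_bigr => j /negbTE ji; rewrite updE ji.
Qed.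

Lemma sum_total (R : realType) s (V : finZmodType) (g : V -> R) : (0 < s)%N ->
  \sum_(x : {ffun 'I_s -> V}) g (total x) = #|V|%:R ^+ s.-1 * \sum_z g z.
Proof.
case: s => // s _; have V0 : #|V|%:R != 0 :> R.
  by rewrite pnatr_eq0 -lt0n; apply/card_gt0P; exists 0.
apply: (mulfI V0); rewrite -(sum_upd (fun x => g (total x)) ord0) mulrA -exprS.
rewrite [s.+1.-1]/=.
have -> : #|V|%:R ^+ s.+1 * \sum_z g z = \sum_(u : {ffun 'I_s.+1 -> V}) \sum_z g z.
  by rewrite sumr_const card_ffun card_ord -[RHS]mulr_natl natrX.
apply: eq_bigr => u _; under eq_bigr do rewrite total_upd.
by rewrite [RHS](reindex_inj (addIr (total u - u ord0))).
Qed.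

Lemma xor_rectangle (R : realType) s (V : finZmodType) (g : V -> R) i E eta :
  (2 <= s)%N ->
  (forall A B : pred V,
     \sum_(a | A a) \sum_(b | B b) g (a + b) <= #|V|%:R * eta) ->
  rectangle i E ->
  \sum_(x : {ffun 'I_s -> V} | E x) g (total x) / #|V|%:R ^+ s.-1 <= eta.
Proof.
move=> s2 hg rE; have [i' ii'] := exists_neq_ord i s2.
have V0 : 0 < #|V|%:R :> R.
  by rewrite ltr0n; apply/card_gt0P; exists 0.
rewrite -mulr_suml ler_pdivrMr ?exprn_gt0 // -(ler_pM2l (exprn_gt0 2 V0)).
have -> : #|V|%:R ^+ 2 * (eta * #|V|%:R ^+ s.-1) = #|V|%:R ^+ s * (#|V|%:R * eta).
  by case: s s2 {i i' E rE ii'} => // s _; rewrite [s.+1.-1]/= [_ ^+ s.+1]exprS; ring.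
apply: (rectangle_sum ii' rE) => u A B.
pose sg := total u - u i - u i'.
apply: le_trans (hg A (fun b => B (b - sg))); apply: ler_sum => a _.
rewrite [leRHS](reindex_inj (addIr sg)) /=.
rewrite le_eqVlt; apply/orP; left; apply/eqP.
apply: eq_big => b; first by rewrite addrK.
move=> _; congr g; rewrite !total_upd updE eq_sym (negbTE ii').
by rewrite -!addrA (addrCA b a) /sg -!addrA.
Qed.

(** Resampling share [i] stays inside the cylinder and makes the total uniform, so only the sum of
    [g] matters. *)
Lemma xor_cylinder (R : realType) s (V : finZmodType) (g : V -> R) i E :
  (2 <= s)%N -> \sum_z g z <= 0 -> cylinder i E ->
  \sum_(x : {ffun 'I_s -> V} | E x) g (total x) / #|V|%:R ^+ s.-1 <= 0.
Proof.
move=> s2 hg cE; have V0 : 0 < #|V|%:R :> R.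
  by rewrite ltr0n; apply/card_gt0P; exists 0.
rewrite -mulr_suml pmulr_lle0 ?invr_gt0 ?exprn_gt0 // -(pmulr_rle0 _ V0).
rewrite big_mkcond -(sum_upd _ i) sumr_le0 // => u _ /=.
case: (boolP (E (upd u i (u i)))) => [Eu|nE].
  have Ea a : E (upd u i a) by have := cE _ a Eu; rewrite upd_upd.
  under eq_bigr => a do rewrite Ea total_upd.
  by have := hg; rewrite (reindex_inj (addIr (total u - u i))).
rewrite big1 // => a _; case: ifP => // Ea.
by have := cE _ (u i) Ea; rewrite upd_upd (negbTE nE).
Qed.

(** Each [z] is spread evenly over its [#|V| ^ s.-1] sharings. This is symmetric in the players, so
    all of them enter the average. *)
Lemma xor_cost (R : realType) s (V : finZmodType) A (T : tester R s V A) C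
    (g g0 g1 b : V -> R) (eta gamma a : R) :
  (2 <= s)%N -> calls_cost_le T C -> (forall i, blind T i) ->
  (forall z, 0 <= g0 z) -> (forall z, 0 <= g1 z) -> \sum_z g0 z = 1 ->
  (forall z, g0 z - g1 z <= g z) ->
  (forall x : {ffun 'I_s -> V}, g0 (total x) != 0 -> a <= accept_pr T x) ->
  (forall x : {ffun 'I_s -> V}, g1 (total x) != 0 -> accept_pr T x <= b (total x)) ->
  gamma <= a - \sum_z g1 z * b z ->
  (0 < #|calls T|)%N -> 0 < gamma ->
  (\sum_z g z <= 0 -> s%:R * gamma <= (#|calls T| * C)%:R) /\
  (0 < eta -> (forall A B : pred V,
     \sum_(a | A a) \sum_(b | B b) g (a + b) <= #|V|%:R * eta) ->
   gamma / (2 * #|calls T|%:R ^+ 2 * ln 5) * s%:R * ln (gamma / (2 * eta)) <= C%:R).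
Proof.
move=> s2 hC bl g0_ge0 g1_ge0 g0_sum g01 hg0 hg1 hgamma J0 gamma0.
have s0 : (0 < s)%N by apply: leq_trans s2.
set K : R := #|V|%:R ^+ s.-1.
have K0 : 0 < K by rewrite exprn_gt0 // ltr0n; apply/card_gt0P; exists 0.
pose F (_ : 'I_s) (x : {ffun 'I_s -> V}) := g (total x) / K.
pose F0 (x : {ffun 'I_s -> V}) := g0 (total x) / K.
pose G (_ : 'I_s) (x : {ffun 'I_s -> V}) := g1 (total x) / K.
have F0_ge0 x : 0 <= F0 x by rewrite divr_ge0 // ltW.
have G_ge0 i x : i \in [set: 'I_s] -> 0 <= G i x by rewrite divr_ge0 // ltW.
have sumK (h : V -> R) : \sum_(x : {ffun 'I_s -> V}) h (total x) / K = \sum_z h z.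
  by rewrite -mulr_suml sum_total // mulrC mulKf // gt_eqF.
have F0_le1 : \sum_x F0 x <= 1 by rewrite sumK g0_sum.
have FFG i x : i \in [set: 'I_s] -> F0 x - G i x <= F i x.
  by move=> _; rewrite /F0 /G /F -mulrBl ler_pM2r // invr_gt0.
have gam i : i \in [set: 'I_s] -> gamma <=
    \sum_x F0 x * accept_pr T x - \sum_x G i x * accept_pr T x.
  move=> _; apply: le_trans hgamma _; apply: lerB.
    rewrite -[leLHS]mulr1 -g0_sum -sumK mulr_sumr; apply: ler_sum => x _.
    rewrite /F0; have [->|/hg0 h] := eqVneq (g0 (total x)) 0.
      by rewrite !mul0r mulr0.
    by rewrite mulrC; apply: ler_wpM2l => //; apply: F0_ge0.
  rewrite -sumK; apply: ler_sum => x _.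
  rewrite /G; have [->|/hg1 h] := eqVneq (g1 (total x)) 0; first by rewrite !mul0r.
  by rewrite [leRHS]mulrAC; apply: ler_wpM2l => //; rewrite divr_ge0 // ltW.
have cardT : #|[set: 'I_s]| = s by rewrite cardsT card_ord.
split=> [gs|eta0 hg].
- rewrite -[in leLHS]cardT; apply: (tester_cost_silent hC _ F0_ge0 F0_le1 G_ge0 FFG _ gam).
    by move=> i _; apply: bl.
  by move=> i E _ cE; apply: xor_cylinder cE.
- have := @tester_cost _ _ _ _ T C [set: 'I_s] F G F0 eta gamma hC.
  rewrite cardT; apply => // i E _ rE.
  exact: xor_rectangle rE.
Qed.

Definition premap (s : nat) (V X A : Type) (phi : 'I_s -> V -> X)
    (P : dprotocol s X A) : dprotocol s V A :=
  DProtocol (center P) (fun i v => reply P i (phi i v)).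

(** The conjunction of [m] independent runs raises the acceptance probability to the power [m]. Only
    the number of calls grows; the cost [C] of one call is unchanged. *)
Definition expt_tester (R : realType) (s : nat) (V A : Type) (T : tester R s V A)
  (m : nat) : tester R s V A.
Proof.
refine (@Tester R s V A {ffun 'I_m -> coins T} (fun w => \prod_k weight T (w k)) _ _
  ('I_m * calls T)%type (fun w j => subprotocol T (w j.1) j.2)
  (fun w x o => [forall k, test T (w k) x (fun j => o (k, j))])).
- by move=> w; apply: prodr_ge0 => k _; apply: weight_ge0.
- rewrite -(bigA_distr_bigA (fun _ => weight T)) /= big1 // => k _.
  exact: weight_sum1.
Defined.

Lemma expt_tester_accept (R : realType) s V A (T : tester R s V A) m x :
  accept_pr (expt_tester T m) x = accept_pr T x ^+ m.
Proof.
have -> : accept_pr T x ^+ m =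
    \prod_(k < m) \sum_w (if accepts T w x then weight T w else 0).
  by rewrite prodr_const card_ord -big_mkcond.
rewrite bigA_distr_bigA /accept_pr big_mkcond; apply: eq_bigr => w _ /=.
case: ifPn => [/forallP h|/forallPn[k h]].
  by apply: eq_bigr => k _; rewrite /accepts h.
by rewrite (bigD1 k) //= /accepts (negbTE h) mul0r.
Qed.

(** * Corruption bound for unique disjointness *)

Notation bits n := {ffun 'I_n -> bool}.

(** [D] splits the coordinates between two parties: Z is a uniform subset of [D] and Y one of its
    complement, hence disjoint. Forcing one coordinate to 1 on both sides creates a unique
    intersection. *)
Definition mask n (D u : bits n) : bits n := [ffun j => u j && D j].

Definition negb_bits n (D : bits n) : bits n := [ffun j => ~~ D j].

Definition mask_avg (R : realType) n (f : bits n -> R) (D : bits n) : R :=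
  (\sum_u f (mask D u)) / 2 ^+ n.

Definition forced_avg (R : realType) n (f : bits n -> R) (j : 'I_n) b (D : bits n) : R :=
  (\sum_u f (upd (mask D u) j b)) / 2 ^+ n.

(** The coordinates of [D] whose bit, under the law conditioned by [f], equals 1 with probability
    outside [1/3, 2/3]. *)
Definition biased (R : realType) n (f : bits n -> R) (D : bits n) : {set 'I_n} :=
  [set j | D j && ((forced_avg f j true D < forced_avg f j false D / 2)
                || (2 * forced_avg f j false D < forced_avg f j true D))].

(** The relative entropy of a bit of bias 2/3 with respect to a fair bit; it is positive because
    [(4/3)^2 * (2/3) = 32/27]. *)
Definition bias_rate (R : realType) : R := (2 * ln (4 / 3) + ln (2 / 3)) / 3.

Lemma bias_rate_gt0 (R : realType) : 0 < bias_rate R.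
Proof.
rewrite /bias_rate divr_gt0 // mulr_natl -lnXn ?divr_gt0 //.
rewrite -lnM ?posrE ?exprn_gt0 ?divr_gt0 // ln_gt0 //; lra.
Qed.

Lemma sum_bits_upd (R : realType) n (F : bits n -> R) j :
  \sum_u (F (upd u j true) + F (upd u j false)) = 2 * \sum_u F u.
Proof.
have := sum_upd F j; rewrite card_bool => <-.
by apply: eq_bigr => u _; rewrite big_bool.
Qed.

Lemma mask_upd n (D u : bits n) j b : D j -> mask D (upd u j b) = upd (mask D u) j b.
Proof.
move=> Dj; apply/ffunP => k; rewrite !ffunE; case: eqP => // ->.
by rewrite Dj andbT.
Qed.

Lemma mask_upd_domain n (D u : bits n) j b d :
  upd (mask (upd D j d) u) j b = upd (mask D u) j b.
Proof. by apply/ffunP => k; rewrite !ffunE; case: eqP. Qed.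

Lemma forced_avg_upd (R : realType) n (f : bits n -> R) j b D d :
  forced_avg f j b (upd D j d) = forced_avg f j b D.
Proof. by congr (_ / _); apply: eq_bigr => u _; rewrite mask_upd_domain. Qed.

Lemma mask_avgE (R : realType) n (f : bits n -> R) j D :
  mask_avg f D = if D j then (forced_avg f j true D + forced_avg f j false D) / 2
                 else forced_avg f j false D.
Proof.
case: ifP => Dj.
  rewrite -mulrDl -big_split /=.
  under [in RHS]eq_bigr do rewrite -!mask_upd //.
  by rewrite (sum_bits_upd (fun u => f (mask D u))) /mask_avg; field; rewrite expf_neq0.
congr (_ / _); apply: eq_bigr => u _; congr f; apply/ffunP => k.
by rewrite !ffunE; case: eqP => // ->; rewrite Dj andbF.
Qed.

Lemma mask_avg_ge0 (R : realType) n (f : bits n -> R) D :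
  (forall x, 0 <= f x) -> 0 <= mask_avg f D.
Proof. by move=> f0; rewrite divr_ge0 ?sumr_ge0 ?exprn_ge0. Qed.

Lemma forced_avg_ge0 (R : realType) n (f : bits n -> R) j b D :
  (forall x, 0 <= f x) -> 0 <= forced_avg f j b D.
Proof. by move=> f0; rewrite divr_ge0 ?sumr_ge0 ?exprn_ge0. Qed.

Lemma forced_avgK (R : realType) n (f : bits n -> R) j b D :
  2 ^+ n * forced_avg f j b D = \sum_u f (upd (mask D u) j b).
Proof. by rewrite mulrC divfK // expf_neq0. Qed.

Lemma mask_avgK (R : realType) n (f : bits n -> R) D :
  2 ^+ n * mask_avg f D = \sum_u f (mask D u).
Proof. by rewrite mulrC divfK // expf_neq0. Qed.

Lemma card_bits n : #|{: bits n}| = (2 ^ n)%N.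
Proof. by rewrite card_ffun card_bool card_ord. Qed.

(* The test function [T] multiplies 4/3 or 2/3 over the biased coordinates, so
   that its mean is 1 while the mean of [ln T] under the law conditioned by [f]
   is at least [bias_rate * #|biased f D|]; Jensen's inequality concludes. *)
Lemma mask_avg_le_biased (R : realType) n (f : bits n -> R) D :
  (forall x, 0 <= f x) -> (forall x, f x <= 1) ->
  mask_avg f D <= expR (- (bias_rate R * #|biased f D|%:R)).
Proof.
move=> f0 f1; set k := bias_rate R; set Bd := biased f D.
pose up j := 2 * forced_avg f j false D < forced_avg f j true D.
pose lam j b : R := if b == up j then 4 / 3 else 2 / 3.
have lam_gt0 j b : 0 < lam j b by rewrite /lam; case: ifP => _; lra.
pose lnT (u : bits n) : R := \sum_(j in Bd) ln (lam j (u j)).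
have expT (u : bits n) : expR (lnT u) = \prod_j (if j \in Bd then lam j (u j) else 1).
  rewrite expR_sum big_mkcond; apply: eq_bigr => j _.
  by case: ifP => // _; rewrite lnK ?posrE.
have sumT : \sum_u expR (lnT u) = 2 ^+ n.
  under eq_bigr do rewrite expT.
  rewrite -(bigA_distr_bigA (fun j b => if j \in Bd then lam j b else 1)) /=.
  rewrite (eq_bigr (fun=> 2)) => [|j _]; first by rewrite prodr_const card_ord.
  by rewrite big_bool; case: ifP => _; rewrite /lam; case: (up j) => /=; lra.
have meanT : 2 ^+ n * (k * #|Bd|%:R * mask_avg f D) <= \sum_u f (mask D u) * lnT u.
  under [leRHS]eq_bigr do rewrite mulr_sumr.
  rewrite exchange_big /=.
  have -> : 2 ^+ n * (k * #|Bd|%:R * mask_avg f D) =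
      \sum_(j in Bd) 2 ^+ n * (k * mask_avg f D).
    by rewrite sumr_const -[RHS]mulr_natl; set M := mask_avg f D; ring.
  apply: ler_sum => j jB.
  have Dj : D j by move: jB; rewrite inE => /andP[].
  rewrite -(@ler_pM2l _ 2) // -(sum_bits_upd (fun u => f (mask D u) * _) j).
  have -> : \sum_u (f (mask D (upd u j true)) * ln (lam j (upd u j true j)) +
       f (mask D (upd u j false)) * ln (lam j (upd u j false j))) =
     2 ^+ n * (forced_avg f j true D * ln (lam j true) +
               forced_avg f j false D * ln (lam j false)).
    rewrite [RHS](_ : _ = 2 ^+ n * forced_avg f j true D * ln (lam j true) +
               2 ^+ n * forced_avg f j false D * ln (lam j false)); last by ring.
    rewrite !forced_avgK.
    rewrite !mulr_suml -big_split; apply: eq_bigr => u _ /=.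
    by rewrite !mask_upd // !updE eqxx.
  rewrite mulrCA ler_pM2l ?exprn_gt0 // (mask_avgE _ j) Dj.
  set a1 := forced_avg f j true D; set a0 := forced_avg f j false D.
  have l32 : ln (2 / 3) <= ln (4 / 3) :> R by rewrite ler_ln ?posrE; lra.
  rewrite /lam /k /bias_rate.
  have : (a1 < a0 / 2) || up j by move: jB; rewrite inE => /andP[].
  case U: (up j) => /=.
    move=> _; have := U; rewrite /up -/a1 -/a0; nra.
  rewrite orbF; nra.
have le1 : \sum_u f (mask D u) * expR (lnT u) <= 2 ^+ n.
  rewrite -sumT; apply: ler_sum => u _; apply: ler_piMl => //; exact: expR_ge0.
set m := k * #|Bd|%:R.
(* Jensen's inequality in the form of the tangent of [expR] at [m]; by [meanT] the linear correction
   has a nonnegative mean. *)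
have jensen : expR m * \sum_u f (mask D u) * (1 + (lnT u - m)) <= 2 ^+ n.
  apply: le_trans le1; rewrite mulr_sumr; apply: ler_sum => u _.
  rewrite mulrCA; apply: ler_wpM2l => //.
  rewrite -[lnT u in leRHS](subrK m) expRD mulrC.
  by apply: ler_wpM2r; [exact: expR_ge0 | exact: expR_ge1Dx].
rewrite expRN -[leRHS]mul1r ler_pdivlMr ?expR_gt0 //.
rewrite -(@ler_pM2l _ (2 ^+ n)) ?exprn_gt0 // mulr1; apply: le_trans jensen.
rewrite mulrA [leLHS]mulrC; apply: ler_wpM2l; first exact: expR_ge0.
have -> : \sum_u f (mask D u) * (1 + (lnT u - m)) =
    2 ^+ n * mask_avg f D * (1 - m) + \sum_u f (mask D u) * lnT u.
  rewrite mask_avgK mulr_suml -big_split.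
  by apply: eq_bigr => u _ /=; ring.
move: meanT; rewrite -/m; lra.
Qed.

Lemma negb_bits_upd n (D : bits n) j b :
  negb_bits (upd D j b) = upd (negb_bits D) j (~~ b).
Proof. by apply/ffunP => k; rewrite !ffunE; case: eqP. Qed.

Definition mask_weight (R : realType) n (f g : bits n -> R) (D : bits n) : R :=
  mask_avg f D * mask_avg g (negb_bits D).

Definition biases (R : realType) n (f g : bits n -> R) (D : bits n) (j : 'I_n) : R :=
  (j \in biased f D)%:R + (j \in biased g (negb_bits D))%:R.

(** Pair [D] with and without [j]. If [j] is biased on neither side, each product of forced averages
    is at most four times the one with both bits forced to 1; otherwise the weight of the biased
    terms dominates. *)
Lemma sum_mask_weight_le (R : realType) n (f g : bits n -> R) (j : 'I_n) :
  (forall x, 0 <= f x) -> (forall y, 0 <= g y) ->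
  \sum_D mask_weight f g D <=
  6 * (\sum_D forced_avg f j true D * forced_avg g j true (negb_bits D))
  + 4 * \sum_D mask_weight f g D * biases f g D j.
Proof.
move=> f0 g0; rewrite !mulr_sumr -big_split /= -(@ler_pM2l _ 2) //.
rewrite -(sum_bits_upd (mask_weight f g) j).
rewrite -(sum_bits_upd (fun D => 6 * _ + 4 * _) j); apply: ler_sum => D _.
rewrite /mask_weight /biases !negb_bits_upd !inE !forced_avg_upd.
rewrite !(mask_avgE _ j) !updE !eqxx !forced_avg_upd /=.
set a1 := forced_avg f j true D; set a0 := forced_avg f j false D.
set b1 := forced_avg g j true _; set b0 := forced_avg g j false _.
have a1_ge0 : 0 <= a1 by exact: forced_avg_ge0.
have a0_ge0 : 0 <= a0 by exact: forced_avg_ge0.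
have b1_ge0 : 0 <= b1 by exact: forced_avg_ge0.
have b0_ge0 : 0 <= b0 by exact: forced_avg_ge0.
have p11 : 0 <= a1 * b1 by exact: mulr_ge0.
have p10 : 0 <= a1 * b0 by exact: mulr_ge0.
have p01 : 0 <= a0 * b1 by exact: mulr_ge0.
have p00 : 0 <= a0 * b0 by exact: mulr_ge0.
case: (boolP (_ || _)) => [_|hf]; case: (boolP (_ || _)) => [_|hg] /=.
- lra.
- move: hg; rewrite negb_or -!leNgt => /andP[h1 h2].
  have := ler_wpM2l a0_ge0 h1; have := ler_wpM2l a0_ge0 h2; lra.
- move: hf; rewrite negb_or -!leNgt => /andP[h1 h2].
  have := ler_wpM2r b0_ge0 h1; have := ler_wpM2r b0_ge0 h2; lra.
- move: hf hg; rewrite !negb_or -!leNgt => /andP[h1 h2] /andP[h3 h4].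
  have := ler_wpM2l a0_ge0 h3; have := ler_wpM2l a0_ge0 h4.
  have := ler_wpM2r b0_ge0 h1; have := ler_wpM2r b0_ge0 h2.
  have : (a0 / 2) * (b0 / 2) <= a1 * b1.
    by apply: ler_pM => //; rewrite divr_ge0.
  lra.
Qed.

Definition disjoint_avg (R : realType) n (f g : bits n -> R) : R :=
  (\sum_D mask_weight f g D) / 2 ^+ n.

Definition unique_avg (R : realType) n (f g : bits n -> R) : R :=
  (\sum_j \sum_D forced_avg f j true D * forced_avg g j true (negb_bits D))
    / (n%:R * 2 ^+ n).

(** Either at most n/40 coordinates are biased, or the mask weight itself is exponentially small;
    the count never exceeds 2n. *)
Lemma mask_weight_biases (R : realType) n (f g : bits n -> R) D :
  (forall x, 0 <= f x <= 1) -> (forall y, 0 <= g y <= 1) ->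
  \sum_j mask_weight f g D * biases f g D j <=
  n%:R / 40 * mask_weight f g D + 2 * n%:R * expR (- (bias_rate R * (n%:R / 40))).
Proof.
move=> hf hg.
have f0 x : 0 <= f x by have /andP[] := hf x.
have f1 x : f x <= 1 by have /andP[] := hf x.
have g0 x : 0 <= g x by have /andP[] := hg x.
have g1 x : g x <= 1 by have /andP[] := hg x.
set w := mask_weight f g D.
set m : R := #|biased f D|%:R + #|biased g (negb_bits D)|%:R.
have -> : \sum_j w * biases f g D j = w * m.
  rewrite -mulr_sumr big_split /= /m; congr (_ * (_ + _)).
  - by rewrite -sum1_card natr_sum [RHS]big_mkcond; apply: eq_bigr => j _; case: (j \in _).
  - by rewrite -sum1_card natr_sum [RHS]big_mkcond; apply: eq_bigr => j _; case: (j \in _).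
have w0 : 0 <= w by rewrite mulr_ge0 ?mask_avg_ge0.
have kappa := bias_rate_gt0 R.
have wm : w <= expR (- (bias_rate R * m)).
  rewrite /m mulrDr opprD expRD; apply: ler_pM; rewrite ?mask_avg_ge0 //;
  exact: mask_avg_le_biased.
have m2 : m <= 2 * n%:R.
  rewrite /m mulr_natl mulr2n; apply: lerD; rewrite ler_nat;
  by rewrite -[leqRHS](card_ord n) max_card.
have [mn|nm] := leP m (n%:R / 40).
  rewrite mulrC -[leLHS]addr0; apply: lerD; first exact: ler_wpM2r.
  by rewrite mulr_ge0 ?expR_ge0 ?mulr_ge0.
rewrite -[leLHS]add0r; apply: lerD; first by rewrite mulr_ge0 ?divr_ge0.
rewrite mulrC; apply: ler_pM => //; first exact: le_trans (ltW nm).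
by apply: le_trans wm _; rewrite ler_expR lerN2 ler_pM2l // ltW.
Qed.

(** The biases absorb [4 * (1/40) = 1/10] of the disjoint mass, so the remaining 9/10 is at most six
    times the unique mass plus [8 * e]: hence [20/3 = 6 / (9/10)], and 9 bounds [8 / (9/10)].
    Functions with values in [0, 1] are allowed, not only sets, because players outside the hard
    pair will be averaged out. *)
Lemma corruption (R : realType) n (f g : bits n -> R) : (0 < n)%N ->
  (forall x, 0 <= f x <= 1) -> (forall y, 0 <= g y <= 1) ->
  disjoint_avg f g - 20 / 3 * unique_avg f g
    <= 9 * expR (- (bias_rate R * (n%:R / 40))).
Proof.
move=> n0 hf hg; have N0 : 0 < n%:R :> R by rewrite ltr0n.
have f0 x : 0 <= f x by have /andP[] := hf x.
have g0 x : 0 <= g x by have /andP[] := hg x.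
have T0 : 0 < 2 ^+ n :> R by rewrite exprn_gt0.
set e := expR _; have e0 : 0 <= e by exact: expR_ge0.
have S : n%:R * \sum_D mask_weight f g D <=
    6 * (\sum_j \sum_D forced_avg f j true D * forced_avg g j true (negb_bits D))
    + 4 * \sum_D \sum_j mask_weight f g D * biases f g D j.
  rewrite [X in 4 * X]exchange_big /= ![in leRHS]mulr_sumr -big_split /=.
  rewrite [leLHS](_ : _ = \sum_(j < n) \sum_D mask_weight f g D); last first.
    by rewrite sumr_const card_ord mulr_natl.
  by apply: ler_sum => j _; apply: sum_mask_weight_le.
have S2 : \sum_D \sum_j mask_weight f g D * biases f g D j <=
    n%:R / 40 * \sum_D mask_weight f g D + 2 ^+ n * (2 * n%:R * e).
  have -> : 2 ^+ n * (2 * n%:R * e) = \sum_(D : bits n) 2 * n%:R * e.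
    by rewrite sumr_const card_bits -[RHS]mulr_natl natrX.
  rewrite mulr_sumr -big_split /=; apply: ler_sum => D _.
  exact: mask_weight_biases.
rewrite /disjoint_avg /unique_avg.
set P := \sum_D mask_weight f g D in S S2 *.
set Q := \sum_j _ in S *.
have -> : P / 2 ^+ n - 20 / 3 * (Q / (n%:R * 2 ^+ n)) =
    (n%:R * P - 20 / 3 * Q) / (n%:R * 2 ^+ n).
  by field; rewrite expf_neq0 // gt_eqF.
rewrite ler_pdivrMr ?mulr_gt0 //.
have : 0 <= 2 ^+ n * (n%:R * e) by rewrite !mulr_ge0 // ltW.
move: S S2; set Z := \sum_D \sum_j _; nra.
Qed.

(** * The Fourier transform of the invertible matrices *)

(** The vanishing sum expresses that the character is not trivial, the conjugation law that its
    values lie on the unit circle. *)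
Definition nontrivial_character (F : finFieldType) (chi : F -> algC) :=
  [/\ chi 0 = 1, forall a b, chi (a + b) = chi a * chi b,
      forall a, (chi a)^* = chi (- a) & \sum_a chi a = 0].

Lemma exists_character p : prime p ->
  exists chi : 'F_p -> algC, nontrivial_character chi.
Proof.
move=> pp; have [z pz] := C_prim_root_exists (prime_gt0 pp).
have zp := prim_expr_order pz.
have trp : (Zp_trunc (pdiv p)).+2 = p by exact: Fp_cast.
pose chi (a : 'F_p) := z ^+ a.
have chi0 : chi 0 = 1 by [].
have chiD a b : chi (a + b) = chi a * chi b.
  by rewrite /chi -exprD /= -[RHS](prim_expr_mod pz) {3}trp.
have z1 : `|z| = 1.
  by apply/eqP; rewrite -(pexpr_eq1 (prime_gt0 pp)) // -normrX zp normr1.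
have chiN a : (chi a)^* = chi (- a).
  have nz : chi a != 0.
    by rewrite /chi expf_neq0 // -normr_gt0 z1.
  apply: (mulfI nz); rewrite -chiD subrr chi0 -normCK /chi normrX z1 expr1n.
  by rewrite expr1n.
exists chi; split => //.
have chi1 : chi 1 != 1.
  rewrite /chi -(prim_order_dvd pz) /=.
  by rewrite modn_small ?trp ?prime_gt1 // dvdn1 gtn_eqF ?prime_gt1.
have h : \sum_a chi a = chi 1 * \sum_a chi a.
  by rewrite mulr_sumr {1}(reindex_inj (addrI 1)); apply: eq_bigr => a _.
apply/eqP; have /eqP := h.
rewrite -subr_eq0 -[X in X - _]mul1r -mulrBl mulf_eq0 subr_eq0 eq_sym.
by rewrite (negbTE chi1).
Qed.

Lemma character_neq1 (F : finFieldType) (chi : F -> algC) :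
  nontrivial_character chi -> exists a, chi a != 1.
Proof.
case=> chi0 chiD chiN chiS; apply/existsP; apply: contraT; rewrite negb_exists => /forallP h.
have /eqP := chiS.
rewrite (eq_bigr (fun=> 1)) => [|a _]; last by apply/eqP; have := h a; rewrite negbK.
rewrite sumr_const pnatr_eq0 => /eqP/card0_eq/(_ 0).
by rewrite inE.
Qed.

Lemma sum_character_eq0 (V : finZmodType) (psi : V -> algC) x0 :
  (forall x y, psi (x + y) = psi x * psi y) -> psi x0 != 1 -> \sum_x psi x = 0.
Proof.
move=> psiD psi1.
have h : \sum_x psi x = psi x0 * \sum_x psi x.
  by rewrite mulr_sumr {1}(reindex_inj (addrI x0)); apply: eq_bigr => a _.
apply/eqP; have /eqP := h.
rewrite -subr_eq0 -[X in X - _]mul1r -mulrBl mulf_eq0 subr_eq0 eq_sym.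
by rewrite (negbTE psi1).
Qed.

Lemma sum_character_mx (F : finFieldType) (chi : F -> algC) m n (z : 'M[F]_(m, n)) :
  nontrivial_character chi ->
  \sum_(R : 'M[F]_(n, m)) chi (\tr (R *m z)) = (#|F| ^ (n * m) * (z == 0))%:R.
Proof.
move=> ntchi; have [chi0 chiD _ _] := ntchi.
have [->|z0] := eqVneq z 0.
  under eq_bigr do rewrite mulmx0 mxtrace0 chi0.
  by rewrite sumr_const card_mx muln1.
rewrite muln0; have [a a1] := character_neq1 ntchi.
have [i [j zij]] : exists i j, z i j != 0.
  suff /existsP[i /existsP zi] : [exists i, [exists j, z i j != 0]] by exists i.
  apply: contraT; rewrite negb_exists => /forallP h.
  case/eqP: z0; apply/matrixP => i j; rewrite mxE.
  have := h i; rewrite negb_exists => /forallP/(_ j).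
  by rewrite negbK => /eqP.
(* Along this direction the trace changes by exactly [a], where the character is not 1. *)
apply: (@sum_character_eq0 _ _ ((a / z i j) *: delta_mx j i)) => [x y|].
  by rewrite mulmxDl mxtraceD chiD.
rewrite -scalemxAl mxtraceZ /mxtrace (bigD1 j) //= big1 => [|k kj].
  rewrite addr0 mxE (bigD1 i) //= big1 => [|l li].
    by rewrite mxE !eqxx mul1r addr0 divfK.
  by rewrite mxE (negbTE li) andbF mul0r.
by rewrite mxE big1 // => l _; rewrite mxE (negbTE kj) mul0r.
Qed.

Definition fourier_mx (F : finFieldType) (chi : F -> algC) n (A : pred 'M[F]_n)
  (R : 'M[F]_n) : algC := \sum_(x | A x) chi (\tr (R *m x)).

Lemma parseval_mx (F : finFieldType) (chi : F -> algC) n (A : pred 'M[F]_n) :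
  nontrivial_character chi ->
  \sum_R `|fourier_mx chi A R| ^+ 2 = (#|F| ^ (n * n) * #|A|)%:R.
Proof.
move=> ntchi; have [_ chiD chiN _] := ntchi.
have step R : `|fourier_mx chi A R| ^+ 2 =
    \sum_(x | A x) \sum_(y | A y) chi (\tr (R *m (x - y))).
  rewrite normCK /fourier_mx rmorph_sum mulr_suml; apply: eq_bigr => x _.
  rewrite mulr_sumr; apply: eq_bigr => y _.
  by rewrite /= chiN -chiD mulmxBr raddfB.
under eq_bigr do rewrite step.
rewrite exchange_big /= mulnC natrM -sum1_card natr_sum mulr_suml.
apply: eq_bigr => x Ax; rewrite exchange_big /= mul1r (bigD1 x) //=.
rewrite sum_character_mx // subrr eqxx muln1 big1 ?addr0 // => y /andP[_ yx].
by rewrite sum_character_mx // subr_eq0 eq_sym (negbTE yx) muln0.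
Qed.

Definition unit_kernel (F : finFieldType) (chi : F -> algC) n (z : 'M[F]_n) : algC :=
  \sum_(R in unitmx) chi (\tr (R *m z)).

(** Additivity factors the sum into Fourier coefficients of [A] and [B]. About the invertible
    matrices only one fact matters: they carry weight 0 or 1 in the spectrum, so the
    arithmetic-geometric inequality and Parseval apply. *)
Lemma unit_kernel_discrepancy (F : finFieldType) (chi : F -> algC) n
    (A B : pred 'M[F]_n) : nontrivial_character chi ->
  `|\sum_(x | A x) \sum_(y | B y) unit_kernel chi (x + y)|
     <= (#|F| ^ (n * n))%:R ^+ 2.
Proof.
move=> ntchi; have [_ chiD chiN _] := ntchi.
have -> : \sum_(x | A x) \sum_(y | B y) unit_kernel chi (x + y) =
    \sum_(R in unitmx) fourier_mx chi A R * fourier_mx chi B R.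
  rewrite /unit_kernel; under eq_bigr do rewrite exchange_big.
  rewrite exchange_big; apply: eq_bigr => R _ /=.
  rewrite mulr_suml; apply: eq_bigr => x _; rewrite mulr_sumr.
  by apply: eq_bigr => y _; rewrite mulmxDr mxtraceD chiD.
apply: le_trans (ler_norm_sum _ _ _) _.
apply: le_trans (_ : \sum_R (`|fourier_mx chi A R| ^+ 2
    + `|fourier_mx chi B R| ^+ 2) / 2 <= _).
  rewrite big_mkcond; apply: ler_sum => R _.
  have n2 : `|fourier_mx chi A R * fourier_mx chi B R| <=
     (`|fourier_mx chi A R| ^+ 2 + `|fourier_mx chi B R| ^+ 2) / 2.
    rewrite normrM ler_pdivlMr // -subr_ge0.
    have -> : `|fourier_mx chi A R| ^+ 2 + `|fourier_mx chi B R| ^+ 2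
        - `|fourier_mx chi A R| * `|fourier_mx chi B R| * 2 =
       (`|fourier_mx chi A R| - `|fourier_mx chi B R|) ^+ 2 by ring.
    by rewrite real_exprn_even_ge0 // rpredB // normr_real.
  by case: ifP => // _; apply: le_trans n2.
rewrite -mulr_suml big_split /= !parseval_mx // ler_pdivrMr //.
rewrite -natrX -natrD -natrM ler_nat -mulnDr -mulnn -mulnA leq_mul //.
rewrite muln2 -addnn; apply: leq_add; rewrite (leq_trans (max_card _)) // card_mx //.
Qed.

Lemma sum_block_mx (F : finFieldType) n (h : 'M[F]_(1 + n) -> algC) :
  \sum_R h R = \sum_(D : 'M[F]_n) \sum_(r : 'rV[F]_n) \sum_(c : 'cV[F]_n) \sum_(a : F)
     h (block_mx a%:M r c D).
Proof.
rewrite pair_bigA pair_bigA pair_bigA /=.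
rewrite (reindex (fun q : 'M[F]_n * 'rV[F]_n * 'cV[F]_n * F =>
  block_mx q.2%:M q.1.1.2 q.1.2 q.1.1.1 : 'M[F]_(1 + n))) //=.
exists (fun R : 'M[F]_(1 + n) => (drsubmx R, ursubmx R, dlsubmx R, ulsubmx R 0 0)).
  by case=> [[[D r] c] a] _; rewrite block_mxKdr block_mxKur block_mxKdl block_mxKul mxE eqxx.
by move=> R _ /=; rewrite -mx11_scalar submxK.
Qed.

Lemma det_corner (F : fieldType) n (a : F) r c (D : 'M[F]_n) :
  \det (block_mx a%:M r c D) = \det (block_mx (0 : 'M[F]_1) r c D) + a * \det D.
Proof.
have -> : \det D = \det (block_mx (1%:M : 'M[F]_1) 0 c D) by rewrite det_lblock det1 mul1r.
rewrite -[X in X + _]mul1r.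
apply: (@determinant_multilinear _ _ _ _ _ (lshift n 0)).
- apply/rowP => j; rewrite !mxE; case: splitP => [i _|//]; rewrite !mxE.
  by case: splitP => k _; rewrite ?ord1 !mxE ?eqxx ?mulr1n; ring.
- by apply/matrixP => i j; rewrite !mxE; case: splitP => k; rewrite /= ?ord1 // !mxE.
- by apply/matrixP => i j; rewrite !mxE; case: splitP => k; rewrite /= ?ord1 // !mxE.
Qed.

Definition gl_card (F : finFieldType) n : nat := #|[pred R : 'M[F]_n | R \in unitmx]|.

(** Hence the kernel depends on the rank alone and can be computed on [pid_mx]. *)
Lemma unit_kernel_equiv (F : finFieldType) (chi : F -> algC) n (z L M : 'M[F]_n) :
  L \in unitmx -> M \in unitmx -> unit_kernel chi (L *m z *m M) = unit_kernel chi z.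
Proof.
move=> Lu Mu; rewrite /unit_kernel.
rewrite [RHS](reindex (fun R => M *m R *m L)) /=; last first.
  exists (fun R => invmx M *m R *m invmx L) => R _ /=.
    by rewrite -!mulmxA mulmxV // mulmx1 mulKmx.
  by rewrite -!mulmxA mulVmx // mulmx1 mulKVmx.
apply: eq_big => R; first by rewrite !unitmx_mul Lu Mu andbT.
by move=> _; rewrite mulmxA mxtrace_mulC !mulmxA.
Qed.

(** The corner factor is the Schur complement of [D]. *)
Lemma det_corner_unit (F : fieldType) n (a : F) (r : 'rV[F]_n) (c : 'cV[F]_n)
    (D : 'M[F]_n) : D \in unitmx ->
  \det (block_mx a%:M r c D) = (a - (r *m invmx D *m c) 0 0) * \det D.
Proof.
move=> Du.
have -> : block_mx a%:M r c D = block_mx (1%:M : 'M[F]_1) (r *m invmx D) 0 1%:M *m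
    block_mx ((a - (r *m invmx D *m c) 0 0)%:M : 'M[F]_1) 0 c D.
  rewrite mulmx_block !mul1mx !mul0mx !add0r mulmxKV //.
  by congr block_mx; rewrite raddfB /= -mx11_scalar subrK.
by rewrite det_mulmx det_ublock det_lblock !det1 !mul1r det_scalar1.
Qed.

Lemma pid_mxS (F : fieldType) n k :
  pid_mx k.+1 = block_mx 1%:M 0 0 (pid_mx k) :> 'M[F]_(1 + n).
Proof.
apply/matrixP => i j; rewrite !mxE.
by case: (splitP i) => i' ->; rewrite !mxE; case: (splitP j) => j' ->; rewrite !mxE ?ord1.
Qed.

(** Sum over the corner [a] first. For singular [D], invertibility does not depend on [a] and the
    character sum vanishes. For invertible [D] exactly one [a] is excluded, which leaves minus the
    character at that value; summing over [c] then kills every [r] except 0. *)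
Lemma unit_kernel_pidS (F : finFieldType) (chi : F -> algC) n k :
  nontrivial_character chi ->
  unit_kernel chi (pid_mx k.+1 : 'M[F]_(1 + n)) =
  - (#|F| ^ n)%:R * unit_kernel chi (pid_mx k : 'M[F]_n).
Proof.
move=> ntchi; have [chi0 chiD chiN chiS] := ntchi.
rewrite /unit_kernel big_mkcond sum_block_mx [in RHS]big_mkcond mulr_sumr.
apply: eq_bigr => D _.
have trE a r c : \tr (block_mx a%:M r c D *m (pid_mx k.+1 : 'M[F]_(1 + n))) =
    a + \tr (D *m pid_mx k).
  rewrite pid_mxS mulmx_block !mulmx1 !mulmx0 !addr0 !add0r mxtrace_block.
  by rewrite mxtrace_scalar.
under eq_bigr => r do under eq_bigr => c do under eq_bigr => a do
  rewrite trE chiD unitmxE unitfE.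
case: (boolP (D \in unitmx)) => Du; last first.
  rewrite mulr0 big1 // => r _; rewrite big1 // => c _.
  have d0 : \det D = 0 by apply/eqP; move: Du; rewrite unitmxE unitfE negbK.
  under eq_bigr => a do rewrite det_corner d0 mulr0 addr0.
  case: (\det (block_mx 0 r c D) != 0); last by rewrite big1.
  by rewrite -mulr_suml chiS mul0r.
have dn0 : \det D != 0 by move: Du; rewrite unitmxE unitfE.
transitivity (\sum_(r : 'rV[F]_n) \sum_(c : 'cV[F]_n)
   - chi (\tr (c *m (r *m invmx D))) * chi (\tr (D *m pid_mx k))).
  apply: eq_bigr => r _; apply: eq_bigr => c _.
  set x := (r *m invmx D *m c) 0 0.
  have -> : \tr (c *m (r *m invmx D)) = x.
    by rewrite mxtrace_mulC [X in \tr X]mx11_scalar mxtrace_scalar.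
  under eq_bigr => a do rewrite det_corner_unit // mulf_eq0 (negbTE dn0) orbF subr_eq0 -/x.
  rewrite -big_mkcond -mulr_suml; congr (_ * _).
  by have /eqP := chiS; rewrite (bigD1 x) //= addrC addr_eq0 => /eqP.
transitivity (\sum_(r : 'rV[F]_n) (- (#|F| ^ n * (r == 0))%:R) *
    chi (\tr (D *m pid_mx k))).
  apply: eq_bigr => r _; rewrite -mulr_suml sumrN; congr (- _ * _).
  rewrite (@sum_character_mx _ _ 1 n) // muln1; congr (_ * _)%:R; congr nat_of_bool.
  apply/eqP/eqP => [h|->]; last by rewrite mul0mx.
  by rewrite -[r](mulmxKV Du) h mul0mx.
rewrite -mulr_suml sumrN; congr (- _ * _).
rewrite (bigD1 0) //= eqxx muln1 big1 ?addr0 // => r /negbTE ->.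
by rewrite muln0.
Qed.

Lemma unit_kernel_pid (F : finFieldType) (chi : F -> algC) n k : (k <= n)%N ->
  nontrivial_character chi ->
  unit_kernel chi (pid_mx k : 'M[F]_n) =
  (-1) ^+ k * (#|F| ^ (\sum_(n - k <= i < n) i) * gl_card F (n - k))%:R.
Proof.
move=> kn ntchi; elim: k n kn => [|k IH] n kn.
  rewrite subn0 big_geq // expn0 mul1n mul1r /unit_kernel.
  have [chi0 _ _ _] := ntchi.
  under eq_bigr do rewrite pid_mx_0 mulmx0 mxtrace0 chi0.
  by rewrite sumr_const.
case: n kn => // n kn; rewrite unit_kernel_pidS // IH // subSS big_nat_recr ?leq_subr //=.
by rewrite expnD exprS !natrM; ring.
Qed.

Lemma unit_kernelE (F : finFieldType) (chi : F -> algC) n (z : 'M[F]_n) :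
  nontrivial_character chi ->
  unit_kernel chi z = (-1) ^+ \rank z *
    (#|F| ^ (\sum_(n - \rank z <= i < n) i) * gl_card F (n - \rank z))%:R.
Proof.
move=> ntchi; rewrite -(unit_kernel_pid (rank_leq_row z) ntchi).
by rewrite -{1}[z]mulmx_ebase unit_kernel_equiv ?row_ebase_unit ?col_ebase_unit.
Qed.

(** * Counting matrices of given rank *)

Lemma gl_cardE (F : finFieldType) n :
  gl_card F n.+1 = (#|F| ^ 'C(n.+1, 2) * \prod_(1 <= i < n.+2) (#|F| ^ i - 1))%N.
Proof.
rewrite -(card_GL F (ltn0Sn n)) cardsT /= card_sub.
by apply: eq_card => R; rewrite !inE.
Qed.

(** The product of the [1 - q ^ -i] is at least [1/4 + 1 / (2 * q ^ n.+1)]; the second term is the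
    slack that lets the induction close. *)
Lemma prod_subn1_ge q n : (1 < q)%N ->
  (q ^ 'C(n.+2, 2) * (q ^ n.+1 + 2) <=
     (\prod_(1 <= i < n.+2) (q ^ i - 1)) * (4 * q ^ n.+1))%N.
Proof.
move=> q1; elim: n => [|n IH].
  by rewrite big_nat1 !expn1; nia.
rewrite big_nat_recr //= binS bin1 expnD.
have : (2 <= q ^ n.+1)%N by rewrite (leq_trans q1) // -{1}[q]expn1 leq_exp2l.
move: IH; rewrite (expnS q n.+1).
set Q := (q ^ 'C(n.+2, 2))%N; set P := (\prod_(1 <= i < n.+2) _)%N; set x := (q ^ n.+1)%N.
move=> IH x2.
have h : (x * (q * x + 2) <= (x + 2) * (q * x - 1))%N by nia.
have := leq_mul IH (leqnn (q * (q * x - 1))).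
have := leq_mul (leqnn (Q * q)) h.
nia.
Qed.

Lemma gl_card_ge (F : finFieldType) n : (#|F| ^ (n * n) <= 4 * gl_card F n)%N.
Proof.
case: n => [|n].
  rewrite expn0 muln_gt0 /=; apply/card_gt0P; exists 1%:M; exact: unitmx1.
have q1 : (1 < #|F|)%N by exact: card_finRing_gt1.
rewrite gl_cardE.
have := prod_subn1_ge n q1; set P := (\prod_(_ <= _ < _) _)%N => h.
have q0 : (0 < #|F| ^ n.+1)%N by rewrite expn_gt0 ltnW.
rewrite -(leq_pmul2r q0).
have e : (n.+1 * n.+1 = 'C(n.+1, 2) + 'C(n.+2, 2))%N.
  have := mul_bin_left n.+1 1; rewrite bin1 subn1 /= => hb.
  by rewrite [X in (_ + X)%N]binS bin1; lia.
rewrite e expnD.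
have := leq_mul (leqnn (#|F| ^ 'C(n.+1, 2))%N) h.
by set x := (#|F| ^ n.+1)%N; set A := (_ ^ 'C(n.+1, 2))%N; set B := (_ ^ _)%N; nia.
Qed.

Definition full_card (F : finFieldType) n m : nat :=
  #|[pred w : 'M[F]_(n, m) | \rank w == m]|.

Definition rank_card (F : finFieldType) n k : nat :=
  #|[pred z : 'M[F]_n | \rank z == k]|.

(* Both sides bound the number of pairs [(z, V)] where [z] has rank [m] and the
   columns of [V] form a basis of its kernel. *)
Lemma rank_card_full (F : finFieldType) m d :
  (rank_card F (m + d) m * gl_card F d <=
     #|F| ^ ((m + d) * d) * full_card F (m + d) m)%N.
Proof.
pose pairs (z : 'M[F]_(m + d)) (V : 'M[F]_(m + d, d)) :=
  [&& \rank z == m, \rank V == d & z *m V == 0].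
apply: (@leq_trans (\sum_z #|[pred V | pairs z V]|)).
  rewrite /rank_card -sum1_card big_distrl /= big_mkcond; apply: leq_sum => z _.
  rewrite inE; case: ifP => // /eqP rz; rewrite mul1n.
  pose f (U : 'M[F]_d) := invmx (row_ebase z) *m col_mx (0 : 'M[F]_(m, d)) U.
  have fI : injective f.
    move=> U U' /(congr1 (mulmx (row_ebase z))); rewrite !mulKVmx ?row_ebase_unit //.
    by move=> /eq_col_mx[].
  rewrite /gl_card -(fintype.card_image fI); apply: subset_leq_card.
  apply/fintype.subsetP => V.
  move=> /fintype.imageP[U]; rewrite !inE => Uu -> {V}; rewrite /pairs rz eqxx /=.
  apply/andP; split.
    rewrite -mxrank_tr trmx_mul mxrankMfree; last first.
      by rewrite row_free_unit unitmx_tr unitmx_inv row_ebase_unit.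
    rewrite mxrank_tr -addsmxE adds0mx mxrank_unit //.
  rewrite /f mulmxA -{1}[z]mulmx_ebase rz mulmxK ?row_ebase_unit // -mulmxA.
  rewrite (_ : pid_mx m = block_mx 1%:M 0 0 0 :> 'M[F]_(m + d)).
    by rewrite mul_block_col !mulmx0 !mul0mx !addr0 col_mx0 mulmx0.
  by rewrite -pid_mx_block.
apply: (@leq_trans (\sum_V #|[pred z | pairs z V]|)).
  have cardE (T : finType) (P : pred T) : #|[pred x | P x]| = (\sum_x P x)%N.
    by rewrite -sum1_card big_mkcond; apply: eq_bigr => x _; rewrite inE; case: (P x).
  under eq_bigr do rewrite cardE; under [leqRHS]eq_bigr do rewrite cardE.
  by rewrite exchange_big.
rewrite -card_mx -sum_nat_const; apply: leq_sum => V _.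
case: (eqVneq (\rank V) d) => [rV|/negbTE rV]; last first.
  by rewrite (eq_card0 (A := [pred z | pairs z V])) // => z; rewrite !inE /pairs rV andbF.
have kV : \rank (kermx V) = m by rewrite mxrank_ker rV addnK.
have -> : full_card F (m + d) m = full_card F (m + d) (\rank (kermx V)) by rewrite kV.
apply: leq_trans (leq_image_card (fun w => w *m row_base (kermx V)) _).
apply: subset_leq_card; apply/fintype.subsetP => z; rewrite !inE => /and3P[/eqP rz _ /eqP zV].
have zk : (z <= row_base (kermx V))%MS by rewrite eq_row_base; apply/sub_kermxP.
apply/fintype.imageP; exists (z *m pinvmx (row_base (kermx V))); last by rewrite mulmxKpV.
by rewrite inE -(mxrankMfree _ (row_base_free (kermx V))) mulmxKpV // rz kV.
Qed.

(* [row_mx w u] is invertible when [u] is [col_mx X U] with [U] invertible in a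
   basis extending the columns of [w]. *)
Lemma full_card_gl (F : finFieldType) m d :
  (full_card F (m + d) m * (#|F| ^ (m * d) * gl_card F d) <= gl_card F (m + d))%N.
Proof.
pose S := [pred q : 'M[F]_(m + d, m) * 'M[F]_(m, d) * 'M[F]_d |
  (\rank q.1.1 == m) && (q.2 \in unitmx)].
pose f (q : 'M[F]_(m + d, m) * 'M[F]_(m, d) * 'M[F]_d) : 'M[F]_(m + d) :=
  row_mx q.1.1 (col_ebase q.1.1 *m col_mx q.1.2 q.2).
have fI : injective f.
  case=> [[w X] U] [[w' X'] U'] /eq_row_mx[/= <-].
  move=> /(congr1 (mulmx (invmx (col_ebase w)))); rewrite !mulKmx ?col_ebase_unit //.
  by move=> /eq_col_mx[-> ->].
have <- : #|S| = (full_card F (m + d) m * (#|F| ^ (m * d) * gl_card F d))%N.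
  rewrite -card_mx /full_card /gl_card mulnA.
  rewrite -[X in (X * _)%N]cardX -cardX; apply: eq_card => -[[w X] U].
  by rewrite !inE /= andbT.
rewrite -(fintype.card_image fI); apply: subset_leq_card; apply/fintype.subsetP => R.
move=> /fintype.imageP[[[w X] U]]; rewrite !inE /= => /andP[/eqP rw Uu] ->.
rewrite /f /= -{1}[w]mulmx_ebase rw.
rewrite pid_mx_col -mulmxA mul_col_mx mul1mx mul0mx -mul_mx_row.
rewrite unitmx_mul col_ebase_unit /= -block_mxEh unitmxE det_ublock unitrM.
by rewrite -!unitmxE row_ebase_unit.
Qed.

Lemma rank_card_bound (F : finFieldType) m d :
  (rank_card F (m + d) m * gl_card F d * (gl_card F d) <=
     #|F| ^ (d * d) * gl_card F (m + d))%N.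
Proof.
have q0 k : (0 < #|F| ^ k)%N 
  by rewrite expn_gt0 ltnW // card_finRing_gt1.
rewrite -(leq_pmul2l (q0 (m * d)%N)).
apply: leq_trans (_ : #|F| ^ (m * d) * gl_card F d *
   (#|F| ^ ((m + d) * d) * full_card F (m + d) m) <= _)%N.
  by have := leq_mul (leqnn (#|F| ^ (m * d) * gl_card F d)%N) (rank_card_full F m d); lia.
have := leq_mul (leqnn (#|F| ^ ((m + d) * d))%N) (full_card_gl F m d).
by rewrite mulnDl expnD; lia.
Qed.

Lemma rank_card_le (F : finFieldType) n d : (d <= n)%N ->
  (rank_card F n (n - d) * gl_card F d <= 4 * gl_card F n)%N.
Proof.
move=> dn; have := rank_card_bound F (n - d) d; rewrite subnK // => h.
have g0 : (0 < gl_card F d)%N by apply/card_gt0P; exists 1%:M; exact: unitmx1.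
rewrite -(leq_pmul2r g0); apply: leq_trans h _.
have := leq_mul (gl_card_ge F d) (leqnn (gl_card F n)); lia.
Qed.

(** For corank 1 the ratio [q / (q - 1) <= 2] replaces the generic constant 4; the margin after ten
    repetitions relies on it. *)
Lemma rank_card_pred_le (F : finFieldType) n : (0 < n)%N ->
  (rank_card F n n.-1 * gl_card F 1 <= 2 * gl_card F n)%N.
Proof.
move=> n0; have := rank_card_bound F n.-1 1; rewrite addn1 prednK // mul1n expn1 => h.
have q1 : (1 < #|F|)%N by exact: card_finRing_gt1.
have g1 : gl_card F 1 = (#|F| - 1)%N by rewrite gl_cardE big_nat1 expn1 mul1n.
rewrite g1 in h *; nia.
Qed.

(** * Lower bounds for matrix problems *)

Definition kernel_size (F : finFieldType) n k : nat :=
  #|F| ^ (\sum_(n - k <= i < n) i) * gl_card F (n - k).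

(** The values of [unit_kernel] as integers, so that a bound proved in [algC] can be read in [R]. *)
Definition kernel_int (F : finFieldType) n (z : 'M[F]_n) : int :=
  (-1) ^+ \rank z * (kernel_size F n (\rank z))%:R.

Lemma kernel_int_discrepancy p n (A B : pred 'M['F_p]_n) : prime p ->
  `|\sum_(x | A x) \sum_(y | B y) kernel_int (x + y)| <= ((#|'F_p| ^ (n * n))%:R ^+ 2 : int).
Proof.
move=> pp; have [chi ntchi] := exists_character pp.
rewrite -(ler_int algC) intr_norm rmorph_sum /=.
under eq_bigr do rewrite rmorph_sum /=.
rewrite rmorphXn /= rmorph_nat; apply: le_trans (unit_kernel_discrepancy A B ntchi).
rewrite le_eqVlt; apply/orP; left; apply/eqP; congr `|_|.
apply: eq_bigr => x _; apply: eq_bigr => y _.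
by rewrite unit_kernelE // /kernel_int rmorphM rmorphXn rmorphN1 rmorph_nat.
Qed.

Lemma gl_card_gt0 (F : finFieldType) n : (0 < gl_card F n)%N.
Proof. by apply/card_gt0P; exists 1%:M; exact: unitmx1. Qed.

(** At corank [d] the exponent of the kernel is ['C(n, 2) - 'C(d, 2)]; the second term is the source
    of the decay. *)
Lemma kernel_size_split (F : finFieldType) n d : (d <= n)%N ->
  (kernel_size F n (n - d) * #|F| ^ 'C(d, 2) =
     #|F| ^ 'C(n, 2) * gl_card F d)%N.
Proof.
move=> dn; rewrite /kernel_size subKn // mulnAC -expnD; congr (_ ^ _ * _)%N.
by rewrite -!bin2_sum addnC -big_cat_nat.
Qed.

Lemma kernel_size_full (F : finFieldType) n : kernel_size F n n = (#|F| ^ 'C(n, 2))%N.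
Proof.
have := kernel_size_split F (leq0n n); rewrite subn0 muln1 => ->.
suff -> : gl_card F 0 = 1%N by rewrite muln1.
rewrite /gl_card (eq_card (B := predT)) => [|R].
  by rewrite card_mx.
by rewrite !inE unitmxE det_mx00 unitr1.
Qed.

(** Since ['C(d.+3, 2)] is at least [3 * d.+1], the layers of corank at least 3 decay with ratio
    1/8. *)
Lemma exp_bin2_ge q d : (1 < q)%N -> (8 ^ d.+1 <= q ^ 'C(d.+3, 2))%N.
Proof.
move=> q1; apply: (@leq_trans (2 ^ 'C(d.+3, 2))); last first.
  by rewrite leq_exp2r ?bin_gt0.
rewrite (_ : 8 = 2 ^ 3)%N // -expnM leq_exp2l //.
elim: d => [|d IH] //; rewrite binS bin1; lia.
Qed.

(* Up to sign and scale, the Fourier transform of the indicator of the invertible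
   matrices. Its mass on corank [d] decays like [p ^ - 'C(d, 2)], and coranks 0
   and 1 have opposite signs. *)
Section MatrixWitness.
Variables (R : realType) (p n : nat).
Hypotheses (p_pr : prime p) (n_ge2 : (2 <= n)%N).

Local Notation F := 'F_p.
Let m0 : R := (gl_card F n * kernel_size F n n)%:R.

Let m0_gt0 : 0 < m0.
Proof.
rewrite ltr0n muln_gt0 gl_card_gt0 kernel_size_full expn_gt0.
by apply/orP; left; apply: ltnW; apply: card_finRing_gt1.
Qed.

Let corank (z : 'M[F]_n) := (n - \rank z)%N.

(** The sign and the scale [m0] make it the uniform probability on the invertible matrices. *)
Definition rank_witness (z : 'M[F]_n) : R := (-1) ^+ n * (kernel_int z)%:~R / m0.

Definition rank_pos (z : 'M[F]_n) : R := (z \in unitmx)%:R / (gl_card F n)%:R.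

(** Corank 2 is absent because the witness is nonnegative there; coranks at least 3 are charged
    whatever their sign. *)
Definition rank_neg (z : 'M[F]_n) : R :=
  ((corank z == 1) || (3 <= corank z))%N%:R * (kernel_size F n (\rank z))%:R / m0.

Lemma rank_pos_sum : \sum_z rank_pos z = 1.
Proof.
rewrite /rank_pos -mulr_suml -natr_sum.
have -> : (\sum_(z : 'M[F]_n) (z \in unitmx) = gl_card F n)%N.
  rewrite /gl_card -sum1_card [RHS]big_mkcond; apply: eq_bigr => z _.
  by rewrite inE; case: ifP.
by rewrite divff // pnatr_eq0 -lt0n gl_card_gt0.
Qed.

Lemma rank_witness_ge z : rank_pos z - rank_neg z <= rank_witness z.
Proof.
have rn : (\rank z <= n)%N := rank_leq_row z.
have G0 : 0 < (gl_card F n)%:R :> R by rewrite ltr0n gl_card_gt0.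
rewrite /rank_witness /kernel_int rmorphM rmorphXn rmorphN1 rmorph_nat /= mulrA -exprD.
have -> : (-1) ^+ (n + \rank z) = (-1) ^+ (corank z) :> R.
  rewrite -[LHS]signr_odd -[RHS]signr_odd; congr (_ ^+ _).
  by rewrite oddD oddB // addbC.
rewrite /rank_pos /rank_neg -row_full_unit /row_full.
have K0 : 0 <= (kernel_size F n (\rank z))%:R / m0 by rewrite divr_ge0 // ltW.
case: (eqVneq (\rank z) n) => [rz|rz].
  have -> : corank z = 0%N by rewrite /corank rz subnn.
  rewrite /= !mul0r subr0 expr0 rz mul1r mul1r /m0 natrM invfM mulrCA divff.
    by rewrite mulr1.
  by rewrite kernel_size_full pnatr_eq0 -lt0n expn_gt0 ltnW // card_finRing_gt1.
have : (0 < corank z)%N by rewrite subn_gt0 ltn_neqAle rz.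
rewrite /= mul0r sub0r -![_ * _ / m0]mulrA; set K := _ / m0 in K0 *.
case: (corank z) => [|[|[|k]]] // _ /=; rewrite ?mul0r ?mul1r.
- by rewrite mulN1r.
- by rewrite oppr0 -signr_odd mul1r.
- rewrite -[leLHS]mulN1r; apply: ler_wpM2r => //.
  by rewrite -signr_odd; case: (odd _); rewrite ?expr0 ?expr1 // (le_trans (lerN10 _)).
Qed.

Lemma rank_witness_discrepancy (A B : pred 'M[F]_n) :
  \sum_(a | A a) \sum_(b | B b) rank_witness (a + b)
    <= #|{: 'M[F]_n}|%:R * (#|{: 'M[F]_n}|%:R / m0).
Proof.
rewrite mulrA ler_pdivlMr // /rank_witness.
under eq_bigr do rewrite -mulr_suml -mulr_sumr.
rewrite -mulr_suml -mulr_sumr divfK ?gt_eqF //.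
apply: le_trans (ler_norm _) _; rewrite normrM normrX normrN1 expr1n mul1r.
have := kernel_int_discrepancy A B p_pr; rewrite -(ler_int R) intr_norm rmorph_sum /=.
under eq_bigr do rewrite rmorph_sum /=.
by rewrite rmorphXn /= rmorph_nat -expr2 card_mx.
Qed.

Lemma rank_neg_layer d : (d <= n)%N ->
  \sum_(z | corank z == d) rank_neg z <=
  if d == 1%N then 2 else if (3 <= d)%N then 4 / 8 ^+ (d - 2) else 0.
Proof.
move=> dn; have q1 : (1 < #|F|)%N by exact: card_finRing_gt1.
have E : \sum_(z | corank z == d) rank_neg z =
   ((d == 1) || (3 <= d))%N%:R * (rank_card F n (n - d) * kernel_size F n (n - d))%N%:R / m0.
  rewrite (eq_bigr (fun=> ((d == 1) || (3 <= d))%N%:R * (kernel_size F n (n - d)%N)%:R / m0)).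
    have -> : rank_card F n (n - d)%N = #|fun z => corank z == d|.
      apply: eq_card => z; rewrite !inE /in_mem /= /corank.
      have := rank_leq_row z; move: (\rank z) => r rn.
      by apply/eqP/eqP => h; move: h rn dn; clear; lia.
    by rewrite sumr_const -[LHS]mulr_natl natrM; ring.
  move=> z /eqP <-; rewrite /rank_neg /corank subKn //; exact: rank_leq_row.
rewrite E ler_pdivrMr // /m0 kernel_size_full.
have [d1|d1] := eqVneq d 1%N.
  rewrite d1 /= mul1r -natrM ler_nat.
  have := kernel_size_split F (ltnW n_ge2); rewrite muln1 => ->.
  have := rank_card_pred_le F (ltnW n_ge2); rewrite -subn1 => h.
  by rewrite [(_ ^ _ * _)%N]mulnC !mulnA leq_mul.
case: ifP => d3 /=; last by rewrite !mul0r.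
rewrite mul1r -mulrA [_^-1 * _]mulrC mulrA ler_pdivlMr ?exprn_gt0 //.
rewrite -natrX -!natrM ler_nat.
apply: leq_trans (_ : rank_card F n (n - d) *
    kernel_size F n (n - d) * #|F| ^ 'C(d, 2) <= _)%N.
  rewrite leq_mul // (_ : d = (d - 3).+3) ?subn2 /=; last lia.
  exact: exp_bin2_ge.
rewrite -mulnA kernel_size_split //.
by rewrite [(_ ^ _ * _)%N]mulnC !mulnA leq_mul // rank_card_le.
Qed.

Lemma rank_neg_sum (beta : R) : 0 <= beta ->
  \sum_z rank_neg z * (if corank z == 1%N then beta else 1) <= 2 * beta + 4 / 7.
Proof.
move=> b0.
have cork (z : 'M[F]_n) : (corank z < n.+1)%N by rewrite ltnS leq_subr.
rewrite (partition_big (fun z => Ordinal (cork z)) predT) //=.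
pose cf (d : nat) : R := if d == 1%N then 2 * beta else
  if (3 <= d)%N then 4 / 8 ^+ (d - 2) else 0.
apply: le_trans (_ : \sum_(d < n.+1) cf d <= _).
  apply: ler_sum => d _.
  rewrite (eq_bigl (fun z => corank z == d)); last by move=> z; rewrite -val_eqE.
  have dn : (d <= n)%N by rewrite -ltnS.
  rewrite (eq_bigr (fun z => rank_neg z * (if d == 1%N :> nat then beta else 1))); last first.
    by move=> z /eqP ->.
  rewrite -mulr_suml; have := rank_neg_layer dn; rewrite /cf.
  case: ifP => d1; last by rewrite mulr1.
  by move=> h; apply: ler_wpM2r.
have -> : n.+1 = (n - 2).+3 by lia.
elim: (n - 2)%N => [|k IH].
  by rewrite !big_ord_recr big_ord0 /= /cf /=; lra.
(* The total 4/7 is the sum of the [4 / 8 ^ i] with i at least 1; the exact partial sum is what the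
   induction can carry. *)
apply: le_trans (_ : 2 * beta + 4 / 7 * (1 - 8 ^- k.+1) <= _); last first.
  by rewrite mulrBr mulr1 addrA gerBl mulr_ge0 // ?divr_ge0 ?invr_ge0 ?exprn_ge0.
elim: k {IH} => [|k IH].
  by rewrite !big_ord_recr big_ord0 /= /cf /=; lra.
rewrite big_ord_recr /=; apply: le_trans (lerD IH (lexx _)) _.
rewrite /cf /= subn2 /= (exprS _ k.+1) invfM; set x := 8 ^- k.+1; lra.
Qed.
End MatrixWitness.

(** [400 = 20 ^ 2] for at most twenty calls, ten runs of a tester with two; [40 = 2 * 20] for an
    advantage of 1/20; and 8 because the logarithm is at least [n ^ 2 * ln p / 8]. *)
Definition matrix_const (R : realType) : R := (400 * 40 * ln 5 * 8)^-1.

Lemma matrix_const_gt0 (R : realType) : 0 < matrix_const R.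
Proof. by rewrite invr_gt0 !mulr_gt0 ?ltr0n // ln_gt0 // ltr1n. Qed.

Lemma witness_eta (R : realType) p n : prime p ->
  #|{: 'M['F_p]_n}|%:R / (gl_card 'F_p n * kernel_size 'F_p n n)%:R
    <= 4 / p%:R ^+ 'C(n, 2) :> R.
Proof.
move=> pp; have p0 : 0 < p%:R :> R by rewrite ltr0n prime_gt0.
have cF : #|'F_p| = p by exact: card_Fp.
rewrite kernel_size_full card_mx cF ler_pdivrMr; last first.
  by rewrite ltr0n muln_gt0 gl_card_gt0 expn_gt0 prime_gt0.
rewrite [(gl_card _ _ * _)%N]mulnC !natrM !natrX mulrA divfK ?expf_neq0 ?gt_eqF //.
by rewrite -natrX -natrM ler_nat; have := gl_card_ge 'F_p n; rewrite cF.
Qed.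

(** The threshold 61/80 is the one of the inverse tester; the rank tester satisfies it easily. *)
Lemma matrix_cost (R : realType) p s n A (T : tester R s 'M['F_p]_n A) C :
  prime p -> (2 <= s)%N -> (8 <= n)%N -> (0 < #|calls T| <= 2)%N ->
  calls_cost_le T C -> (forall i, blind T i) ->
  (forall x : {ffun 'I_s -> 'M['F_p]_n}, total x \in unitmx -> 39 / 40 <= accept_pr T x) ->
  (forall x : {ffun 'I_s -> 'M['F_p]_n},
     (n - \rank (total x) = 1)%N -> accept_pr T x <= 61 / 80) ->
  matrix_const R * s%:R * n%:R ^+ 2 * ln p%:R <= C%:R.
Proof.
move=> pp s2 n8 /andP[c0 c2] hC bl hpos hneg.
have n2 : (2 <= n)%N by apply: leq_trans n8.
(* Ten repetitions give (39/40)^10 - 2 (61/80)^10 - 4/7 > 1/20, where 2 and 4/7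
   bound the relative masses of corank 1 and of coranks at least 3. *)
pose T10 := expt_tester T 10.
have p1 : 1 < p%:R :> R by rewrite ltr1n prime_gt1.
have p0 : 0 < p%:R :> R by apply: lt_trans p1.
have lnp : ln 2 <= ln p%:R :> R by rewrite ler_ln ?posrE // ler_nat prime_gt1.
have ln2 : 0 < ln 2 :> R by rewrite ln_gt0 // ltr1n.
have ln5 : 0 < ln 5 :> R by rewrite ln_gt0 // ltr1n.
have hC10 : calls_cost_le T10 C by move=> w [k j] x; apply: hC.
have bl10 i : blind T10 i by move=> w x a o; apply: eq_forallb => k; apply: bl.
have a10 x : accept_pr T10 x = accept_pr T x ^+ 10 by exact: expt_tester_accept.
have J : #|calls T10| = (10 * #|calls T|)%N by rewrite card_prod card_ord.
have J0 : (0 < #|calls T10|)%N by rewrite J muln_gt0.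
have J20 : #|calls T10|%:R <= 20 :> R by rewrite ler_nat J; lia.
set eta : R := 4 / p%:R ^+ 'C(n, 2).
have eta0 : 0 < eta by rewrite divr_gt0 ?exprn_gt0.
pose b (z : 'M['F_p]_n) : R := if (n - \rank z == 1)%N then (61 / 80) ^+ 10 else 1.
have [] := @xor_cost R s 'M['F_p]_n A T10 C (@rank_witness R p n) (@rank_pos R p n)
  (@rank_neg R p n) b eta (20^-1) ((39 / 40) ^+ 10) s2 hC10 bl10.
- by move=> z; rewrite /rank_pos divr_ge0.
- by move=> z; rewrite /rank_neg divr_ge0 ?mulr_ge0.
- exact: rank_pos_sum.
- exact: rank_witness_ge.
- move=> x; rewrite /rank_pos a10; case: (boolP (_ \in _)) => [u _|_].
    by apply: lerXn2r; rewrite ?nnegrE ?accept_pr_ge0 ?divr_ge0 // hpos.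
  by rewrite mul0r eqxx.
- move=> x _; rewrite a10 /b; case: eqP => [h|_].
    by apply: lerXn2r; rewrite ?nnegrE ?accept_pr_ge0 ?divr_ge0 // hneg.
  by apply: exprn_ile1; rewrite ?accept_pr_ge0 ?accept_pr_le1.
- have := @rank_neg_sum R p n pp n2 ((61 / 80) ^+ 10); rewrite exprn_ge0 ?divr_ge0 //.
  move=> /(_ isT) h.
  have {h} : \sum_z rank_neg R z * b z <= 2 * (61 / 80) ^+ 10 + 4 / 7 by exact: h.
  set S := \sum_z _; lra.
- exact: J0.
- by rewrite invr_gt0.
move=> _ /(_ eta0) H; apply: le_trans (H _) => [|A0 B0]; last first.
  apply: le_trans (rank_witness_discrepancy R pp A0 B0) _.
  by apply: ler_wpM2l => //; exact: witness_eta.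
have e : 20^-1 / (2 * eta) = p%:R ^+ 'C(n, 2) / 160.
  by rewrite /eta; field; rewrite expf_neq0 // gt_eqF.
have binE : 'C(n, 2)%:R = n%:R * (n%:R - 1) / 2 :> R.
  apply: (mulfI (x := 2)) => //; rewrite -natrM mul_bin_left bin1 subn1 natrM.
  by rewrite -subn1 natrB 1?ltnW //; field.
(* For n at least 8 the quadratic term absorbs both [160 = 20 * 2 * 4] and the loss from [n ^ 2] to
   [n * (n - 1)]. *)
have lne : 4^-1 * n%:R ^+ 2 * ln p%:R <= 2 * ln (20^-1 / (2 * eta)).
  rewrite e ln_div ?posrE ?exprn_gt0 // lnXn // -[ln p%:R *+ _]mulr_natl binE.
  have l160 : ln 160 <= 8 * ln p%:R :> R.
    apply: le_trans (_ : 8 * ln 2 <= _); last by rewrite ler_pM2l.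
    by rewrite mulr_natl -lnXn // ler_ln ?posrE ?exprn_gt0 //; lra.
  have n8r : 8 <= n%:R :> R by rewrite ler_nat.
  have : 0 <= (n%:R * (n%:R - 1) - 16 - 4^-1 * n%:R ^+ 2) * ln p%:R :> R.
    by rewrite mulr_ge0 //; [nra | lra].
  move: l160; set L := ln p%:R; nra.
have lne0 : 0 <= ln (20^-1 / (2 * eta)).
  by rewrite -(@pmulr_rge0 _ 2) //; apply: le_trans lne; rewrite !mulr_ge0 ?sqr_ge0 //; lra.
have c20 : (20 * (2 * 400 * ln 5))^-1 <= 20^-1 / (2 * #|calls T10|%:R ^+ 2 * ln 5) :> R.
  have Jr : 0 < #|calls T10|%:R :> R by rewrite ltr0n.
  rewrite -invrM ?unitfE ?gt_eqF // ?mulr_gt0 ?exprn_gt0 // mulrC.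
  rewrite lef_pV2 ?posrE ?mulr_gt0 ?exprn_gt0 ?ltr0n //.
  apply: ler_wpM2r => //; apply: ler_wpM2r; first exact: ltW.
  apply: ler_wpM2l => //; rewrite (_ : 400 = 20 ^+ 2); last by rewrite -natrX.
  by apply: lerXn2r => //; rewrite nnegrE ltW.
apply: le_trans (_ : (20 * (2 * 400 * ln 5))^-1 * s%:R *
    ln (20^-1 / (2 * eta)) <= _); last first.
  by apply: ler_wpM2r => //; apply: ler_wpM2r.
have -> : matrix_const R * s%:R * n%:R ^+ 2 * ln p%:R =
   (20 * (2 * 400 * ln 5))^-1 * s%:R * (8^-1 * n%:R ^+ 2 * ln p%:R).
  by rewrite /matrix_const; field; rewrite gt_eqF.
apply: ler_wpM2l; first by rewrite mulr_ge0 ?invr_ge0 ?mulr_ge0 ?ler0n ?(ltW ln5).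
lra.
Qed.

(** * Testers obtained from correct protocols *)

Lemma rand_cc_ge (R : realType) s (X : finType) (A : eqType) (delta b : R)
    (f : problem s X A) :
  (forall P : protocol R s X A, correct delta f P -> b <= (cost P)%:R) ->
  (b%:E <= rand_cc delta f)%E.
Proof.
by move=> h; apply: le_ereal_inf_tmp => _ [P cP ->]; rewrite lee_fin; apply: h.
Qed.

Lemma cost_ge (R : realType) s (X : finType) A (P : protocol R s X A) w (y : 'I_s -> X) :
  ((execute (strategy P w) y).1 <= cost P)%N.
Proof.
have -> : y = [ffun i => y i] by apply/funext => i; rewrite ffunE.
apply: leq_trans (leq_bigmax w).
exact: (leq_bigmax (F := fun x : {ffun 'I_s -> X} => (execute (strategy P w) x).1)).
Qed.

Lemma correct_accept (R : realType) s X (A : eqType) (delta : R) (f : problem s X A)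
    (P : protocol R s X A) (tst : pred A) y :
  correct delta f P -> promise f y -> tst (answer f y) ->
  1 - delta <= \sum_(w | tst (execute (strategy P w) y).2) coin_pr P w.
Proof.
move=> cP py ta; apply: le_trans (cP y py) _.
rewrite /success_pr big_mkcond [leRHS]big_mkcond; apply: ler_sum => w _.
case: eqP => [->|_]; first by rewrite ta.
by case: ifP => // _; apply: coin_pr_ge0.
Qed.

Lemma correct_reject (R : realType) s X (A : eqType) (delta : R) (f : problem s X A)
    (P : protocol R s X A) (tst : pred A) y :
  correct delta f P -> promise f y -> ~~ tst (answer f y) ->
  \sum_(w | tst (execute (strategy P w) y).2) coin_pr P w <= delta.
Proof.
move=> cP py ta; have := correct_accept (tst := predC tst) cP py ta.
have := coin_pr_sum1 P; rewrite (bigID (fun w => tst (execute (strategy P w) y).2)) /=.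
set a := \sum_(i | _) _; set b := \sum_(i | _) _; lra.
Qed.

Definition single_tester (R : realType) s (V X A : Type) (P : protocol R s X A)
    (phi : 'I_s -> V -> X) (tst : {ffun 'I_s -> V} -> pred A) : tester R s V A :=
  @Tester R s V A (coin P) (coin_pr P) (@coin_pr_ge0 _ _ _ _ P) (coin_pr_sum1 P)
    unit (fun w _ => premap phi (strategy P w)) (fun w x o => tst x (o tt)).

Lemma single_tester_cost (R : realType) s V (X : finType) A (P : protocol R s X A)
    (phi : 'I_s -> V -> X) (tst : {ffun 'I_s -> V} -> pred A) :
  calls_cost_le (single_tester P phi tst) (cost P).
Proof. by move=> w j x; apply: cost_ge. Qed.

Lemma single_tester_accept (R : realType) s V X (A : eqType) (delta : R)
    (f : problem s X A) (P : protocol R s X A) (phi : 'I_s -> V -> X)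
    (tst : {ffun 'I_s -> V} -> pred A) (x : {ffun 'I_s -> V}) :
  correct delta f P -> promise f (fun i => phi i (x i)) ->
  tst x (answer f (fun i => phi i (x i))) ->
  1 - delta <= accept_pr (single_tester P phi tst) x.
Proof. by move=> cP py ta; apply: correct_accept cP py ta. Qed.

Lemma single_tester_reject (R : realType) s V X (A : eqType) (delta : R)
    (f : problem s X A) (P : protocol R s X A) (phi : 'I_s -> V -> X)
    (tst : {ffun 'I_s -> V} -> pred A) (x : {ffun 'I_s -> V}) :
  correct delta f P -> promise f (fun i => phi i (x i)) ->
  ~~ tst x (answer f (fun i => phi i (x i))) ->
  accept_pr (single_tester P phi tst) x <= delta.
Proof. by move=> cP py ta; apply: correct_reject cP py ta. Qed.

Lemma rank_cost (R : realType) p s n (P : protocol R s 'M['F_p]_n.+1 nat) :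
  prime p -> (2 <= s)%N -> (8 <= n.+1)%N -> correct 40^-1 (rank_problem p s n) P ->
  matrix_const R * s%:R * n.+1%:R ^+ 2 * ln p%:R <= (cost P)%:R.
Proof.
move=> pp s2 n8 cP.
pose T := single_tester P (fun _ => id) (fun _ a => a == n.+1).
apply: (@matrix_cost R p s n.+1 _ T) => //.
- by rewrite card_unit.
- exact: single_tester_cost.
- move=> x ux; have rx : \rank (total x) = n.+1 by apply: mxrank_unit.
  have -> : 39 / 40 = 1 - 40^-1 :> R by lra.
  apply: single_tester_accept cP _ _ => /=; first by rewrite rx eqxx orbT.
  by rewrite rx.
- move=> x rx; have {}rx : \rank (total x) = n.
    by move: rx; have := rank_leq_row (total x); move: (\rank _) => r; lia.
  apply: le_trans (_ : 40^-1 <= _); last by lra.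
  apply: single_tester_reject cP _ _ => /=; first by rewrite rx eqxx.
  by rewrite rx ltn_eqF.
Qed.

(** * Bordered matrices and the corner of the inverse *)

Lemma card_nonzero_ge (V : finZmodType) (W : zmodType) (h : V -> W) x0 :
  {morph h : x y / x + y} -> h x0 != 0 ->
  (#|V| <= 2 * #|[pred x | h x != 0%R]|)%N.
Proof.
move=> hD h0; have <- := cardC [pred x | h x != 0].
rewrite mul2n -addnn leq_add2l.
(* Translation by [x0] injects the zeros of [h] into the complement. *)
rewrite -(fintype.card_image (addIr x0)); apply: subset_leq_card.
apply/fintype.subsetP => y /fintype.imageP[x]; rewrite !inE negbK => /eqP hx ->.
by rewrite hD hx add0r.
Qed.

(** The determinant is affine in the corner with slope [\det D], so it cannot vanish at both 0 and
    1. *)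
Lemma det_corner_neq0 (F : fieldType) n (r : 'rV[F]_n) (c : 'cV[F]_n) (D : 'M[F]_n) :
  D \in unitmx -> exists b : bool, block_mx (b%:R)%:M r c D \in unitmx.
Proof.
rewrite unitmxE unitfE => d0.
case: (boolP (block_mx (0%:R)%:M r c D \in unitmx)) => [h|]; first by exists false.
rewrite unitmxE unitfE negbK det_corner mul0r addr0 => /eqP h.
by exists true; rewrite unitmxE unitfE det_corner h add0r mul1r.
Qed.

(** By Cramer's rule the corner of the inverse is [\det D / \det M]. *)
Lemma invmx_corner (F : fieldType) n (a : F) (r : 'rV[F]_n) (c : 'cV[F]_n) (D : 'M[F]_n) :
  let M : 'M[F]_n.+1 := block_mx a%:M r c D in
  M \in unitmx -> (invmx M ord0 ord0 == 0) = (D \notin unitmx).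
Proof.
move=> M uM; rewrite /invmx uM mxE mulf_eq0 invr_eq0.
have -> : (\det M == 0) = false by apply/negbTE; move: uM; rewrite unitmxE unitfE.
rewrite /= mxE /cofactor addn0 expr0 mul1r unitmxE unitfE negbK.
suff -> : row' ord0 (col' ord0 M) = D by [].
apply/matrixP => i j; rewrite !mxE; case: splitP => k /=; first by rewrite ord1.
move=> ik; rewrite !mxE; case: splitP => l /=; first by rewrite ord1.
by move=> jl; congr (D _ _); apply: val_inj; [case: ik | case: jl].
Qed.

(** [k] and [l] span the left and right kernels of [D]. A row vector killed by the bordered matrix
    loses its first entry after multiplication by [l]; its remainder is then a multiple of [k],
    which [k *m c != 0] forces to be zero. *)
Lemma corank1_border (F : finFieldType) n (D : 'M[F]_n) : (n - \rank D = 1)%N ->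
  exists (k : 'rV[F]_n) (l : 'cV[F]_n), [/\ k != 0, l != 0 &
    forall a r c, k *m c != 0 -> r *m l != 0 ->
      block_mx (a%:M : 'M[F]_1) r c D \in unitmx].
Proof.
move=> rD; pose k := nz_row (kermx D); pose l := (nz_row (kermx D^T))^T.
have k0 : k != 0 by rewrite nz_row_eq0 -mxrank_eq0 mxrank_ker rD.
have l0 : l != 0 by rewrite trmx_eq0 nz_row_eq0 -mxrank_eq0 mxrank_ker mxrank_tr rD.
have Dl : D *m l = 0.
  apply: trmx_inj; rewrite trmx_mul trmxK trmx0; apply/sub_kermxP; exact: nz_row_sub.
have kk : (kermx D <= k)%MS.
  rewrite -(geq_leqif (mxrank_leqif_sup (nz_row_sub _))) mxrank_ker rD.
  by rewrite lt0n mxrank_eq0.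
exists k, l; split => // a r c kc rl.
rewrite -row_free_unit; apply: inj_row_free => v.
rewrite -[v]hsubmxK; set al : 'M[F]_1 := lsubmx v; set w := rsubmx v.
rewrite mul_row_block => /eqP; rewrite row_mx_eq0 => /andP[/eqP h1 /eqP h2].
have al0 : al = 0.
  have := congr1 (mulmx^~ l) h2; rewrite /= mulmxDl -!mulmxA Dl mulmx0 addr0 mul0mx.
  rewrite [al]mx11_scalar mul_scalar_mx => /eqP.
  by rewrite scaler_eq0 (negbTE rl) orbF => /eqP ->; rewrite raddf0.
move: h1 h2; rewrite al0 !mul0mx !add0r => h1 h2.
have /sub_rVP[be wk] : (w <= k)%MS by apply: submx_trans kk; apply/sub_kermxP.
move: h1; rewrite wk -scalemxAl => /eqP; rewrite scaler_eq0 (negbTE kc) orbF => /eqP ->.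
by rewrite scale0r row_mx0.
Qed.

(** The border consists of public coins, so player 0 can add it to its share at no cost. *)
Definition bordered (F : fieldType) s n (b : bool) (r : 'rV[F]_n) (c : 'cV[F]_n)
    (i : 'I_s) (D : 'M[F]_n) : 'M[F]_n.+1 :=
  block_mx (0 : 'M[F]_1) 0 0 D +
  (if i == 0%N :> nat then block_mx (b%:R)%:M r c 0 else 0).

Lemma total_bordered (F : fieldType) s n b (r : 'rV[F]_n) c (x : 'I_s -> 'M[F]_n) :
  (0 < s)%N ->
  total (fun i => bordered b r c i (x i)) = block_mx (b%:R)%:M r c (total x).
Proof.
move=> s0; rewrite /total big_split /=.
have -> : \sum_(i < s) (if i == 0%N :> nat then block_mx (b%:R)%:M r c 0 else 0) =
    block_mx (b%:R)%:M r c 0 :> 'M[F]_(1 + n).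
  rewrite (bigD1 (Ordinal s0)) //= big1 ?addr0 // => i.
  by rewrite -val_eqE /= => /negbTE ->.
rewrite -(big_morph (fun D : 'M[F]_n => block_mx (0 : 'M[F]_1) 0 0 D)
  (id1 := 0) (id2 := 0) (op1 := +%R) (op2 := +%R)) => [|D D'|].
- by rewrite [LHS](@add_block_mx _ 1 n 1 n) !add0r addr0.
- by rewrite add_block_mx !add0r.
- exact: block_mx0.
Qed.

Section InverseTester.
Variables (R : realType) (p s n : nat) (P : protocol R s 'M['F_p]_n.+1 bool).
Local Notation F := 'F_p.
Let N : R := #|{: 'rV[F]_n}|%:R * #|{: 'cV[F]_n}|%:R.

Let N_gt0 : 0 < N.
Proof. by rewrite mulr_gt0 // ltr0n; apply/card_gt0P; exists 0. Qed.

Let weight (w : 'rV[F]_n * 'cV[F]_n * coin P) : R := coin_pr P w.2 / N.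

Let weight_ge0 w : 0 <= weight w.
Proof. by rewrite divr_ge0 ?coin_pr_ge0 // ltW. Qed.

Let weight_sum1 : \sum_w weight w = 1.
Proof.
rewrite -(pair_bigA _ (fun rc w => coin_pr P w / N)) /=.
rewrite (eq_bigr (fun=> N^-1)) => [|rc _]; last by rewrite -mulr_suml coin_pr_sum1 mul1r.
by rewrite sumr_const card_prod -[LHS]mulr_natr natrM mulVf // gt_eqF.
Qed.

(** Accepts unless both runs report a zero corner. For an invertible total one of the two borders
    meets the promise; the other run may violate it, but no answer of that run can undo the
    acceptance. *)
Definition inverse_tester : tester R s 'M[F]_n bool :=
  Tester weight_ge0 weight_sum1
    (fun w b => premap (bordered b w.1.1 w.1.2) (strategy P w.2))
    (fun w x (o : bool -> bool) => ~~ (o false && o true)).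

Let border_accept r c (x : {ffun 'I_s -> 'M[F]_n}) : R := \sum_(w |
   ~~ ((execute (strategy P w) (fun i => bordered false r c i (x i))).2 &&
       (execute (strategy P w) (fun i => bordered true r c i (x i))).2)) coin_pr P w.

Let inverse_tester_accept x :
  accept_pr inverse_tester x = (\sum_r \sum_c border_accept r c x) / N.
Proof.
rewrite /accept_pr big_mkcond /=.
rewrite -(pair_bigA _ (fun rc w => if accepts inverse_tester (rc, w) x then
   weight (rc, w) else 0)) /=.
rewrite -(pair_bigA _ (fun r c => \sum_w if accepts inverse_tester (r, c, w) x then
   weight (r, c, w) else 0)) /=.
rewrite mulr_suml; apply: eq_bigr => r _; rewrite mulr_suml; apply: eq_bigr => c _.
by rewrite -big_mkcond /= mulr_suml.
Qed.

Let avg_const (a : R) : \sum_(r : 'rV[F]_n) \sum_(c : 'cV[F]_n) a = a * N.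
Proof.
by rewrite !sumr_const -[LHS]mulr_natr -[X in X * _]mulr_natr /N -mulrA [_%:R * _]mulrC.
Qed.

Hypotheses (s_gt0 : (0 < s)%N) (cP : correct 40^-1 (inverse_problem p s n) P).

Lemma inverse_tester_unit (x : {ffun 'I_s -> 'M[F]_n}) :
  total x \in unitmx -> 39 / 40 <= accept_pr inverse_tester x.
Proof.
move=> ux; rewrite inverse_tester_accept ler_pdivlMr // -avg_const.
apply: ler_sum => r _; apply: ler_sum => c _.
have [b ub] := det_corner_neq0 r c ux.
have := correct_accept (tst := negb) (y := fun i => bordered b r c i (x i)) cP.
rewrite /= total_bordered // ub => /(_ isT).
rewrite invmx_corner // ux => /(_ isT) h.
apply: le_trans (_ : 1 - 40^-1 <= _); first by lra.
apply: le_trans h _; rewrite big_mkcond [leRHS]big_mkcond; apply: ler_sum => w _.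
case: ifP => h; last by case: ifP => // _; apply: coin_pr_ge0.
have key (o : bool -> bool) : ~~ o b -> ~~ (o false && o true).
  by case: (b); case: (o false); case: (o true).
have {}h := key (fun b => (execute (strategy P w) (fun i => bordered b r c i (x i))).2) h.
by case: ifP h.
Qed.

(** At least a quarter of the pairs [(r, c)] avoid both kernels; on these each run errs with
    probability at most 1/40, so acceptance is at most 1/20. Hence [61/80 = 1 - 19/20 * 1/4]. *)
Lemma inverse_tester_corank1 (x : {ffun 'I_s -> 'M[F]_n}) :
  (n - \rank (total x) = 1)%N -> accept_pr inverse_tester x <= 61 / 80.
Proof.
move=> rx; have [k [l [k0 l0 gen]]] := corank1_border rx.
have nux : total x \notin unitmx.
  by rewrite -row_full_unit /row_full; apply: contra_eqN rx => /eqP ->; rewrite subnn.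
rewrite inverse_tester_accept ler_pdivrMr //.
have le1 r c : border_accept r c x <= 1.
  rewrite -(coin_pr_sum1 P) /border_accept big_mkcond; apply: ler_sum => w _.
  by case: ifP => // _; apply: coin_pr_ge0.
have good r c : k *m c != 0 -> r *m l != 0 -> border_accept r c x <= 20^-1.
  move=> kc rl.
  have rej b : \sum_(w | ~~ (execute (strategy P w) (fun i => bordered b r c i (x i))).2)
      coin_pr P w <= 40^-1.
    apply: (correct_reject (tst := negb) cP); rewrite /= total_bordered ?gen //.
    by rewrite invmx_corner ?gen // nux.
  have := lerD (rej false) (rej true); rewrite (_ : 40^-1 + 40^-1 = 20^-1); last by lra.
  apply: le_trans; rewrite /border_accept [leLHS]big_mkcond.
  rewrite [X in _ <= X + _]big_mkcond [X in _ <= _ + X]big_mkcond -big_split.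
  have key (u v : bool) (a : R) : 0 <= a ->
      (if ~~ (u && v) then a else 0) <= (if ~~ u then a else 0) + (if ~~ v then a else 0).
    by case: u; case: v => /=; lra.
  by apply: ler_sum => w _; apply: key; apply: coin_pr_ge0.
pose gr (r : 'rV[F]_n) := (r *m l != 0).
pose gc (c : 'cV[F]_n) := (k *m c != 0).
apply: le_trans (_ : \sum_(r : 'rV[F]_n) \sum_(c : 'cV[F]_n)
   (1 - 19 / 20 * (gr r)%:R * (gc c)%:R) <= _).
  apply: ler_sum => r _; apply: ler_sum => c _; rewrite /gr /gc.
  case: (boolP (r *m l != 0)) => rl; last by rewrite mulr0 mul0r subr0 le1.
  case: (boolP (k *m c != 0)) => kc; last by rewrite mulr0 subr0 le1.
  by rewrite !mulr1; apply: le_trans (good r c kc rl) _; lra.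
have -> : \sum_(r : 'rV[F]_n) \sum_(c : 'cV[F]_n) (1 - 19 / 20 * (gr r)%:R * (gc c)%:R) =
    N - 19 / 20 * (#|gr|%:R * #|gc|%:R).
  under eq_bigr do rewrite sumrB; rewrite sumrB avg_const mul1r; congr (_ - _).
  under eq_bigr do rewrite -mulr_sumr; rewrite -mulr_suml -mulr_sumr -mulrA.
  congr (_ * (_ * _)).
  - by rewrite -sum1_card natr_sum [RHS]big_mkcond; apply: eq_bigr => r _;
    rewrite /in_mem /=; case: (gr r).
  - by rewrite -sum1_card natr_sum [RHS]big_mkcond; apply: eq_bigr => c _;
    rewrite /in_mem /=; case: (gc c).
have hgr : #|{: 'rV[F]_n}|%:R <= 2 * #|gr|%:R :> R.
  rewrite -natrM ler_nat.
  have [i li] : exists i, l i 0 != 0.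
    apply/existsP; apply: contraNT l0; rewrite negb_exists => /forallP h.
    by apply/eqP/matrixP => i j; rewrite ord1 mxE; have := h i; rewrite negbK => /eqP.
  apply: (card_nonzero_ge (h := fun r : 'rV[F]_n => r *m l) (x0 := delta_mx 0 i)).
    by move=> r r'; rewrite mulmxDl.
  rewrite -rowE; apply: contra_neq li => h.
  by have := congr1 (fun A : 'M[F]_1 => A 0 0) h; rewrite !mxE.
have hgc : #|{: 'cV[F]_n}|%:R <= 2 * #|gc|%:R :> R.
  rewrite -natrM ler_nat.
  have [i li] : exists i, k 0 i != 0.
    apply/existsP; apply: contraNT k0; rewrite negb_exists => /forallP h.
    by apply/eqP/matrixP => j i; rewrite ord1 mxE; have := h i; rewrite negbK => /eqP.
  apply: (card_nonzero_ge (h := fun c : 'cV[F]_n => k *m c) (x0 := delta_mx i 0)).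
    by move=> r r'; rewrite mulmxDr.
  rewrite -colE; apply: contra_neq li => h.
  by have := congr1 (fun A : 'M[F]_1 => A 0 0) h; rewrite !mxE.
have : N <= (2 * #|gr|%:R) * (2 * #|gc|%:R) by apply: ler_pM.
lra.
Qed.
End InverseTester.

Lemma inverse_cost (R : realType) p s n (P : protocol R s 'M['F_p]_n.+1 bool) :
  prime p -> (2 <= s)%N -> (8 <= n)%N -> correct 40^-1 (inverse_problem p s n) P ->
  matrix_const R * s%:R * n%:R ^+ 2 * ln p%:R <= (cost P)%:R.
Proof.
move=> pp s2 n8 cP; have s0 : (0 < s)%N by apply: ltnW.
apply: (@matrix_cost R p s n _ (inverse_tester P)) => //.
- by rewrite card_bool.
- by move=> w j x; apply: cost_ge.
- by move=> x; apply: inverse_tester_unit.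
- by move=> x; apply: inverse_tester_corank1.
Qed.

(** * Linear systems with a fixed right-hand side *)

Definition premap_protocol (R : realType) s V X A (phi : 'I_s -> V -> X)
    (P : protocol R s X A) : protocol R s V A :=
  Protocol (@coin_pr_ge0 _ _ _ _ P) (coin_pr_sum1 P)
    (fun w => premap phi (strategy P w)).

Lemma exists_unit_col (F : fieldType) n (b : 'cV[F]_n.+1) : b != 0 ->
  exists2 H : 'M[F]_n.+1, H \in unitmx & b = H *m delta_mx ord0 ord0.
Proof.
move=> b0; have rb : \rank b = 1%N.
  by apply/eqP; rewrite eqn_leq rank_leq_col lt0n mxrank_eq0.
set e := row_ebase b 0 0.
have e0 : e != 0.
  have := row_ebase_unit b; rewrite unitmxE unitfE {1}[row_ebase b]mx11_scalar.
  by rewrite det_scalar1.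
exists (e *: col_ebase b).
  by rewrite unitmxZ ?unitfE ?col_ebase_unit.
rewrite -{1}[b]mulmx_ebase rb [row_ebase b]mx11_scalar mul_mx_scalar -scalemxAl.
congr (_ *: (_ *m _)); apply/matrixP => i j; rewrite !mxE ord1 andbT.
by case: (eqVneq i ord0) => [->|i0] //; case: (unliftP ord0 i) i0 => [i' ->|-> //].
Qed.

(** Each player multiplies its share by [H] on the left. The system then says that [t] is the first
    column of the inverse of the original total. *)
Lemma solve_cost (R : realType) p s n (b : 'cV['F_p]_n.+1)
    (P : protocol R s 'M['F_p]_n.+1 bool) :
  prime p -> (2 <= s)%N -> (8 <= n)%N -> b != 0 -> correct 40^-1 (solve_problem s b) P ->
  matrix_const R * s%:R * n%:R ^+ 2 * ln p%:R <= (cost P)%:R.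
Proof.
move=> pp s2 n8 b0 cP; have [H uH bE] := exists_unit_col b0.
pose P' := premap_protocol (fun (_ : 'I_s) x => H *m x) P.
have cost_le : (cost P' <= cost P)%N.
  by apply/bigmax_leqP => w _; apply/bigmax_leqP => x _; apply: cost_ge.
apply: le_trans (_ : (cost P')%:R <= _); last by rewrite ler_nat.
apply: inverse_cost => // x /= ux.
have tot : total (fun i => H *m x i) = H *m total x by rewrite /total mulmx_sumr.
have := cP (fun i => H *m x i); rewrite /= tot unitmx_mul uH ux => /(_ isT).
rewrite /success_pr /= tot.
suff -> : [exists t : 'cV_n.+1, (H *m total x *m t == b) && (t ord0 ord0 == 0)] =
    (invmx (total x) ord0 ord0 == 0) by [].
have E t : (H *m total x *m t == b) = (t == invmx (total x) *m delta_mx ord0 ord0).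
  rewrite bE -mulmxA; apply/eqP/eqP => [/(congr1 (mulmx (invmx H)))|->].
    by rewrite !mulKmx // => <-; rewrite mulKmx.
  by rewrite mulKVmx.
apply/existsP/eqP => [[t]|h].
  by rewrite E => /andP[/eqP -> /eqP]; rewrite -colE mxE.
by exists (invmx (total x) *m delta_mx ord0 ord0); rewrite E eqxx -colE mxE h eqxx.
Qed.

(** * Generalized inner product, odd characteristic *)

(** Cauchy-Schwarz, from the double sum of the squared differences. *)
Lemma sum_abs2_le (I : finType) (A : pred I) (h : I -> algC) :
  `|\sum_(x | A x) h x| ^+ 2 <= #|A|%:R * \sum_(x | A x) `|h x| ^+ 2.
Proof.
apply: le_trans (_ : (\sum_(x | A x) `|h x|) ^+ 2 <= _).
  by apply: lerXn2r; rewrite ?nnegrE ?sumr_ge0 ?ler_norm_sum.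
set S := \sum_(x | A x) `|h x|; set Q := \sum_(x | A x) `|h x| ^+ 2.
rewrite -(@ler_pM2l _ 2) // -subr_ge0.
have -> : 2 * (#|A|%:R * Q) - 2 * S ^+ 2 =
    \sum_(x | A x) \sum_(y | A y) (`|h x| - `|h y|) ^+ 2.
  have E x : \sum_(y | A y) (`|h x| - `|h y|) ^+ 2 =
      #|A|%:R * `|h x| ^+ 2 - 2 * (`|h x| * S) + Q.
    rewrite /S /Q -sum1_card natr_sum [X in X * _](_ : _ = \sum_(y | A y) 1) //.
    rewrite mulr_suml 2!mulr_sumr -sumrB -big_split; apply: eq_bigr => y _ /=; ring.
  under [RHS]eq_bigr do rewrite E.
  rewrite !big_split /= sumrN -!mulr_sumr -mulr_suml -/S -/Q sumr_const -mulr_natl.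
  by rewrite expr2; ring.
apply: sumr_ge0 => x _; apply: sumr_ge0 => y _.
by rewrite real_exprn_even_ge0 // rpredB // normr_real.
Qed.

Definition nonzero p := {a : 'F_p | a != 0}.

Definition scaled_dot p n (rho : 'I_n -> 'F_p) (a b : {ffun 'I_n -> nonzero p}) : 'F_p :=
  \sum_j val (a j) * val (b j) * rho j.

(** After Cauchy-Schwarz in [a], the sum is extended from nonzero rows to all rows; orthogonality
    then leaves only the diagonal, because [colof] is injective. *)
Lemma scaled_dot_character p n (rho : 'I_n -> 'F_p) (chi : 'F_p -> algC) t
    (A B : pred {ffun 'I_n -> nonzero p}) : prime p ->
  nontrivial_character chi -> (forall j, rho j != 0) -> t != 0 ->
  `|\sum_(a | A a) \sum_(b | B b) chi (t * scaled_dot rho a b)| ^+ 2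
    <= (p ^ n)%:R * (#|{ffun 'I_n -> nonzero p}|%:R) ^+ 2.
Proof.
move=> pp ntchi rho0 t0; have [chi0 chiD chiN _] := ntchi.
set N := #|{ffun 'I_n -> nonzero p}|.
apply: le_trans (sum_abs2_le _ _) _.
pose rowof (a : {ffun 'I_n -> nonzero p}) : 'rV['F_p]_n := \row_j val (a j).
pose colof (b : {ffun 'I_n -> nonzero p}) : 'cV['F_p]_n := \col_j (t * (val (b j) * rho j)).
have dotE a b : t * scaled_dot rho a b = \tr (rowof a *m colof b).
  rewrite /mxtrace big_ord1 mxE /scaled_dot mulr_sumr; apply: eq_bigr => j _.
  by rewrite !mxE; ring.
have rowI : injective rowof.
  move=> a a' /rowP h; apply/ffunP => j; apply: val_inj.
  by have := h j; rewrite !mxE.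
have colI : injective colof.
  move=> b b' /colP h; apply/ffunP => j; apply: val_inj.
  by have := h j; rewrite !mxE => /(mulfI t0)/(mulIf (rho0 j)).
pose Q (R : 'rV['F_p]_n) := `|\sum_(b | B b) chi (\tr (R *m colof b))| ^+ 2.
have le1 : \sum_(a | A a) `|\sum_(b | B b) chi (t * scaled_dot rho a b)| ^+ 2 <= \sum_R Q R.
  apply: le_trans (_ : \sum_a Q (rowof a) <= _).
    rewrite big_mkcond; apply: ler_sum => a _; rewrite /Q.
    under [X in _ <= `|X| ^+ 2]eq_bigr do rewrite -dotE.
    by case: ifP => // _; rewrite exprn_ge0.
  rewrite -(big_imset Q (in2W rowI)) /= big_mkcond; apply: ler_sum => r _.
  by case: ifP => // _; rewrite /Q exprn_ge0.
have E : \sum_R Q R = (p ^ n * #|B|)%:R.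
  have step R : Q R = \sum_(b | B b) \sum_(b' | B b') chi (\tr (R *m (colof b - colof b'))).
    rewrite /Q normCK rmorph_sum mulr_suml; apply: eq_bigr => b _.
    rewrite mulr_sumr; apply: eq_bigr => b' _.
    by rewrite /= chiN -chiD mulmxBr raddfB.
  under eq_bigr do rewrite step.
  rewrite exchange_big /= mulnC natrM -sum1_card natr_sum mulr_suml.
  apply: eq_bigr => b Bb; rewrite exchange_big /= mul1r (bigD1 b) //=.
  rewrite sum_character_mx // subrr eqxx muln1 mul1n card_Fp // big1 ?addr0 //.
  move=> b' /andP[_ bb']; rewrite sum_character_mx // subr_eq0 (inj_eq colI).
  by rewrite eq_sym (negbTE bb') muln0.
apply: le_trans (_ : #|A|%:R * (p ^ n * #|B|)%:R <= _).
  by apply: ler_wpM2l => //; rewrite -E.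
rewrite -natrX -!natrM ler_nat mulnCA leq_mul // -mulnn leq_mul //; exact: max_card.
Qed.

Definition zero_one_gap (F : fieldType) (y : F) : int := (y == 1)%:R - (y == 0)%:R.

(** Expanding the indicators in characters cancels the term at [t = 0], and the other coefficients
    have modulus at most 2. The bound is squared because the square root of [p ^ n] need not be an
    integer. *)
Lemma scaled_dot_discrepancy p n (rho : 'I_n -> 'F_p)
    (A B : pred {ffun 'I_n -> nonzero p}) : prime p -> (forall j, rho j != 0) ->
  `|\sum_(a | A a) \sum_(b | B b) zero_one_gap (scaled_dot rho a b)| ^+ 2
     <= ((4 * p ^ n * #|{ffun 'I_n -> nonzero p}| ^ 2)%:R : int).
Proof.
move=> pp rho0; have [chi ntchi] := exists_character pp.
have [chi0 chiD chiN chiS] := ntchi.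
set N := #|{ffun 'I_n -> nonzero p}|.
rewrite -(ler_int algC) rmorphXn /= intr_norm rmorph_sum /= rmorph_nat.
under eq_bigr do rewrite rmorph_sum /=.
have p0 : 0 < p%:R :> algC by rewrite ltr0n prime_gt0.
have chi_sum (y : 'F_p) : \sum_t chi (t * y) = p%:R * (y == 0)%:R.
  have [->|y0] := eqVneq y 0.
    under eq_bigr do rewrite mulr0 chi0.
    by rewrite sumr_const mulr1; congr (_%:R); exact: card_Fp.
  rewrite mulr0; transitivity (\sum_a chi a); last exact: chiS.
  by rewrite [RHS](reindex_inj (mulIf y0)).
have gapE (y : 'F_p) : p%:R * (zero_one_gap y)%:~R =
    \sum_(t | t != 0) (chi (- t) - 1) * chi (t * y).
  rewrite /zero_one_gap rmorphB !rmorph_nat mulrBr -subr_eq0 -!chi_sum.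
  rewrite -sumrB (bigD1 0) //= !mul0r subrr add0r; apply: eq_bigr => t _.
  rewrite mulrBl mul1r -chiD; congr (chi _ - _).
  by rewrite mulrBr mulr1 addrC.
set S := \sum_(a | A a) _.
have pS : p%:R * S = \sum_(t | t != 0) (chi (- t) - 1) *
    \sum_(a | A a) \sum_(b | B b) chi (t * scaled_dot rho a b).
  rewrite /S mulr_sumr; under eq_bigr do (rewrite mulr_sumr; under eq_bigr do rewrite gapE;
    rewrite exchange_big /=).
  rewrite exchange_big /=; apply: eq_bigr => t _.
  by rewrite mulr_sumr; apply: eq_bigr => a _; rewrite mulr_sumr.
have chi1 t : `|chi t| = 1.
  by apply/eqP; rewrite -(@pexpr_eq1 _ _ 2) // normCK chiN -chiD subrr chi0.
set K : algC := sqrtC (p ^ n)%:R * N%:R.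
have K0 : 0 <= K by rewrite mulr_ge0 ?sqrtC_ge0.
have St t : t != 0 -> `|\sum_(a | A a) \sum_(b | B b) chi (t * scaled_dot rho a b)| <= K.
  move=> t0; rewrite -(@ler_pXn2r _ 2) ?nnegrE //.
  by rewrite exprMn sqrtCK; exact: scaled_dot_character.
have bound : `|S| <= 2 * K.
  rewrite -(ler_pM2l p0) -[p%:R in leLHS](ger0_norm (ltW p0)) -normrM pS.
  apply: le_trans (ler_norm_sum _ _ _) _.
  apply: le_trans (_ : \sum_(t : 'F_p) 2 * K <= _); last first.
    rewrite sumr_const -[leLHS]mulr_natl le_eqVlt; apply/orP; left; apply/eqP.
    by congr (_%:R * _); exact: card_Fp.
  rewrite big_mkcond; apply: ler_sum => t _; case: ifP => [/St h|_]; last exact: mulr_ge0.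
  rewrite normrM; apply: ler_pM => //.
  by apply: le_trans (ler_normB _ _) _; rewrite chi1 normr1.
apply: le_trans (_ : (2 * K) ^+ 2 <= _).
  by apply: lerXn2r; rewrite ?nnegrE ?mulr_ge0.
by rewrite /K !exprMn sqrtCK -!natrX -!natrM mulnA.
Qed.

Definition nzmul p (a b : nonzero p) : nonzero p := exist _ (val a * val b)
  (mulf_neq0 (valP a) (valP b)).

Definition nonzero_row p n (a : {ffun 'I_n -> nonzero p}) : 'rV['F_p]_n := \row_j val (a j).

Definition nz_ip p s n (x : {ffun 'I_s -> {ffun 'I_n -> nonzero p}}) : 'F_p :=
  inner_product (fun i => nonzero_row (x i)).

Definition nz_others p s n (x : {ffun 'I_s -> {ffun 'I_n -> nonzero p}}) i j : 'F_p :=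
  \prod_(k | k != i) val (x k j).

Lemma nz_others_neq0 p s n (x : {ffun 'I_s -> {ffun 'I_n -> nonzero p}}) i j :
  nz_others x i j != 0.
Proof. by apply/prodf_neq0 => k _; apply: (valP (x k j)). Qed.

Lemma nz_others_upd p s n (x : {ffun 'I_s -> {ffun 'I_n -> nonzero p}}) i a j :
  nz_others (upd x i a) i j = nz_others x i j.
Proof. by apply: eq_bigr => k /negbTE ki; rewrite updE ki. Qed.

Lemma nz_ipE p s n (x : {ffun 'I_s -> {ffun 'I_n -> nonzero p}}) i :
  nz_ip x = \sum_j val (x i j) * nz_others x i j.
Proof.
rewrite /nz_ip /inner_product; apply: eq_bigr => j _; rewrite (bigD1 i) //= mxE; congr (_ * _).
by apply: eq_bigr => k _; rewrite mxE.
Qed.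

Lemma nz_ip_upd2 p s n (u : {ffun 'I_s -> {ffun 'I_n -> nonzero p}}) i i' a b : i != i' ->
  nz_ip (upd (upd u i a) i' b) =
  scaled_dot (fun j => \prod_(k | (k != i) && (k != i')) val (u k j)) a b.
Proof.
move=> ii'; rewrite (nz_ipE _ i) /scaled_dot; apply: eq_bigr => j _.
rewrite updE (negbTE ii') updE eqxx -mulrA; congr (_ * _).
rewrite /nz_others (bigD1 i') 1?eq_sym //= updE eqxx; congr (_ * _).
by apply: eq_bigr => k /andP[/negbTE ki /negbTE ki']; rewrite !updE ki ki'.
Qed.

Lemma card_nonzero p : prime p -> #|{: nonzero p}| = p.-1.
Proof.
by move=> pp; rewrite card_sig; have := cardC1 (0 : 'F_p); rewrite card_Fp // => <-.
Qed.

Section NonzeroCounts.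
Variables (R : realType) (p s n : nat).
Hypotheses (p_pr : prime p) (p_ge3 : (3 <= p)%N) (s_gt0 : (0 < s)%N) (n_gt0 : (0 < n)%N).
Local Notation V := {ffun 'I_n -> nonzero p}.
Let cnt (a : 'F_p) : R := \sum_(x : {ffun 'I_s -> V}) (nz_ip x == a)%:R.
Let i0 : 'I_s := Ordinal s_gt0.
Let j0 : 'I_n := Ordinal n_gt0.

Let nz_gt0 : 0 < #|{: nonzero p}|%:R :> R.
Proof. by rewrite ltr0n card_nonzero // -subn1 subn_gt0 prime_gt1. Qed.

Let V_gt0 : 0 < #|{: V}|%:R :> R.
Proof. by rewrite ltr0n card_ffun expn_gt0 -(ltr0n R) nz_gt0. Qed.

(** With everything fixed but one entry of one player, at most one of the [p - 1] nonzero values of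
    this entry makes the inner product vanish. *)
Lemma nz_count_zero_le :
  (p%:R - 1) * \sum_(x : {ffun 'I_s -> V}) (nz_ip x == 0)%:R <= #|{: V}|%:R ^+ s :> R.
Proof.
have -> : p%:R - 1 = #|{: nonzero p}|%:R :> R.
  by rewrite card_nonzero // -subn1 natrB // prime_gt0.
rewrite -(ler_pM2l V_gt0) mulrCA -(sum_upd (fun x : {ffun 'I_s -> V} => (nz_ip x == 0)%:R) i0).
have -> : #|{: V}|%:R * #|{: V}|%:R ^+ s = \sum_(u : {ffun 'I_s -> V}) \sum_(a : V) 1 :> R.
  under eq_bigr do rewrite sumr_const.
  rewrite sumr_const -[RHS]mulr_natr -natrX; congr (_ * _%:R).
  by rewrite [RHS]card_ffun card_ord.
rewrite mulr_sumr; apply: ler_sum => u _.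
rewrite -(sum_upd (fun a : V => (nz_ip (upd u i0 a) == 0)%:R) j0).
apply: ler_sum => a _.
have uniq (c c' : nonzero p) : nz_ip (upd u i0 (upd a j0 c)) = 0 ->
    nz_ip (upd u i0 (upd a j0 c')) = 0 -> c = c'.
  rewrite !(nz_ipE _ i0) => h h'; apply: val_inj.
  apply: (mulIf (nz_others_neq0 u i0 j0)).
  move: h h'; rewrite (bigD1 j0) //= [X in _ -> X = 0 -> _](bigD1 j0) //=.
  rewrite !nz_others_upd !updE !eqxx /= => /eqP h /eqP h'.
  move: h h'; rewrite !addr_eq0 => /eqP -> /eqP ->; congr (- _).
  by apply: eq_bigr => j /negbTE jj; rewrite !nz_others_upd !updE jj.
have [[c /eqP hc]|none] := pselect (exists c, nz_ip (upd u i0 (upd a j0 c)) == 0).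
  rewrite (bigD1 c) //= hc eqxx big1 ?addr0 // => c' cc'.
  by case: eqP => // hc'; rewrite (uniq _ _ hc hc') eqxx in cc'.
by rewrite big1 // => c _; case: eqP => // /eqP hc; case: none; exists c.
Qed.

(** Multiplying the row of one player by [a] scales the inner product, so all nonzero values are
    equally frequent. *)
Let nz_count_scale (a : 'F_p) : a != 0 -> cnt a = cnt 1.
Proof.
move=> a0; pose c : nonzero p := exist _ a a0.
apply: (mulfI (x := #|{: V}|%:R)); first by rewrite gt_eqF.
rewrite /cnt -(sum_upd (fun x : {ffun 'I_s -> V} => (nz_ip x == a)%:R) i0).
rewrite -(sum_upd (fun x : {ffun 'I_s -> V} => (nz_ip x == 1)%:R) i0).
apply: eq_bigr => u _.
have cI : injective (fun v : V => [ffun j => nzmul c (v j)] : V).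
  move=> v v' /ffunP h; apply/ffunP => j; apply: val_inj.
  by have := congr1 val (h j); rewrite !ffunE /= => /(mulfI a0).
rewrite (reindex_inj cI) /=; apply: eq_bigr => v _; congr ((_ : bool)%:R).
rewrite !(nz_ipE _ i0).
have -> : \sum_j val (upd u i0 [ffun j1 => nzmul c (v j1)] i0 j) *
    nz_others (upd u i0 [ffun j1 => nzmul c (v j1)]) i0 j =
  a * \sum_j val (upd u i0 v i0 j) * nz_others (upd u i0 v) i0 j.
  rewrite mulr_sumr; apply: eq_bigr => j _.
  by rewrite !nz_others_upd !updE !eqxx /= ffunE /= mulrA.
by rewrite -[X in _ == X]mulr1 (inj_eq (mulfI a0)).
Qed.

Let nz_count_total : #|{: V}|%:R ^+ s = cnt 0 + (p%:R - 1) * cnt 1.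
Proof.
have -> : #|{: V}|%:R ^+ s = \sum_(a : 'F_p) cnt a.
  rewrite /cnt exchange_big /= -natrX -[in LHS](card_ord s) -card_ffun -sum1_card natr_sum.
  apply: eq_bigr => x _; rewrite (bigD1 (nz_ip x)) //= eqxx big1 ?addr0 // => a.
  by rewrite eq_sym => /negbTE ->.
rewrite (bigD1 0) //= (eq_bigr _ (fun a a0 => nz_count_scale a0)) sumr_const.
congr (_ + _); rewrite -[LHS]mulr_natl; congr (_ * _).
have -> : p%:R - 1 = p.-1%:R :> R by rewrite -subn1 natrB ?prime_gt0.
congr (_%:R).
by have := cardC1 (0 : 'F_p); rewrite card_Fp // => <-.
Qed.

(** As [p - 1] is at least 2, the value 0 takes at most half of the mass, and the [p - 1] nonzero
    values share the rest equally. *)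
Lemma nz_count_one_ge :
  #|{: V}|%:R ^+ s <= 2 * (p%:R - 1) * \sum_(x : {ffun 'I_s -> V}) (nz_ip x == 1)%:R :> R.
Proof.
have := nz_count_zero_le; rewrite nz_count_total -/(cnt 0) -/(cnt 1).
have p3 : 3 <= p%:R :> R by rewrite ler_nat.
have : 0 <= cnt 0 by apply: sumr_ge0 => x _; apply: ler0n.
by set m0 := cnt 0; set m1 := cnt 1; nra.
Qed.

Lemma nz_count_zero_one :
  \sum_(x : {ffun 'I_s -> V}) (nz_ip x == 0)%:R <=
  2 * \sum_(x : {ffun 'I_s -> V}) (nz_ip x == 1)%:R :> R.
Proof.
have p3 : 3 <= p%:R :> R by rewrite ler_nat.
have p1 : 0 < p%:R - 1 :> R by lra.
rewrite -(ler_pM2l p1); apply: le_trans nz_count_zero_le _.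
by rewrite mulrA [_ * 2]mulrC; exact: nz_count_one_ge.
Qed.
End NonzeroCounts.

Lemma ip_odd_cost (R : realType) p s n (P : protocol R s 'rV['F_p]_n 'F_p) :
  prime p -> (3 <= p)%N -> (2 <= s)%N -> (72 <= n)%N ->
  correct 12^-1 (ip_problem p s n) P ->
  (80 * ln 5 : R)^-1 * s%:R * n%:R * ln p%:R <= (cost P)%:R.
Proof.
move=> pp p3 s2 n72 cP.
have s0 : (0 < s)%N by exact: ltnW.
have n0 : (0 < n)%N by apply: leq_trans n72.
pose V := {ffun 'I_n -> nonzero p}; pose N : R := #|{: V}|%:R.
pose T := single_tester P (fun (_ : 'I_s) (a : V) => nonzero_row a) (fun _ a => a == 1).
pose m1 : R := \sum_(x : {ffun 'I_s -> V}) (nz_ip x == 1)%:R.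
have p3r : 3 <= p%:R :> R by rewrite ler_nat.
have N_gt0 : 0 < N.
  by rewrite ltr0n card_ffun expn_gt0 card_nonzero // -subn1 subn_gt0 prime_gt1.
have h1 : N ^+ s <= 2 * (p%:R - 1) * m1 by exact: nz_count_one_ge.
have m1_gt0 : 0 < m1.
  have : 0 < 2 * (p%:R - 1) * m1 by apply: lt_le_trans h1; rewrite exprn_gt0.
  by rewrite pmulr_rgt0 // mulr_gt0 //; lra.
have h0 : \sum_(x : {ffun 'I_s -> V}) (nz_ip x == 0)%:R <= 2 * m1 by exact: nz_count_zero_one.
pose F0 (x : {ffun 'I_s -> V}) : R := (nz_ip x == 1)%:R / m1.
pose G (i : 'I_s) (x : {ffun 'I_s -> V}) : R := (nz_ip x == 0)%:R / m1.
pose F (i : 'I_s) (x : {ffun 'I_s -> V}) : R := (zero_one_gap (nz_ip x))%:~R / m1.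
pose rp : R := Num.sqrt (p%:R ^+ n).
have rp_gt0 : 0 < rp by rewrite sqrtr_gt0 exprn_gt0 //; lra.
(* The discrepancy [2 * rp * N] of two rows, normalized by [m1], which is at least
   [N ^ s / (2 * (p - 1))]. *)
pose eta : R := 4 * (p%:R - 1) * rp / N.
have eta_gt0 : 0 < eta by rewrite divr_gt0 ?mulr_gt0 //; lra.
have := @tester_cost R s V 'F_p T (cost P) [set: 'I_s] F G F0 eta (2^-1).
rewrite card_unit expr1n mulr1 cardsT card_ord => H.
have {}H : 2^-1 / (2 * ln 5) * s%:R * ln (2^-1 / (2 * eta)) <= (cost P)%:R.
  apply: H => //.
  - exact: single_tester_cost.
  - by move=> x; rewrite divr_ge0 // ltW.
  - by rewrite -mulr_suml divff ?gt_eqF.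
  - by move=> i x _; rewrite divr_ge0 // ltW.
  - move=> i x _; rewrite /F0 /G /F -mulrBl /zero_one_gap rmorphB !rmorph_nat lexx //.
  - move=> i E _ rE; have [i' ii'] := exists_neq_ord i s2.
    rewrite -mulr_suml ler_pdivrMr // -(ler_pM2l (exprn_gt0 2 N_gt0)).
    apply: le_trans (_ : N ^+ s * (2 * rp * N) <= _).
      apply: (rectangle_sum ii' rE) => u A B.
      have rho0 j : \prod_(k | (k != i) && (k != i')) val (u k j) != 0.
        by apply/prodf_neq0 => k _; apply: (valP (u k j)).
      under eq_bigr do (under eq_bigr do rewrite nz_ip_upd2 //).
      have := scaled_dot_discrepancy A B pp rho0.
      rewrite -(ler_int R) rmorphXn /= intr_norm rmorph_sum /= rmorph_nat.
      under eq_bigr do rewrite rmorph_sum /=.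
      set S := \sum_(a | _) _ => hS; apply: le_trans (ler_norm _) _.
      rewrite -(@ler_pXn2r _ 2) ?nnegrE // ?mulr_ge0 ?(ltW rp_gt0) ?(ltW N_gt0) //.
      apply: le_trans hS _; rewrite !exprMn sqr_sqrtr ?exprn_ge0 //.
      by rewrite -!natrX -!natrM.
    rewrite /eta; have -> : N ^+ 2 * (4 * (p%:R - 1) * rp / N * m1) =
       (2 * (p%:R - 1) * m1) * (2 * rp * N) by field; rewrite gt_eqF.
    by apply: ler_wpM2r h1; rewrite !mulr_ge0 ?(ltW rp_gt0) ?(ltW N_gt0).
  - move=> i _.
    have lo : 11 / 12 <= \sum_x F0 x * accept_pr T x.
      have -> : 11 / 12 = \sum_x F0 x * (11 / 12) :> R.
        by rewrite -mulr_suml -mulr_suml divff ?mul1r // gt_eqF.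
      apply: ler_sum => x _; rewrite /F0; case: (eqVneq (nz_ip x) 1) => [x1|]; last first.
        by rewrite !mul0r.
      apply: ler_wpM2l; first by rewrite divr_ge0 // ltW.
      have -> : 11 / 12 = 1 - 12^-1 :> R by lra.
      apply: single_tester_accept cP _ _ => /=; rewrite -/(nz_ip x) x1 ?eqxx ?orbT //.
    have up : \sum_x G i x * accept_pr T x <= 1 / 6.
      apply: le_trans (_ : \sum_x G i x * 12^-1 <= _).
        apply: ler_sum => x _; rewrite /G; case: (eqVneq (nz_ip x) 0) => [x1|]; last first.
          by rewrite !mul0r.
        apply: ler_wpM2l; first by rewrite divr_ge0 // ltW.
        apply: single_tester_reject cP _ _ => /=; rewrite -/(nz_ip x) x1 ?eqxx //.
      rewrite -mulr_suml -mulr_suml ler_pdivrMr // ler_pdivrMr //; lra.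
    lra.
apply: le_trans H.
have L0 : 0 < ln p%:R :> R by rewrite ln_gt0 //; lra.
have ln5 : 0 < ln 5 :> R by rewrite ln_gt0 // ltr1n.
(* [p ^ 3 <= (p - 1) ^ 5]: the exponent 3/5 exceeds 1/2, which is what beats the square root of
   [p ^ n]. *)
have Lq : 3 * ln p%:R <= 5 * ln (p%:R - 1) :> R.
  rewrite ![_ * ln _]mulr_natl -!lnXn ?subr_gt0 ?ltr1n ?prime_gt1 //; last by lra.
  rewrite ler_ln ?posrE ?exprn_gt0 //; [| lra | lra].
  rewrite -[p%:R in leLHS](subrK 1); set q := p%:R - 1.
  have q2 : 2 <= q by rewrite /q; lra.
  have : 0 <= (q - 2) * q ^+ 2 by rewrite mulr_ge0 ?sqr_ge0 //; lra.
  have : 0 <= (q ^+ 2 - 4) * q ^+ 3 by rewrite mulr_ge0 ?exprn_ge0 //; nra.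
  nra.
have l16 : ln 16 <= 3 * ln p%:R :> R.
  rewrite mulr_natl -lnXn; last by lra.
  rewrite ler_ln ?posrE ?exprn_gt0 //; last by lra.
  apply: le_trans (_ : 3 ^+ 3 <= _); first by lra.
  by apply: lerXn2r; rewrite ?nnegrE //; lra.
have etaE : ln (2^-1 / (2 * eta)) =
    n%:R * ln (p%:R - 1) - ln 16 - ln (p%:R - 1) - n%:R / 2 * ln p%:R.
  have q0 : 0 < p%:R - 1 :> R by lra.
  have -> : 2^-1 / (2 * eta) = (p%:R - 1) ^+ n / 16 / (p%:R - 1) / rp.
    have -> : (p%:R - 1) ^+ n = N.
      by rewrite /N card_ffun card_ord card_nonzero // natrX -subn1 natrB // prime_gt0.
    by rewrite /eta; field; rewrite !gt_eqF.
  rewrite !ln_div ?posrE ?divr_gt0 ?exprn_gt0 // lnXn // -[_ *+ n]mulr_natl.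
  congr (_ - _); rewrite /rp.
  have : 2 * ln (Num.sqrt (p%:R ^+ n)) = n%:R * ln p%:R :> R.
    rewrite mulr_natl -lnXn ?sqrtr_gt0 ?exprn_gt0 ?sqr_sqrtr ?exprn_ge0 //; [|lra].
    by rewrite lnXn ?mulr_natl //; lra.
  lra.
have n72r : 72 <= n%:R :> R by rewrite ler_nat.
(* The threshold comes from here: [3/5 * (n - 1) - 3 - n/2 >= n/20] holds exactly for n at least
   72. *)
have -> : (80 * ln 5)^-1 * s%:R * n%:R * ln p%:R =
    2^-1 / (2 * ln 5) * s%:R * (20^-1 * n%:R * ln p%:R) :> R.
  by field; rewrite gt_eqF.
apply: ler_wpM2l; first by rewrite mulr_ge0 ?divr_ge0 ?mulr_ge0 ?(ltW ln5).
rewrite etaE; have : 0 <= (n%:R - 1) * (5 * ln (p%:R - 1) - 3 * ln p%:R) :> R.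
  by rewrite mulr_ge0 //; lra.
have : 0 <= (n%:R - 72) * ln p%:R :> R by rewrite mulr_ge0 //; lra.
set a := ln p%:R; set b := ln (p%:R - 1); move: l16; set d := ln 16; rewrite -/a; nra.
Qed.

(** * Generalized inner product, characteristic two *)

Definition point (R : realType) (T : eqType) (a : T) (z : T) : R := (z == a)%:R.

Lemma sum_point (R : realType) (T : finType) (f : T -> R) z :
  f z = \sum_a point R a z * f a.
Proof.
rewrite (bigD1 z) //= /point eqxx mul1r big1 ?addr0 // => a.
by rewrite eq_sym => /negbTE ->; rewrite mul0r.
Qed.

(** The averages are bilinear in [(f, g)], so their values at point masses are the underlying laws
    of the pair. *)
Definition disjoint_law (R : realType) n (Z Y : bits n) : R :=
  disjoint_avg (point R Z) (point R Y).

Definition unique_law (R : realType) n (Z Y : bits n) : R :=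
  unique_avg (point R Z) (point R Y).

Lemma mask_avg_point (R : realType) n (f : bits n -> R) D :
  mask_avg f D = \sum_Z mask_avg (point R Z) D * f Z.
Proof.
rewrite /mask_avg (eq_bigr (fun u => \sum_Z point R Z (mask D u) * f Z)).
  rewrite exchange_big mulr_suml; apply: eq_bigr => Z _.
  by rewrite -mulr_suml mulrAC.
by move=> u _; rewrite -sum_point.
Qed.

Lemma forced_avg_point (R : realType) n (f : bits n -> R) j b D :
  forced_avg f j b D = \sum_Z forced_avg (point R Z) j b D * f Z.
Proof.
rewrite /forced_avg (eq_bigr (fun u => \sum_Z point R Z (upd (mask D u) j b) * f Z)).
  rewrite exchange_big mulr_suml; apply: eq_bigr => Z _.
  by rewrite -mulr_suml mulrAC.
by move=> u _; rewrite -sum_point.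
Qed.

Lemma disjoint_avg_law (R : realType) n (f g : bits n -> R) :
  disjoint_avg f g = \sum_Z \sum_Y disjoint_law R Z Y * (f Z * g Y).
Proof.
rewrite /disjoint_law /disjoint_avg /mask_weight.
transitivity (\sum_D \sum_Z \sum_Y mask_avg (point R Z) D *
    mask_avg (point R Y) (negb_bits D) / 2 ^+ n * (f Z * g Y)).
  rewrite mulr_suml; apply: eq_bigr => D _.
  rewrite (mask_avg_point f) (mask_avg_point g) mulr_suml mulr_suml.
  apply: eq_bigr => Z _; rewrite mulr_sumr mulr_suml; apply: eq_bigr => Y _.
  set a := mask_avg _ D; set b := mask_avg _ _; ring.
rewrite exchange_big; apply: eq_bigr => Z _; rewrite exchange_big; apply: eq_bigr => Y _.
by rewrite -mulr_suml -mulr_suml.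
Qed.

Lemma unique_avg_law (R : realType) n (f g : bits n -> R) :
  unique_avg f g = \sum_Z \sum_Y unique_law R Z Y * (f Z * g Y).
Proof.
rewrite /unique_law /unique_avg.
transitivity (\sum_(j < n) \sum_D \sum_Z \sum_Y forced_avg (point R Z) j true D *
    forced_avg (point R Y) j true (negb_bits D) / (n%:R * 2 ^+ n) * (f Z * g Y)).
  rewrite mulr_suml; apply: eq_bigr => j _; rewrite mulr_suml; apply: eq_bigr => D _.
  rewrite (forced_avg_point f) (forced_avg_point g) mulr_suml mulr_suml.
  apply: eq_bigr => Z _; rewrite mulr_sumr mulr_suml; apply: eq_bigr => Y _.
  set a := forced_avg _ j true D; set b := forced_avg _ j _ _; ring.
under eq_bigr do rewrite exchange_big; rewrite exchange_big; apply: eq_bigr => Z _.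
under eq_bigr do rewrite exchange_big; rewrite exchange_big; apply: eq_bigr => Y _.
by under eq_bigr do rewrite -mulr_suml -mulr_suml; rewrite -mulr_suml -mulr_suml.
Qed.

Lemma point_ge0 (R : realType) (T : eqType) (a z : T) : 0 <= point R a z.
Proof. exact: ler0n. Qed.

Lemma disjoint_law_ge0 (R : realType) n (Z Y : bits n) : 0 <= disjoint_law R Z Y.
Proof.
rewrite divr_ge0 ?exprn_ge0 // sumr_ge0 // => D _.
by rewrite mulr_ge0 // mask_avg_ge0 // => z; exact: point_ge0.
Qed.

Lemma unique_law_ge0 (R : realType) n (Z Y : bits n) : 0 <= unique_law R Z Y.
Proof.
rewrite divr_ge0 ?mulr_ge0 ?exprn_ge0 // sumr_ge0 // => j _; rewrite sumr_ge0 // => D _.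
by rewrite mulr_ge0 // forced_avg_ge0 // => z; exact: point_ge0.
Qed.

Lemma mask_avg1 (R : realType) n D : mask_avg (fun _ : bits n => 1 : R) D = 1.
Proof. by rewrite /mask_avg sumr_const card_bits natrX divff // expf_neq0. Qed.

Lemma forced_avg1 (R : realType) n j b D : forced_avg (fun _ : bits n => 1 : R) j b D = 1.
Proof. by rewrite /forced_avg sumr_const card_bits natrX divff // expf_neq0. Qed.

Lemma disjoint_law_sum (R : realType) n : \sum_Z \sum_(Y : bits n) disjoint_law R Z Y = 1.
Proof.
transitivity (disjoint_avg (fun _ : bits n => 1 : R) (fun=> 1)).
  by rewrite disjoint_avg_law; apply: eq_bigr => Z _; apply: eq_bigr => Y _; rewrite !mulr1.
rewrite /disjoint_avg /mask_weight; under eq_bigr do rewrite !mask_avg1 mulr1.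
by rewrite sumr_const card_bits natrX divff // expf_neq0.
Qed.

Lemma unique_law_sum (R : realType) n : (0 < n)%N ->
  \sum_Z \sum_(Y : bits n) unique_law R Z Y = 1.
Proof.
move=> n0; transitivity (unique_avg (fun _ : bits n => 1 : R) (fun=> 1)).
  by rewrite unique_avg_law; apply: eq_bigr => Z _; apply: eq_bigr => Y _; rewrite !mulr1.
rewrite /unique_avg; under eq_bigr do under eq_bigr do rewrite !forced_avg1 mulr1.
under eq_bigr do rewrite sumr_const card_bits.
rewrite sumr_const card_ord -[X in X / _]mulr_natl natrX divff //.
by rewrite mulf_neq0 ?expf_neq0 // pnatr_eq0 -lt0n.
Qed.

Lemma disjoint_law_support (R : realType) n (Z Y : bits n) :
  disjoint_law R Z Y != 0 -> forall j, ~~ (Z j && Y j).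
Proof.
move=> h j; apply: contra_neqN h => /andP[Zj Yj].
rewrite /disjoint_law /disjoint_avg big1 ?mul0r // => D _; rewrite /mask_weight.
case: (boolP (D j)) => Dj; [suff -> : mask_avg (point R Y) (negb_bits D) = 0
  by rewrite mulr0 | suff -> : mask_avg (point R Z) D = 0 by rewrite mul0r].
- rewrite /mask_avg big1 ?mul0r // => v _; rewrite /point; case: eqP => // E.
  by move: Yj; rewrite -E !ffunE Dj andbF.
- rewrite /mask_avg big1 ?mul0r // => v _; rewrite /point; case: eqP => // E.
  by move: Zj; rewrite -E !ffunE (negbTE Dj) andbF.
Qed.

Lemma unique_law_support (R : realType) n (Z Y : bits n) :
  unique_law R Z Y != 0 -> exists j, forall k, Z k && Y k = (k == j).
Proof.
move=> h; apply: contrapT => none; case/eqP: h.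
rewrite /unique_law /unique_avg big1 ?mul0r // => j _; rewrite big1 // => D _.
rewrite /forced_avg; apply/eqP; rewrite mulf_eq0; apply/orP.
have [[u Eu]|nu] := pselect (exists u, upd (mask D u) j true = Z); last first.
  left; rewrite big1 ?mul0r // => u _; rewrite /point; case: eqP => // Eu.
  by case: nu; exists u.
right; rewrite big1 ?mul0r // => v _; rewrite /point; case: eqP => // Ev.
case: none; exists j => k; rewrite -Eu -Ev !updE.
by case: eqP => // _; rewrite !ffunE; case: (D k); rewrite ?andbF.
Qed.

Definition marginal (R : realType) n (Y : bits n) : R := \sum_Z disjoint_law R Z Y.

(** Where the marginal is zero the quotient is 0, so the total mass is then 0; [marginalM] holds all
    the same. *)
Definition conditional (R : realType) n (Z Y : bits n) : R :=
  disjoint_law R Z Y / marginal R Y.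

Lemma marginal_ge0 (R : realType) n (Y : bits n) : 0 <= marginal R Y.
Proof. by apply: sumr_ge0 => Z _; apply: disjoint_law_ge0. Qed.

Lemma conditional_ge0 (R : realType) n (Z Y : bits n) : 0 <= conditional R Z Y.
Proof. by rewrite divr_ge0 ?disjoint_law_ge0 ?marginal_ge0. Qed.

Lemma marginalM (R : realType) n (Z Y : bits n) :
  marginal R Y * conditional R Z Y = disjoint_law R Z Y.
Proof.
rewrite /conditional; have [m0|m0] := eqVneq (marginal R Y) 0; last first.
  by rewrite mulrC divfK.
rewrite m0 mul0r; have /eqP := m0; rewrite psumr_eq0 => [|Z' _].
  by move=> /allP/(_ Z (mem_index_enum _))/eqP ->.
exact: disjoint_law_ge0.
Qed.

Lemma conditional_sum (R : realType) n (Y : bits n) :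
  \sum_Z conditional R Z Y = (marginal R Y != 0)%:R.
Proof.
rewrite -mulr_suml -/(marginal R Y); have [->|m0] := eqVneq; first by rewrite mul0r.
by rewrite divff.
Qed.

Lemma conditional_sum_le1 (R : realType) n (Y : bits n) : \sum_Z conditional R Z Y <= 1.
Proof. by rewrite conditional_sum; case: (_ != _). Qed.

Section Star.
Variables (R : realType) (s n : nat) (i0 i : 'I_s).
Hypothesis i0i : i != i0.
Local Notation V := (bits n).

(** Given the input of the centre [i0] the other players are independent; this factor gathers those
    outside the pair formed by [i] and the centre. *)
Definition bystanders (x : {ffun 'I_s -> V}) : R :=
  \prod_(k | (k != i0) && (k != i)) conditional R (x k) (x i0).

Lemma bystanders_ge0 x : 0 <= bystanders x.
Proof. by apply: prodr_ge0 => k _; apply: conditional_ge0. Qed.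

Lemma bystanders_upd x a : bystanders (upd x i a) = bystanders x.
Proof.
apply: eq_bigr => k /andP[_ /negbTE ki].
by rewrite !updE ki [i0 == i]eq_sym (negbTE i0i).
Qed.

Lemma sum_bystanders_le (b : V) :
  \sum_(x : {ffun 'I_s -> V} | x i0 == b) bystanders x <= #|{: V}|%:R.
Proof.
pose f k (a : V) : R := if k == i0 then (a == b)%:R else
  if k == i then 1 else conditional R a b.
rewrite big_mkcond (eq_bigr (fun x : {ffun 'I_s -> V} => \prod_k f k (x k))); last first.
  move=> x _; rewrite (bigD1 i0) //= /f eqxx (bigD1 i) //= (negbTE i0i) eqxx mul1r.
  case: eqP => [xb|_]; last by rewrite mul0r.
  rewrite mul1r; apply: eq_bigr => k /andP[/negbTE -> /negbTE ->].
  by rewrite xb.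
rewrite -(bigA_distr_bigA f) /= (bigD1 i0) //= (bigD1 i) //=.
have -> : \sum_a f i0 a = 1.
  by rewrite (bigD1 b) //= /f !eqxx big1 ?addr0 // => a /negbTE ->.
have -> : \sum_a f i a = #|{: V}|%:R.
  by rewrite (eq_bigr (fun=> 1)) ?sumr_const // => a _; rewrite /f (negbTE i0i) eqxx.
rewrite mul1r ler_piMr //; apply: prodr_ile1 => k /andP[/negbTE k0 /negbTE ki].
rewrite /f k0 ki conditional_sum_le1 andbT; apply: sumr_ge0 => a _.
exact: conditional_ge0.
Qed.

(** For player [i] the rectangle is a set [A]; on the other side, averaging over the bystanders
    leaves a function [g] of the centre's input with values in [0, 1]. The two-party corruption
    bound applies to [A] and [g]. *)
Lemma star_rectangle (E : pred {ffun 'I_s -> V}) : (0 < n)%N -> rectangle i E ->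
  \sum_(x | E x) (disjoint_law R (x i) (x i0) - 20 / 3 * unique_law R (x i) (x i0))
     * bystanders x <= 9 * expR (- (bias_rate R * (n%:R / 40))).
Proof.
move=> n0 rE; pose w (a b : V) := disjoint_law R a b - 20 / 3 * unique_law R a b.
pose A (a : V) : R := [exists x, E x && (x i == a)]%:R.
pose B (x : {ffun 'I_s -> V}) : R := [exists a, E (upd x i a)]%:R.
pose g (b : V) : R :=
  (\sum_(x : {ffun 'I_s -> V} | x i0 == b) B x * bystanders x) / #|{: V}|%:R.
have V0 : 0 < #|{: V}|%:R :> R by rewrite ltr0n card_bits expn_gt0.
have A01 a : 0 <= A a <= 1 by rewrite ler0n lern1; case: [exists _, _].
have g01 b : 0 <= g b <= 1.
  rewrite divr_ge0 ?ler_pdivrMr ?mul1r ?(ltW V0) //=; last first.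
    by apply: sumr_ge0 => x _; rewrite mulr_ge0 ?bystanders_ge0.
  apply: le_trans (sum_bystanders_le b); apply: ler_sum => x _.
  by rewrite ler_piMl ?bystanders_ge0 // /B; case: [exists _, _].
apply: le_trans (corruption n0 A01 g01).
rewrite disjoint_avg_law unique_avg_law mulr_sumr -sumrB.
rewrite -(ler_pM2l V0) big_mkcond -(sum_upd _ i) exchange_big /= mulr_sumr.
apply: ler_sum => a _; rewrite mulr_sumr -sumrB mulr_sumr.
rewrite (partition_big (fun x : {ffun 'I_s -> V} => x i0) predT) //=.
apply: ler_sum => b _.
have -> : #|{: V}|%:R * (disjoint_law R a b * (A a * g b) -
     20 / 3 * (unique_law R a b * (A a * g b))) =
   \sum_(x : {ffun 'I_s -> V} | x i0 == b) w a b * A a * (B x * bystanders x).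
  by rewrite -mulr_sumr /g /w; field; rewrite gt_eqF.
rewrite le_eqVlt; apply/orP; left; apply/eqP; apply: eq_bigr => x /eqP xb.
rewrite bystanders_upd !updE eqxx [i0 == i]eq_sym (negbTE i0i) xb -/(w a b).
have -> : E (upd x i a) = [exists x, E x && (x i == a)] && [exists a, E (upd x i a)].
  apply/idP/andP => [h|[/existsP[x' /andP[Ex' /eqP x'a]] /existsP[a' Ea']]].
    split; apply/existsP; last by exists a.
    by exists (upd x i a); rewrite h updE !eqxx.
  by have := rE _ _ Ex' Ea'; rewrite upd_upd x'a.
rewrite /A /B; set q := bystanders x.
by case: [exists _, _]; case: [exists _, _] => /=; ring.
Qed.
End Star.

(** All players except the centre negate their bits, so a coordinate contributes exactly when the
    centre has a 1 and nobody else does. *)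
Definition star_row s n (i0 i : 'I_s) (v : bits n) : 'rV['F_2]_n :=
  \row_j ((if i == i0 then v j else ~~ v j)%:R).

(** When the other players are disjoint from the centre every one of its bits counts; a single
    intersection removes one term and flips the value. *)
Definition parity n (v : bits n) : 'F_2 := \sum_j (v j)%:R.

Lemma star_ip s n (i0 : 'I_s) (x : {ffun 'I_s -> bits n}) :
  inner_product (fun i => star_row i0 i (x i)) =
  \sum_j (x i0 j && [forall k, (k != i0) ==> ~~ x k j])%:R.
Proof.
apply: eq_bigr => j _; rewrite (bigD1 i0) //= mxE eqxx.
case: (x i0 j); last by rewrite mul0r.
rewrite mul1r /=; case: (boolP [forall k, _]) => [/forallP h|/forallPn[k]].
  rewrite big1 // => k k0; have := h k; rewrite mxE k0 (negbTE k0) /= => ->.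
  by [].
rewrite negb_imply negbK => /andP[k0 xk].
by rewrite (bigD1 k) //= mxE (negbTE k0) xk mul0r.
Qed.

Lemma star_ip_disjoint s n (i0 : 'I_s) (x : {ffun 'I_s -> bits n}) :
  (forall k j, k != i0 -> ~~ (x k j && x i0 j)) ->
  inner_product (fun i => star_row i0 i (x i)) = parity (x i0).
Proof.
move=> h; rewrite star_ip; apply: eq_bigr => j _.
case: (boolP (x i0 j)) => // yj; congr (_%:R); rewrite /=.
case: (boolP [forall k, _]) => // /forallPn[k]; rewrite negb_imply negbK => /andP[k0 xk].
by have := h k j k0; rewrite xk yj.
Qed.

Lemma star_ip_unique s n (i0 i : 'I_s) (x : {ffun 'I_s -> bits n}) j0 : i != i0 ->
  (forall k j, k != i0 -> k != i -> ~~ (x k j && x i0 j)) ->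
  (forall j, x i j && x i0 j = (j == j0)) ->
  inner_product (fun i => star_row i0 i (x i)) + 1 = parity (x i0).
Proof.
move=> ii0 h u; rewrite star_ip /parity (bigD1 j0) //= [RHS](bigD1 j0) //=.
have /andP[xj yj] : x i j0 && x i0 j0 by rewrite u eqxx.
rewrite yj; case: (boolP [forall k, _]) => [/forallP/(_ i)|_]; first by rewrite ii0 xj.
rewrite /= add0r addrC; congr (_ + _); apply: eq_bigr => j jj.
case: (boolP (x i0 j)) => // yj'; congr (_%:R); rewrite /=.
case: (boolP [forall k, _]) => // /forallPn[k]; rewrite negb_imply negbK => /andP[k0 xk].
have [ki|ki] := eqVneq k i; last by have := h k j k0 ki; rewrite xk yj'.
by have := u j; rewrite -ki xk yj' (negbTE jj).
Qed.

Lemma F2_zero_one (a : 'F_2) : (a == 0) || (a == 1).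
Proof. by case: a => [[|[|m]] hm]. Qed.

Definition corruption_rate (R : realType) : R := bias_rate R / 40.

Lemma corruption_rate_gt0 (R : realType) : 0 < corruption_rate R.
Proof. by rewrite divr_gt0 ?bias_rate_gt0. Qed.

(** The advantage is [11/12 - 20/3 * 1/12 = 13/36], rounded down to 1/3; then [54 = 3 * 2 * 9],
    where 9 comes from [corruption]. *)
Lemma ip_two_cost (R : realType) s n (P : protocol R s 'rV['F_2]_n 'F_2) :
  (2 <= s)%N -> (0 < n)%N -> correct 12^-1 (ip_problem 2 s n) P ->
  (6 * ln 5 : R)^-1 * s.-1%:R * (corruption_rate R * n%:R - ln 54) <= (cost P)%:R.
Proof.
move=> s2 n0 cP; have s0 : (0 < s)%N by exact: ltnW.
pose i0 : 'I_s := Ordinal s0.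
pose T := single_tester P (star_row i0)
  (fun (x : {ffun 'I_s -> bits n}) a => a == parity (x i0)).
pose eta : R := 9 * expR (- (corruption_rate R * n%:R)).
have eta0 : 0 < eta by rewrite mulr_gt0 // expR_gt0.
pose F0 (x : {ffun 'I_s -> bits n}) : R :=
  marginal R (x i0) * \prod_(k | k != i0) conditional R (x k) (x i0).
pose G i (x : {ffun 'I_s -> bits n}) : R :=
  20 / 3 * unique_law R (x i) (x i0) * bystanders R i0 i x.
have F0_ge0 x : 0 <= F0 x.
  by rewrite mulr_ge0 ?marginal_ge0 ?prodr_ge0 // => k _; apply: conditional_ge0.
have F0E i x : i != i0 -> F0 x = disjoint_law R (x i) (x i0) * bystanders R i0 i x.
  by move=> ii0; rewrite /F0 (bigD1 i) //= mulrA marginalM.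
have F0_sum : \sum_x F0 x = 1.
  rewrite (partition_big (fun x : {ffun 'I_s -> bits n} => x i0) predT) //=.
  rewrite -(disjoint_law_sum R n) exchange_big; apply: eq_bigr => Y _ /=.
  rewrite -/(marginal R Y).
  transitivity (marginal R Y * \sum_(x : {ffun 'I_s -> bits n} | x i0 == Y)
      \prod_(k | k != i0) conditional R (x k) Y).
    by rewrite mulr_sumr; apply: eq_bigr => x /eqP <-.
  have [->|mY] := eqVneq (marginal R Y) 0; first by rewrite mul0r.
  rewrite -[RHS]mulr1; congr (_ * _).
  pose f k (a : bits n) : R := if k == i0 then (a == Y)%:R else conditional R a Y.
  rewrite big_mkcond (eq_bigr (fun x : {ffun 'I_s -> bits n} => \prod_k f k (x k))).
    rewrite -(bigA_distr_bigA f) big1 // => k _; rewrite /f; case: (eqVneq k i0) => _.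
      by rewrite (bigD1 Y) //= eqxx big1 ?addr0 // => a /negbTE ->.
    by rewrite conditional_sum mY.
  move=> x _; rewrite [RHS](bigD1 i0) //= /f eqxx; case: (eqVneq (x i0) Y) => _;
    last by rewrite mul0r.
  by rewrite mul1r; apply: eq_bigr => k /negbTE ->.
have G_ge0 i x : 0 <= G i x.
  by rewrite mulr_ge0 ?bystanders_ge0 // mulr_ge0 ?unique_law_ge0.
have V0 : 0 < #|{: bits n}|%:R :> R by rewrite ltr0n card_bits expn_gt0.
have G_sum i : i != i0 -> \sum_x G i x <= 20 / 3.
  move=> ii0; rewrite -(ler_pM2l V0) -(sum_upd _ i) exchange_big /=.
  apply: le_trans (_ : \sum_a \sum_b 20 / 3 * unique_law R a b * #|{: bits n}|%:R <= _).
    apply: ler_sum => a _.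
    rewrite (partition_big (fun x : {ffun 'I_s -> bits n} => x i0) predT) //=.
    apply: ler_sum => b _.
    rewrite (eq_bigr (fun x : {ffun 'I_s -> bits n} => 20 / 3 * unique_law R a b *
      bystanders R i0 i x)).
      rewrite -mulr_sumr; apply: ler_wpM2l (sum_bystanders_le _ _ _) => //.
      by rewrite mulr_ge0 ?unique_law_ge0.
    move=> x /eqP xb; rewrite /G bystanders_upd // !updE eqxx [i0 == i]eq_sym.
    by rewrite (negbTE ii0) xb.
  under eq_bigr do (rewrite -mulr_suml -mulr_sumr).
  by rewrite -mulr_suml -mulr_sumr unique_law_sum // mulr1 mulrC.
have cardB : #|[set~ i0]| = s.-1 by rewrite cardsC1 card_ord.
have := @tester_cost R s (bits n) 'F_2 T (cost P) [set~ i0]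
  (fun i x => F0 x - G i x) G F0 eta (3^-1).
rewrite card_unit expr1n mulr1 cardB => H.
have inB i : i \in [set~ i0] -> i != i0 by rewrite !inE.
apply: le_trans (H _ _ _ _ _ _ _ _ _ _ _) => //.
- have ln5 : 0 < ln 5 :> R by rewrite ln_gt0 // ltr1n.
  have -> : 3^-1 / (2 * ln 5) = (6 * ln 5)^-1 :> R by field; rewrite gt_eqF.
  apply: ler_wpM2l; first by rewrite mulr_ge0 ?invr_ge0 ?mulr_ge0 ?(ltW ln5).
  have -> : 3^-1 / (2 * eta) = expR (corruption_rate R * n%:R) / 54.
    by rewrite /eta expRN; field; rewrite gt_eqF // expR_gt0.
  by rewrite ln_div ?posrE ?expR_gt0 // expRK.
- exact: single_tester_cost.
- move=> i /inB ii0 w x a o; rewrite /T /=; congr (_ == parity _).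
  by rewrite updE eq_sym (negbTE ii0).
- by rewrite F0_sum.
- move=> i E /inB ii0 rE.
  rewrite (eq_bigr (fun x : {ffun 'I_s -> bits n} => (disjoint_law R (x i) (x i0) -
     20 / 3 * unique_law R (x i) (x i0)) * bystanders R i0 i x)).
    apply: le_trans (star_rectangle R ii0 n0 rE) _.
    by rewrite /eta /corruption_rate mulrA mulrAC.
  by move=> x _; rewrite (F0E i) // mulrBl.
- move=> i /inB ii0.
  have prom (x : {ffun 'I_s -> bits n}) : promise (ip_problem 2 s n) (fun k => star_row i0 k (x k)).
    exact: F2_zero_one.
  have bnz (x : {ffun 'I_s -> bits n}) : bystanders R i0 i x != 0 ->
      forall k j, k != i0 -> k != i ->
      ~~ (x k j && x i0 j).
    move=> /prodf_neq0 h k j k0 ki; have := h k; rewrite k0 ki => /(_ isT).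
    rewrite /conditional mulf_eq0 negb_or => /andP[/disjoint_law_support/(_ j) //].
  have lo : 11 / 12 <= \sum_x F0 x * accept_pr T x.
    have -> : 11 / 12 = \sum_x F0 x * (11 / 12) :> R by rewrite -mulr_suml F0_sum mul1r.
    apply: ler_sum => x _.
    have [->|Fx] := eqVneq (F0 x) 0; first by rewrite !mul0r.
    apply: ler_wpM2l => //; have -> : 11 / 12 = 1 - 12^-1 :> R by lra.
    apply: single_tester_accept cP (prom x) _; rewrite /= star_ip_disjoint //.
    move=> k j k0; move: Fx; rewrite (F0E i) // mulf_eq0 negb_or => /andP[d b].
    have [->|ki] := eqVneq k i; first exact: (disjoint_law_support d).
    exact: bnz b k j k0 ki.
  have up : \sum_x G i x * accept_pr T x <= 5 / 9.
    apply: le_trans (_ : \sum_x G i x * 12^-1 <= _); last first.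
      by rewrite -mulr_suml; have := G_sum i ii0; lra.
    apply: ler_sum => x _; have [->|] := eqVneq (G i x) 0; first by rewrite !mul0r.
    rewrite {1}/G mulf_eq0 negb_or mulf_eq0 negb_or => /andP[/andP[_ ux] b].
    have [j0 uj] := unique_law_support ux.
    apply: ler_wpM2l => //.
    apply: single_tester_reject cP (prom x) _ => /=.
    rewrite -(star_ip_unique ii0 (bnz x b) uj) -subr_eq0 opprD addrA subrr add0r.
    by rewrite oppr_eq0 oner_eq0.
  lra.
Qed.

(** * Hamming weight *)

Definition bits_row n (x : bits n) : 'rV['F_2]_n := \row_j (x j)%:R.

Lemma hamming_weightE n (z : 'rV['F_2]_n) :
  hamming_weight z = (\sum_j (z ord0 j == 1%R))%N.
Proof.
rewrite /hamming_weight -sum1_card big_mkcond; apply: eq_bigr => j _.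
by rewrite inE; case: (_ == _).
Qed.

Lemma hamming_weight_row_mx m n (a : 'rV['F_2]_m) (b : 'rV['F_2]_n) :
  hamming_weight (row_mx a b) = (hamming_weight a + hamming_weight b)%N.
Proof.
rewrite !hamming_weightE big_split_ord /=; congr (_ + _)%N; apply: eq_bigr => j _.
- by rewrite row_mxEl.
- by rewrite row_mxEr.
Qed.

Lemma hamming_weight_bits n (x : bits n) : hamming_weight (bits_row x) = (\sum_j x j)%N.
Proof.
by rewrite hamming_weightE; apply: eq_bigr => j _; rewrite mxE; case: (x j).
Qed.

Lemma hamming_weight0 n : hamming_weight (0 : 'rV['F_2]_n) = 0%N.
Proof. by apply: eq_card0 => j; rewrite inE mxE. Qed.

Lemma hamming_weight1 n : hamming_weight (const_mx 1 : 'rV['F_2]_n) = n.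
Proof.
by rewrite -[RHS](card_ord n); apply: eq_card => j; rewrite !inE mxE eqxx.
Qed.

Section Hamming.
Variables (R : realType) (s N K M k : nat).
Local Notation n := (N + (N + (N + (K + M))))%N.
Local Notation V := 'rV['F_2]_n.
Hypotheses (s_ge2 : (2 <= s)%N) (N_gt0 : (0 < N)%N) (kE : k.+2 = (2 * N + K)%N).

(* Each pair of bits becomes three bits, of total weight 2 unless both bits are
   1, in which case the weight is 0. *)
Definition first_code (Z : bits N) : V :=
  row_mx (bits_row Z) (row_mx (bits_row (negb_bits Z)) 0).

(** The blocks of [K] ones and [M] zeros adjust the weight and the length. *)
Definition second_code (Y : bits N) : V :=
  row_mx (bits_row Y) (row_mx 0 (row_mx (bits_row (negb_bits Y)) (row_mx (const_mx 1) 0))).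

Lemma code_weight Z Y :
  (hamming_weight (first_code Z + second_code Y) + 2 * \sum_j (Z j && Y j))%N = k.+2.
Proof.
rewrite /first_code /second_code add_row_mx add_row_mx addr0 add0r.
rewrite !hamming_weight_row_mx hamming_weight1 hamming_weight0 addn0 kE.
have -> : bits_row Z + bits_row Y = bits_row [ffun j => Z j (+) Y j].
  by apply/rowP => j; rewrite !mxE ffunE; case: (Z j); case: (Y j); apply/val_inj.
rewrite !hamming_weight_bits.
have arith (a b c d e : nat) : (a + (b + (c + e)) + d = a + (b + c) + d + e)%N by lia.
suff -> : (2 * N = \sum_(j < N) [ffun j => Z j (+) Y j] j + (\sum_(j < N) negb_bits Z j +
    \sum_(j < N) negb_bits Y j) + 2 * \sum_(j < N) (Z j && Y j))%N by exact: arith.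
rewrite -{1}(card_ord N) -sum1_card !big_distrr -!big_split /=; apply: eq_bigr => j _.
by rewrite !ffunE; case: (Z j); case: (Y j).
Qed.

Definition code_law (law : bits N -> bits N -> R) (z : V) : R :=
  \sum_Z \sum_Y law Z Y * (first_code Z + second_code Y == z)%:R.

Lemma code_law_ge0 law z : (forall Z Y, 0 <= law Z Y) -> 0 <= code_law law z.
Proof. by move=> h; apply: sumr_ge0 => Z _; apply: sumr_ge0 => Y _; rewrite mulr_ge0. Qed.

Lemma code_law_sum law : \sum_z code_law law z = \sum_Z \sum_Y law Z Y.
Proof.
rewrite exchange_big; apply: eq_bigr => Z _; rewrite exchange_big; apply: eq_bigr => Y _.
rewrite /= -mulr_sumr (bigD1 (first_code Z + second_code Y)) //= eqxx big1 ?addr0 ?mulr1 //.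
by move=> z; rewrite eq_sym => /negbTE ->.
Qed.

Lemma code_law_support law z : code_law law z != 0 ->
  exists Z Y, law Z Y != 0 /\ z = first_code Z + second_code Y.
Proof.
move=> h; apply: contrapT => none; case/eqP: h.
rewrite /code_law big1 // => Z _; rewrite big1 // => Y _.
have [->|l] := eqVneq (law Z Y) 0; first by rewrite mul0r.
by case: eqP => [E|_]; [case: none; exists Z, Y | rewrite mulr0].
Qed.

(** A sharing of a code word is the pair of the two codes shifted by [r] and [- r]; for each fixed
    [r] the sets [A] and [B] become sets of Z and of Y. *)
Lemma code_law_rectangle law (A B : pred V) :
  \sum_(a | A a) \sum_(b | B b) code_law law (a + b) =
  \sum_r \sum_Z \sum_Y law Z Y * ((A (first_code Z + r))%:R * (B (second_code Y - r))%:R).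
Proof.
transitivity (\sum_a \sum_b \sum_Z \sum_Y law Z Y *
    (first_code Z + second_code Y == a + b)%:R * ((A a)%:R * (B b)%:R)).
  rewrite big_mkcond; apply: eq_bigr => a _; rewrite [in LHS]big_mkcond.
  case: (A a); last first.
    rewrite big1 // => b _; rewrite big1 // => Z _; rewrite big1 // => Y _.
    by rewrite mul0r mulr0.
  apply: eq_bigr => b _; rewrite /code_law; case: (B b).
    by apply: eq_bigr => Z _; apply: eq_bigr => Y _; rewrite !mulr1.
  by rewrite big1 // => Z _; rewrite big1 // => Y _; rewrite !mulr0.
transitivity (\sum_Z \sum_Y \sum_a \sum_b law Z Y *
    (first_code Z + second_code Y == a + b)%:R * ((A a)%:R * (B b)%:R)).
  under eq_bigr do rewrite exchange_big; rewrite exchange_big; apply: eq_bigr => Z _.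
  under eq_bigr do rewrite exchange_big; rewrite exchange_big; apply: eq_bigr => Y _.
  by [].
rewrite [RHS]exchange_big; apply: eq_bigr => Z _; rewrite [RHS]exchange_big.
apply: eq_bigr => Y _; rewrite (reindex_inj (addrI (first_code Z))).
apply: eq_bigr => r _; rewrite (bigD1 (second_code Y - r)) //= big1 ?addr0.
  by rewrite addrACA subrr addr0 eqxx mulr1.
move=> b br; case: eqP => [E|_]; last by rewrite mulr0 mul0r.
case/eqP: br; move: E; rewrite -addrA => /addrI ->; rewrite addrAC subrr add0r //.
Qed.

Lemma code_law_discrepancy (A B : pred V) :
  \sum_(a | A a) \sum_(b | B b) (code_law (@disjoint_law R N) (a + b)
      - 20 / 3 * code_law (@unique_law R N) (a + b))
    <= #|{: V}|%:R * (9 * expR (- (corruption_rate R * N%:R))).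
Proof.
under eq_bigr do rewrite sumrB -mulr_sumr; rewrite sumrB -mulr_sumr.
rewrite !code_law_rectangle mulr_sumr -sumrB.
have -> : #|{: V}|%:R * (9 * expR (- (corruption_rate R * N%:R))) =
    \sum_(r : V) 9 * expR (- (bias_rate R * (N%:R / 40))).
  rewrite sumr_const -[RHS]mulr_natl; congr (_ * (_ * expR (- _))).
  by rewrite /corruption_rate mulrAC -mulrA.
apply: ler_sum => r _.
have := @corruption R N (fun Z => (A (first_code Z + r))%:R)
  (fun Y => (B (second_code Y - r))%:R) N_gt0.
rewrite disjoint_avg_law unique_avg_law; apply => [Z|Y].
- by case: (A _); rewrite ?ler01 ?lexx.
- by case: (B _); rewrite ?ler01 ?lexx.
Qed.

Lemma ham_cost (P : protocol R s V nat) : correct 12^-1 (ham_problem s n k) P ->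
  s%:R / 3 <= (cost P)%:R :> R /\
  (6 * ln 5 : R)^-1 * s%:R * (corruption_rate R * N%:R - ln 54) <= (cost P)%:R.
Proof.
move=> cP.
pose T := single_tester P (fun (_ : 'I_s) (a : V) => a) (fun _ a => a == k.+2).
pose eta : R := 9 * expR (- (corruption_rate R * N%:R)).
have eta0 : 0 < eta by rewrite mulr_gt0 // expR_gt0.
pose g0 := code_law (@disjoint_law R N).
pose g1 z := 20 / 3 * code_law (@unique_law R N) z.
have g0_sum : \sum_z g0 z = 1 by rewrite code_law_sum disjoint_law_sum.
have g1_sum : \sum_z g1 z = 20 / 3.
  by rewrite -mulr_sumr code_law_sum unique_law_sum // mulr1.
have hw0 z : g0 z != 0 -> hamming_weight z = k.+2.
  move=> /code_law_support[Z [Y [/disjoint_law_support d ->]]].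
  have := code_weight Z Y; rewrite big1 ?muln0 ?addn0 // => j _.
  by rewrite (negbTE (d j)).
have hw1 z : g1 z != 0 -> hamming_weight z = k.
  rewrite /g1 mulf_eq0 negb_or => /andP[_].
  move=> /code_law_support[Z [Y [/unique_law_support [j u] ->]]].
  have := code_weight Z Y; rewrite (bigD1 j) //= u eqxx big1.
    by rewrite addn0 addn2 => -[].
  by move=> i /negbTE ij; rewrite u ij.
have := @xor_cost R s V nat T (cost P) (fun z => g0 z - g1 z) g0 g1 (fun=> 12^-1)
  eta (3^-1) (11 / 12) s_ge2.
rewrite card_unit mul1n expr1n mulr1 sumrB g0_sum g1_sum => H.
have [] := H.
- exact: single_tester_cost.
- by [].
- by move=> z; apply: code_law_ge0 => Z Y; apply: disjoint_law_ge0.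
- by move=> z; rewrite mulr_ge0 //; apply: code_law_ge0 => Z Y; apply: unique_law_ge0.
- by [].
- by [].
- move=> x /hw0 hx; have -> : 11 / 12 = 1 - 12^-1 :> R by lra.
  by apply: single_tester_accept cP _ _ => /=; rewrite hx eqxx ?orbT.
- move=> x /hw1 hx; apply: single_tester_reject cP _ _ => /=; rewrite hx ?eqxx //.
  by rewrite ltn_eqF // ltnS leqnSn.
- by rewrite -mulr_suml g1_sum; lra.
- by [].
- by rewrite invr_gt0.
(* The weight has sum [1 - 20/3 <= 0], so the bound from silent players is available. *)
move=> h1 h2; split; first by apply: h1; lra.
have {}h2 := h2 eta0 (@code_law_discrepancy).
have ln5 : 0 < ln 5 :> R by rewrite ln_gt0 // ltr1n.
apply: le_trans h2.
have -> : 3^-1 / (2 * ln 5) = (6 * ln 5)^-1 :> R by field; rewrite gt_eqF.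
apply: ler_wpM2l; first by rewrite mulr_ge0 ?invr_ge0 ?mulr_ge0 ?(ltW ln5).
have -> : 3^-1 / (2 * eta) = expR (corruption_rate R * N%:R) / 54.
  by rewrite /eta expRN; field; rewrite gt_eqF // expR_gt0.
by rewrite ln_div ?posrE ?expR_gt0 // expRK.
Qed.
End Hamming.

Lemma ham_cost_le (R : realType) s n k N (P : protocol R s 'rV['F_2]_n nat) :
  (2 <= s)%N -> (0 < N)%N -> (2 * N <= k.+2)%N -> (N + k.+2 <= n)%N ->
  correct 12^-1 (ham_problem s n k) P ->
  s%:R / 3 <= (cost P)%:R :> R /\
  (6 * ln 5 : R)^-1 * s%:R * (corruption_rate R * N%:R - ln 54) <= (cost P)%:R.
Proof.
move=> s2 N0 Nk Nn.
have nE : n = (N + (N + (N + ((k.+2 - 2 * N) + (n - (N + k.+2))))))%N by lia.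
move: (n - _)%N nE => M nE; subst n => cP.
by apply: ham_cost s2 N0 _ P cP; lia.
Qed.

(** * Asymptotic bounds *)

Lemma matrix_cc (R : realType) :
  exists c : R, exists n0 : nat, 0 < c /\
     forall p s n : nat, prime p -> (2 <= s)%N -> (n0 <= n.+1)%N ->
       let bound : \bar R := (c * s%:R * n.+1%:R ^+ 2 * ln p%:R)%:E in
       [/\ (bound <= rand_cc 40^-1 (rank_problem p s n))%E,
           (bound <= rand_cc 40^-1 (inverse_problem p s n))%E &
           forall b : 'cV['F_p]_n.+1, b != 0 ->
             (bound <= rand_cc 40^-1 (solve_problem s b))%E].
Proof.
have c0 := matrix_const_gt0 R.
(* Bordering uses up one dimension; the factor 2 covers [n.+1 ^ 2 <= 2 * n ^ 2]. *)
exists (matrix_const R / 2), 9%N; split; first by rewrite divr_gt0.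
move=> p s n pp s2; rewrite ltnS => n8 bound.
have L0 : 0 <= ln p%:R :> R by rewrite ln_ge0 // ler1n prime_gt0.
have cs : 0 <= matrix_const R * s%:R by rewrite mulr_ge0 // ltW.
have le1 : matrix_const R / 2 * s%:R * n.+1%:R ^+ 2 * ln p%:R <=
    matrix_const R * s%:R * n.+1%:R ^+ 2 * ln p%:R.
  apply: ler_wpM2r => //; apply: ler_wpM2r; first exact: sqr_ge0.
  by rewrite mulrAC ler_pdivrMr // ler_peMr // ler1n.
have le2 : matrix_const R / 2 * s%:R * n.+1%:R ^+ 2 * ln p%:R <=
    matrix_const R * s%:R * n%:R ^+ 2 * ln p%:R.
  apply: ler_wpM2r => //.
  have -> : matrix_const R / 2 * s%:R * n.+1%:R ^+ 2 =
      matrix_const R * s%:R * (n.+1%:R ^+ 2 / 2) by ring.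
  by apply: ler_wpM2l => //; rewrite ler_pdivrMr // -!natrX -natrM ler_nat; nia.
split => [||b b0]; apply: rand_cc_ge => P cP.
- by apply: le_trans le1 _; apply: rank_cost => //; apply: leqW.
- by apply: le_trans le2 _; apply: inverse_cost.
- by apply: le_trans le2 _; apply: solve_cost cP.
Qed.

Lemma ip_cc (R : realType) :
  exists c : R, exists n0 : nat, 0 < c /\
     forall p s n : nat, prime p -> (2 <= s)%N -> (n0 <= n)%N ->
       ((c * s%:R * n%:R * ln p%:R)%:E <= rand_cc 12^-1 (ip_problem p s n))%E.
Proof.
have pred_half (m : nat) : (2 <= m)%N -> (m <= m.-1 * 2)%N by lia.
have rho0 := corruption_rate_gt0 R; set rho := corruption_rate R in rho0.
have ln5 : 0 < ln 5 :> R by rewrite ln_gt0 // ltr1n.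
have ln2 : 0 < ln 2 :> R by rewrite ln_gt0 // ltr1n.
have ln54 : 0 < ln 54 :> R by rewrite ln_gt0 // ltr1n.
pose c1 : R := (80 * ln 5)^-1.
(* In [rho / 4] one factor 2 pays for [s.-1 >= s / 2] and the other for [ln 54 <= rho * n / 2]. *)
pose c2 : R := (6 * ln 5)^-1 * (rho / 4) / ln 2.
have c1_gt0 : 0 < c1 by rewrite invr_gt0 mulr_gt0 // ltr0n.
have c2_gt0 : 0 < c2.
  have h6 : 0 < (6 * ln 5)^-1 :> R by rewrite invr_gt0 mulr_gt0.
  have h4 : 0 < rho / 4 by rewrite divr_gt0.
  by rewrite /c2 divr_gt0 // mulr_gt0.
exists (Num.min c1 c2), (maxn 72 (Num.truncn (2 * ln 54 / rho)).+1).
split; first by rewrite lt_min c1_gt0.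
move=> p s n pp s2; rewrite geq_max => /andP[n72 nL].
apply: rand_cc_ge => P cP.
have s0 : 0 <= s%:R :> R by [].
have L0 : 0 <= ln p%:R :> R by rewrite ln_ge0 // ler1n prime_gt0.
have cle (c : R) : Num.min c1 c2 <= c ->
    Num.min c1 c2 * s%:R * n%:R * ln p%:R <= c * s%:R * n%:R * ln p%:R.
  by move=> h; do 3!apply: ler_wpM2r => //.
have [p3|p2] := leqP 3 p.
  apply: le_trans (cle c1 _) _; first by rewrite ge_min lexx.
  exact: ip_odd_cost.
have {p2} p2 : p = 2%N by apply/eqP; rewrite eqn_leq -ltnS p2 prime_gt1.
subst p; apply: le_trans (cle c2 _) _; first by rewrite ge_min lexx orbT.
apply: le_trans (ip_two_cost s2 _ cP); last by apply: leq_trans n72.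
have -> : c2 * s%:R * n%:R * ln 2 =
    (6 * ln 5)^-1 * ((s%:R / 2) * (rho / 2 * n%:R)) :> R.
  by rewrite /c2; field; rewrite !gt_eqF.
rewrite -[leRHS]mulrA; apply: ler_wpM2l; first by rewrite invr_ge0 mulr_ge0 // ltW.
have nL' : 2 * ln 54 / rho <= n%:R.
  by apply: ltW; apply: lt_le_trans (truncnS_gt _) _; rewrite ler_nat.
have rho2 : 0 <= rho / 2 by apply: divr_ge0 => //; exact: ltW.
apply: ler_pM; [by rewrite divr_ge0 | by apply: mulr_ge0 | |].
- by rewrite ler_pdivrMr // -natrM ler_nat; exact: pred_half.
- by move: nL'; rewrite ler_pdivrMr // -/rho; lra.
Qed.

Lemma ham_cc (R : realType) (eps : R) : 0 < eps ->
  exists c : R, exists n0 : nat, 0 < c /\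
     forall s n k : nat, (2 <= s)%N -> (n0 <= n)%N ->
       k%:R <= (1 - eps) * n%:R ->
       ((c * s%:R * k%:R)%:E <= rand_cc 12^-1 (ham_problem s n k))%E.
Proof.
have half_le (m : nat) : (m <= 2 * m./2.+1)%N by lia.
have half_ge (m : nat) : (2 * m./2.+1 <= m.+2)%N by lia.
move=> eps0; have rho0 := corruption_rate_gt0 R; set rho := corruption_rate R in rho0.
have ln5 : 0 < ln 5 :> R by rewrite ln_gt0 // ltr1n.
have ln54 : 0 < ln 54 :> R by rewrite ln_gt0 // ltr1n.
pose A : R := (6 * ln 5)^-1.
have A0 : 0 < A by rewrite invr_gt0 mulr_gt0.
pose e : R := Num.min 2^-1 (eps / 2).
have e0 : 0 < e by rewrite /e lt_min invr_gt0 ltr0n /= divr_gt0.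
have D0 : 0 < 1 + 3 * A * ln 54 by rewrite addr_gt0 // mulr_gt0 // mulr_gt0.
(* The second bound plus [3 * A * ln 54] times the first cancels [ln 54], so small [k] needs no
   separate treatment. *)
pose c : R := A * rho * e / (1 + 3 * A * ln 54).
have c0 : 0 < c by apply: divr_gt0 => //; apply: mulr_gt0 => //; apply: mulr_gt0.
(* From [4 <= eps * n] follow [k.+2 < n] and [n - k.+2 >= eps * n / 2]: there is room for the coding
   blocks. *)
exists c, (Num.truncn (4 / eps)).+1; split=> // s n k s2 n4 kn.
apply: rand_cc_ge => P cP.
have [->|k0] := posnP k; first by rewrite mulr0 ler0n.
have n4' : 4 <= eps * n%:R.
  rewrite mulrC -ler_pdivrMr //; apply: ltW.
  by apply: lt_le_trans (truncnS_gt _) _; rewrite ler_nat.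
have k2n : (k.+2 < n)%N.
  by rewrite -(ltr_nat R) -[k.+2]addn2 natrD; lra.
(* The largest block length allowed by the weight and by the length; it is at least [e * k]. *)
set N := minn (k./2.+1) (n - k.+2)%N.
have N0 : (0 < N)%N by rewrite leq_min /= subn_gt0.
have [h1 h2] : s%:R / 3 <= (cost P)%:R :> R /\
    A * s%:R * (rho * N%:R - ln 54) <= (cost P)%:R.
  apply: ham_cost_le s2 N0 _ _ cP.
    by apply: leq_trans (half_ge k); rewrite leq_mul2l geq_minl.
  by rewrite -[leqRHS](subnK (ltnW k2n)) leq_add2r geq_minr.
have eN : e * k%:R <= N%:R.
  have k2 : k%:R <= 2 * k./2.+1%:R :> R by rewrite -natrM ler_nat.
  have nk : eps / 2 * k%:R <= (n - k.+2)%:R.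
    rewrite natrB 1?ltnW // -[k.+2]addn2 natrD.
    have kr : k%:R <= n%:R :> R by rewrite ler_nat; do 3!apply: ltnW.
    have := ler_wpM2l (ltW eps0) kr; lra.
  rewrite /N; case: leqP => _.
    apply: le_trans (_ : 2^-1 * k%:R <= _); last by rewrite ler_pdivrMl.
    by apply: ler_wpM2r => //; rewrite ge_min lexx.
  apply: le_trans nk; apply: ler_wpM2r => //; by rewrite ge_min lexx orbT.
have h3 := ler_wpM2l (ltW (mulr_gt0 (mulr_gt0 (ltr0n R 3) A0) ln54)) h1.
have -> : c * s%:R * k%:R = (A * rho * s%:R * (e * k%:R)) / (1 + 3 * A * ln 54).
  by rewrite /c; field; rewrite gt_eqF.
rewrite ler_pdivrMr //; apply: le_trans (_ : A * rho * s%:R * N%:R <= _).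
  by apply: ler_wpM2l => //; apply: mulr_ge0 => //; exact: ltW (mulr_gt0 A0 rho0).
move: h2 h3; set B := ln 54; lra.
Qed.

Theorem theorem1p2 (R : realType) :
  (exists c : R, exists n0 : nat, 0 < c /\
     forall p s n : nat, prime p -> (2 <= s)%N -> (n0 <= n.+1)%N ->
       let bound : \bar R := (c * s%:R * n.+1%:R ^+ 2 * ln p%:R)%:E in
       [/\ (bound <= rand_cc 40^-1 (rank_problem p s n))%E,
           (bound <= rand_cc 40^-1 (inverse_problem p s n))%E &
           forall b : 'cV['F_p]_n.+1, b != 0 ->
             (bound <= rand_cc 40^-1 (solve_problem s b))%E])
  /\
  (exists c : R, exists n0 : nat, 0 < c /\
     forall p s n : nat, prime p -> (2 <= s)%N -> (n0 <= n)%N ->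
       ((c * s%:R * n%:R * ln p%:R)%:E <= rand_cc 12^-1 (ip_problem p s n))%E)
  /\
  (forall eps : R, 0 < eps ->
     exists c : R, exists n0 : nat, 0 < c /\
     forall s n k : nat, (2 <= s)%N -> (n0 <= n)%N ->
       k%:R <= (1 - eps) * n%:R ->
       ((c * s%:R * k%:R)%:E <= rand_cc 12^-1 (ham_problem s n k))%E).
Proof. split; [exact: matrix_cc | split; [exact: ip_cc | exact: ham_cc]]. Qed.
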